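(* Let $d\in\{2,3\}$, $r>\frac{d+1}{2}$, $\beta_0>0$, $g>0$, and let $(\mathbf u_0,\eta_0)$ with $\mathbf u_0\in H$, $\eta_0$ a real mean-zero scalar function, satisfy $\|(\mathbf u_0,\eta_0)\|_{\beta_0}^2:=\|\mathbf u_0\|_{\beta_0}^2+\|\eta_0\|_{\beta_0}^2<\infty$. Then there is a constant $C>0$ depending only on $d$ such that the complexified inviscid Boussinesq system $$\frac{d\mathbf u}{d\zeta}+B(\mathbf u,\mathbf u)=g\,\mathbb P(\eta\,\mathbf e),\qquad \frac{d\eta}{d\zeta}+\mathbf u\cdot\nabla\eta=0,\qquad \mathbf u(0)=\mathbf u_0,\ \eta(0)=\eta_0,$$ admits a unique solution $(\mathbf u(\zeta),\eta(\zeta))$, holomorphic in $\zeta$, in the region $$\mathcal R=\Big\{\zeta=se^{i\theta}:\ \theta\in[0,2\pi),\ 0<s<\min\Big\{\frac{C\beta_0}{2^rC_W(r)\|(\mathbf u_0,\eta_0)\|_{\beta_0}},\ \frac{2\ln2}{g}\Big\}\Big\}.$$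
   Context: Periodic domain $\Omega=[0,2\pi]^d$; $H$ = real mean-zero divergence-free $L^2$ vector fields, complexified as $H+iH$; scalars are mean-zero and likewise complexified. $\mathbf e$ is the upward unit vector in $\mathbb R^d$, $g$ the gravitational constant. $A=-\Delta$ (Fourier multiplier $|\mathbf k|^2$), $\Lambda=A^{1/2}$. Gevrey norms $\|\mathbf u\|_\beta=\|A^{r/2}e^{\beta A^{1/2}}\mathbf u\|$ and $\|\eta\|_\beta=\|\Lambda^re^{\beta\Lambda}\eta\|$ ($L^2$ norms). $B(\mathbf u,\mathbf v)=\mathbb P(\mathbf u\cdot\nabla\mathbf v)$, $\mathbb P$ the Leray–Helmholtz projection; all nonlinear terms are extended complex-bilinearly. $C_W(r)=\frac{1}{\pi2^{d-1}}\frac{2r-d}{2r-1-d}$. *)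

(* Defs.v *)
From Stdlib Require Import Reals List ZArith.
From Coquelicot Require Import Coquelicot.
Import ListNotations.
Open Scope R_scope.

(** Fourier setting on the torus [0,2pi]^d.
    A wavevector k in Z^d is encoded as [k : nat -> Z] with k j = 0 for j >= d.
    A (complexified) vector field is given by its Fourier coefficients
    [u : Vec -> nat -> C] (u k i = i-th component of the k-th coefficient),
    a scalar field by [eta : Vec -> C]. *)
Definition Vec := nat -> Z.
Definition VField := Vec -> nat -> C.
Definition SField := Vec -> C.

Definition validk (d : nat) (k : Vec) : Prop := forall j, (d <= j)%nat -> k j = 0%Z.
Definition zerok : Vec := fun _ => 0%Z.
Definition vsub (k j : Vec) : Vec := fun m => (k m - j m)%Z.
Definition vneg (k : Vec) : Vec := fun m => (- k m)%Z.

Definition zrange (N : nat) : list Z :=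
  map (fun m => (Z.of_nat m - Z.of_nat N)%Z) (seq 0 (2 * N + 1)).
Fixpoint box (n N : nat) : list Vec :=
  match n with
  | O => [zerok]
  | S n' => flat_map (fun z => map (fun k : Vec => fun j => if Nat.eqb j n' then z else k j)
                                 (box n' N)) (zrange N)
  end.

Definition sumR {A} (l : list A) (f : A -> R) : R := fold_right (fun a s => f a + s) 0 l.
Definition sumC {A} (l : list A) (f : A -> C) : C := fold_right (fun a s => Cplus (f a) s) (RtoC 0) l.
Definition sum_lt (d : nat) (f : nat -> R) : R := sumR (seq 0 d) f.
Definition sumC_lt (d : nat) (f : nat -> C) : C := sumC (seq 0 d) f.

Definition knorm (d : nat) (k : Vec) : R := sqrt (sum_lt d (fun i => IZR (k i) ^ 2)).

(** Gevrey weight |k|^{2r} e^{2 beta |k|} (symbol of (A^{r/2} e^{beta A^{1/2}})^2);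
    set to 0 at k = 0 (all fields considered are mean-zero). *)
Definition gweight (d : nat) (r beta : R) (k : Vec) : R :=
  if Rle_dec (knorm d k) 0 then 0
  else Rpower (knorm d k) (2 * r) * exp (2 * beta * knorm d k).

Definition vsq (d : nat) (u : VField) (k : Vec) : R := sum_lt d (fun i => Cmod (u k i) ^ 2).
Definition ssq (eta : SField) (k : Vec) : R := Cmod (eta k) ^ 2.

(** partial sums of squared L^2 norms (Parseval: ||f||^2 = (2pi)^d sum |f_k|^2) *)
Definition wpartial (d : nat) (w : Vec -> R) (a : Vec -> R) (N : nat) : R :=
  (2 * PI) ^ d * sumR (box d N) (fun k => w k * a k).

Definition wfinite (d : nat) (w a : Vec -> R) : Prop :=
  exists M, forall N, wpartial d w a N <= M.
Definition wnorm2 (d : nat) (w a : Vec -> R) : R :=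
  real (Sup_seq (fun N => Finite (wpartial d w a N))).

Definition gev_fin_v d r beta (u : VField) := wfinite d (gweight d r beta) (vsq d u).
Definition gev_fin_s d r beta (eta : SField) := wfinite d (gweight d r beta) (ssq eta).
Definition gev_pair_norm d r beta (u : VField) (eta : SField) : R :=
  sqrt (wnorm2 d (gweight d r beta) (vsq d u) + wnorm2 d (gweight d r beta) (ssq eta)).

(** membership in the complexified spaces:
    H + iH : mean-zero, divergence-free (k . u_k = 0), supported on Z^d x {0..d-1};
    complexified mean-zero scalars. *)
Definition inH (d : nat) (u : VField) : Prop :=
  (forall k i, ~ (validk d k /\ (i < d)%nat) -> u k i = RtoC 0) /\
  (forall i, u zerok i = RtoC 0) /\
  (forall k, sumC_lt d (fun i => Cmult (RtoC (IZR (k i))) (u k i)) = RtoC 0) /\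
  wfinite d (fun _ => 1) (vsq d u).
Definition inS (d : nat) (eta : SField) : Prop :=
  (forall k, ~ validk d k -> eta k = RtoC 0) /\
  eta zerok = RtoC 0 /\
  wfinite d (fun _ => 1) (ssq eta).

Definition real_v (u : VField) : Prop := forall k i, u (vneg k) i = Cconj (u k i).
Definition real_s (eta : SField) : Prop := forall k, eta (vneg k) = Cconj (eta k).

Definition conv_to (d : nat) (f : Vec -> C) (z : C) : Prop :=
  is_lim_seq (fun N => Re (sumC (box d N) f)) (Re z) /\
  is_lim_seq (fun N => Im (sumC (box d N) f)) (Im z).

(** Fourier coefficient of (u . grad v)_i at k :  sum_j sum_m u_j^m (i (k-j)_m) v_{k-j}^i *)
Definition adv_term_v (d : nat) (u v : VField) (k : Vec) (i : nat) : Vec -> C :=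
  fun j => sumC_lt d (fun m => Cmult (u j m) (Cmult (Cmult Ci (RtoC (IZR (k m - j m)))) (v (vsub k j) i))).
Definition adv_term_s (d : nat) (u : VField) (eta : SField) (k : Vec) : Vec -> C :=
  fun j => sumC_lt d (fun m => Cmult (u j m) (Cmult (Cmult Ci (RtoC (IZR (k m - j m)))) (eta (vsub k j)))).

(** Leray-Helmholtz projection at wavevector k (onto mean-zero divergence-free fields):
    (P w)_i = w_i - k_i (k . w) / |k|^2, and 0 at k = 0. *)
Definition leray (d : nat) (k : Vec) (w : nat -> C) (i : nat) : C :=
  if Rle_dec (knorm d k) 0 then RtoC 0
  else Cminus (w i) (Cdiv (Cmult (RtoC (IZR (k i))) (sumC_lt d (fun m => Cmult (RtoC (IZR (k m))) (w m))))
                          (RtoC (knorm d k ^ 2))).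

Definition upvec (d : nat) (i : nat) : R := if Nat.eqb i (d - 1) then 1 else 0.

Definition CW (d : nat) (r : R) : R :=
  / (PI * 2 ^ (d - 1)) * ((2 * r - INR d) / (2 * r - 1 - INR d)).

Definition dq_v (U : C -> VField) (z h : C) (DU : VField) : VField :=
  fun k i => Cminus (Cdiv (Cminus (U (Cplus z h) k i) (U z k i)) h) (DU k i).
Definition dq_s (E : C -> SField) (z h : C) (DE : SField) : SField :=
  fun k => Cminus (Cdiv (Cminus (E (Cplus z h) k) (E z k)) h) (DE k).

(** (U,E) is a holomorphic solution on the open disk |zeta| < rho of
      dU/dzeta + B(U,U) = g P(E e),  dE/dzeta + U . grad E = 0,  U(0)=u0, E(0)=eta0,
    with values in (H+iH) x (complexified mean-zero scalars), each U(zeta),E(zeta)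
    lying in some Gevrey class of positive radius, and complex derivative taken in
    the L^2 norm. *)
Definition bouss_sol (d : nat) (r g rho : R) (u0 : VField) (eta0 : SField)
    (U : C -> VField) (E : C -> SField) : Prop :=
  (forall k i, U (RtoC 0) k i = u0 k i) /\ (forall k, E (RtoC 0) k = eta0 k) /\
  forall z, Cmod z < rho ->
    inH d (U z) /\ inS d (E z) /\
    (exists beta, 0 < beta /\ gev_fin_v d r beta (U z) /\ gev_fin_s d r beta (E z)) /\
    exists (DU : VField) (DE : SField),
      (forall eps, 0 < eps -> exists delta, 0 < delta /\
         forall h, 0 < Cmod h < delta -> Cmod (Cplus z h) < rho ->
           forall N, wpartial d (fun _ => 1) (vsq d (dq_v U z h DU)) N <= eps /\
                     wpartial d (fun _ => 1) (ssq (dq_s E z h DE)) N <= eps) /\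
      forall k, validk d k ->
        exists (b : nat -> C) (c : C),
          (forall i, (i < d)%nat -> conv_to d (adv_term_v d (U z) (U z) k i) (b i)) /\
          conv_to d (adv_term_s d (U z) (E z) k) c /\
          (forall i, (i < d)%nat ->
             DU k i = Cplus (Copp (leray d k b i))
                            (Cmult (RtoC g) (leray d k (fun m => Cmult (E z k) (RtoC (upvec d m))) i))) /\
          DE k = Copp c.

(** radius of the region R:
    min{ C beta0 / (2^r C_W(r) ||(u0,eta0)||_beta0), 2 ln 2 / g },
    the first entry being +infinity when ||(u0,eta0)||_beta0 = 0. *)
Definition region_radius (d : nat) (Cst r beta0 g : R) (u0 : VField) (eta0 : SField) : R :=
  let n := gev_pair_norm d r beta0 u0 eta0 in
  if Rle_dec n 0 then 2 * ln 2 / g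
  else Rmin (Cst * beta0 / (Rpower 2 r * CW d r * n)) (2 * ln 2 / g).

(* Main.v *)
Require Import Defs.
From Stdlib Require Import Reals List ZArith Lia Lra Permutation.
From Stdlib Require Import Classical ClassicalEpsilon FunctionalExtensionality.
From Coquelicot Require Import Coquelicot.
Open Scope R_scope.

(** Existence.  Written with the derivative in front, the nonlinearity is bounded on the algebra of
    absolutely summable Fourier series with weight [exp (beta |k|)], at the cost of one derivative.
    The Gevrey norm controls this norm at [beta0] uniformly in [r], because [2 r > d + 1], so the
    factors [2^r] and [C_W(r)], both bounded below, only shrink the region.  The Taylor
    coefficients in [zeta] are then defined by recursion; the [n]-th one is bounded at
    [beta < beta0] by [A_n / (beta0 - beta)^n], where [A_n] obeys a Catalan-like recursion, and the
    Taylor series converges at [beta0 / 2] in the whole disk.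

    Uniqueness.  A solution is only assumed square-summable, differentiable in [L^2], and Gevrey at
    each [zeta] with no uniformity, and along a real ray such a class need not be a uniqueness
    class.  Complex differentiability is what saves it: the difference [w] of two solutions
    agreeing at a point is, mode by mode, a C^1 holomorphic function whose derivative is bounded by
    the [L^2] norm of [w], so a Schwarz lemma in [L^2] shows that [w] vanishes to infinite order
    there, hence identically nearby; a continuation argument along segments concludes. *)

(** * Finite sums over lists *)

(** In complex time the cancellation behind the energy estimate for transport is gone, so a
    derivative is really lost; existence therefore has to trade analyticity radius for that
    derivative. In uniqueness the loss is harmless because the equation is read one wavevector at a
    time: on a fixed mode the derivative costs the number |k|, which enters only the constant of an
    O(|w|^(n+1)) bound, and the conclusion of the Schwarz lemma does not see that constant. The
    modes are recombined by duality: finitely many of them are paired with the conjugates of their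
    values at one point, which gives a scalar holomorphic function whose value there is the square
    of an l^2 norm. The equation also yields continuity of the derivative of each mode, so Cauchy's
    formula for C^1 functions applies; it is obtained by differentiating circle integrals in a
    parameter. Buoyancy loses no derivative and only asks that [g * |zeta|] stay bounded, which is
    where [2 * ln 2 / g] enters, through [ln 2 < 1]. *)

Lemma sumR_app {A} (l l' : list A) f : sumR (l ++ l') f = sumR l f + sumR l' f.
Proof. unfold sumR; induction l as [|a l IH]; simpl; [lra|rewrite IH; lra]. Qed.

Lemma sumR_ext {A} (l : list A) f g :
  (forall a, In a l -> f a = g a) -> sumR l f = sumR l g.
Proof.
  unfold sumR; induction l as [|a l IH]; simpl; intros H; [easy|].
  rewrite (H a) by auto; rewrite IH; auto.
Qed.

Lemma sumR_le {A} (l : list A) f g :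
  (forall a, In a l -> f a <= g a) -> sumR l f <= sumR l g.
Proof.
  unfold sumR; induction l as [|a l IH]; simpl; intros H; [lra|].
  apply Rplus_le_compat; auto.
Qed.

Lemma sumR_plus {A} (l : list A) f g :
  sumR l (fun a => f a + g a) = sumR l f + sumR l g.
Proof. unfold sumR; induction l as [|a l IH]; simpl; [lra|rewrite IH; lra]. Qed.

Lemma sumR_scal {A} (l : list A) c f : sumR l (fun a => c * f a) = c * sumR l f.
Proof. unfold sumR; induction l as [|a l IH]; simpl; [lra|rewrite IH; lra]. Qed.

Lemma sumR_zero {A} (l : list A) f : (forall a, In a l -> f a = 0) -> sumR l f = 0.
Proof.
  unfold sumR; induction l as [|a l IH]; simpl; intros H; [easy|].
  rewrite (H a), IH; auto; lra.
Qed.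

Lemma sumR_nonneg {A} (l : list A) f : (forall a, In a l -> 0 <= f a) -> 0 <= sumR l f.
Proof.
  intros H; rewrite <- (sumR_zero l (fun _ => 0)); auto; now apply sumR_le.
Qed.

Lemma sumR_const {A} (l : list A) c : sumR l (fun _ => c) = INR (length l) * c.
Proof.
  unfold sumR; induction l as [|a l IH]; simpl length; [simpl; lra|].
  rewrite S_INR; simpl; rewrite IH; lra.
Qed.

Lemma sumR_map {A B} (h : A -> B) (l : list A) f : sumR (map h l) f = sumR l (fun a => f (h a)).
Proof. unfold sumR; induction l as [|a l IH]; simpl; [easy|now rewrite IH]. Qed.

Lemma sumR_flat_map {A B} (h : A -> list B) (l : list A) f :
  sumR (flat_map h l) f = sumR l (fun a => sumR (h a) f).
Proof.
  induction l as [|a l IH]; simpl; [easy|]. rewrite sumR_app, IH; easy.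
Qed.

Lemma sumR_exchange {A B} (l : list A) (l' : list B) f :
  sumR l (fun a => sumR l' (f a)) = sumR l' (fun b => sumR l (fun a => f a b)).
Proof.
  induction l as [|a l IH].
  - symmetry; now apply sumR_zero.
  - change (sumR l' (f a) + sumR l (fun a => sumR l' (f a)) =
            sumR l' (fun b => f a b + sumR l (fun a => f a b))).
    now rewrite sumR_plus, IH.
Qed.

Lemma sumR_list_prod {A B} (l : list A) (l' : list B) f :
  sumR (list_prod l l') f = sumR l (fun a => sumR l' (fun b => f (a, b))).
Proof.
  induction l as [|a l IH]; simpl; [easy|].
  rewrite sumR_app, IH, sumR_map; easy.
Qed.

Lemma sumR_perm {A} (l l' : list A) f : Permutation l l' -> sumR l f = sumR l' f.
Proof. unfold sumR; induction 1; simpl; lra. Qed.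

Lemma sumR_in_le {A} (l : list A) f a :
  (forall b, In b l -> 0 <= f b) -> In a l -> f a <= sumR l f.
Proof.
  intros H H'; destruct (in_split _ _ H') as (l1 & l2 & ->).
  rewrite sumR_app; change (sumR (a :: l2) f) with (f a + sumR l2 f).
  assert (0 <= sumR l1 f) by (apply sumR_nonneg; intros; apply H, in_or_app; auto).
  assert (0 <= sumR l2 f) by (apply sumR_nonneg; intros; apply H, in_or_app; simpl; auto).
  lra.
Qed.

(** Elements of [l] are removed from [l'] one at a time, so no decidable equality is required of the
    index type; wavevectors are functions and have none constructively. Comparisons of a finite sum
    with one over a larger list rest on this splitting. *)
Lemma incl_perm_app {A} (l l' : list A) :
  NoDup l -> incl l l' -> exists r, Permutation l' (l ++ r).
Proof.
  revert l'; induction l as [|a l IH]; intros l' Hn Hi; [now exists l'|].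
  destruct (in_split a l') as (l1 & l2 & ->); [apply Hi; now left|].
  inversion Hn as [|? ? Ha Hl]; subst.
  destruct (IH (l1 ++ l2) Hl) as [r Hr].
  - intros b Hb; assert (Hb' := Hi b (or_intror Hb)).
    apply in_app_or in Hb' as [?|[->|?]]; [apply in_or_app; auto|easy|apply in_or_app; auto].
  - exists r; simpl; rewrite <- Hr; symmetry; apply Permutation_middle.
Qed.

Lemma sumR_incl_le {A} (l l' : list A) f :
  (forall a, 0 <= f a) -> NoDup l -> incl l l' -> sumR l f <= sumR l' f.
Proof.
  intros H Hn Hi; destruct (incl_perm_app _ _ Hn Hi) as [r Hr].
  rewrite (sumR_perm _ _ _ Hr), sumR_app.
  assert (0 <= sumR r f) by (apply sumR_nonneg; auto); lra.
Qed.

Lemma sumR_mult {A B} (l : list A) (l' : list B) f g :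
  sumR l f * sumR l' g = sumR l (fun a => sumR l' (fun b => f a * g b)).
Proof.
  rewrite Rmult_comm, <- sumR_scal; apply sumR_ext; intros a _.
  rewrite sumR_scal; lra.
Qed.

Lemma sumC_parts {A} (l : list A) f :
  sumC l f = (sumR l (fun a => Re (f a)), sumR l (fun a => Im (f a))).
Proof.
  unfold sumC, sumR; induction l as [|a l IH]; simpl; [easy|].
  rewrite IH; destruct (f a); easy.
Qed.

Lemma sumC_app {A} (l l' : list A) f : sumC (l ++ l') f = Cplus (sumC l f) (sumC l' f).
Proof. rewrite !sumC_parts, !sumR_app; easy. Qed.

Lemma sumC_ext {A} (l : list A) f g :
  (forall a, In a l -> f a = g a) -> sumC l f = sumC l g.
Proof.
  intros H; rewrite !sumC_parts; f_equal; apply sumR_ext; intros; now rewrite H.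
Qed.

Lemma sumC_plus {A} (l : list A) f g :
  sumC l (fun a => Cplus (f a) (g a)) = Cplus (sumC l f) (sumC l g).
Proof.
  unfold sumC; induction l as [|a l IH]; simpl; [|rewrite IH]; ring.
Qed.

Lemma sumC_scal {A} (l : list A) c f : sumC l (fun a => Cmult c (f a)) = Cmult c (sumC l f).
Proof. unfold sumC; induction l as [|a l IH]; simpl; [|rewrite IH]; ring. Qed.

Lemma sumC_minus {A} (l : list A) f g :
  sumC l (fun a => Cminus (f a) (g a)) = Cminus (sumC l f) (sumC l g).
Proof.
  unfold sumC; induction l as [|a l IH]; simpl; [|rewrite IH]; ring.
Qed.

Lemma sumC_zero {A} (l : list A) f : (forall a, In a l -> f a = RtoC 0) -> sumC l f = RtoC 0.
Proof.
  intros H; rewrite sumC_parts, !sumR_zero; auto; intros a Ha; now rewrite H.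
Qed.

Lemma sumC_perm {A} (l l' : list A) f : Permutation l l' -> sumC l f = sumC l' f.
Proof. intros H; rewrite !sumC_parts; f_equal; now apply sumR_perm. Qed.

Lemma sumC_map {A B} (h : A -> B) (l : list A) f : sumC (map h l) f = sumC l (fun a => f (h a)).
Proof. unfold sumC; induction l as [|a l IH]; simpl; [easy|now rewrite IH]. Qed.

Lemma sumC_exchange {A B} (l : list A) (l' : list B) f :
  sumC l (fun a => sumC l' (f a)) = sumC l' (fun b => sumC l (fun a => f a b)).
Proof.
  induction l as [|a l IH].
  - symmetry; now apply sumC_zero.
  - change (Cplus (sumC l' (f a)) (sumC l (fun a => sumC l' (f a))) =
            sumC l' (fun b => Cplus (f a b) (sumC l (fun a => f a b)))).
    now rewrite sumC_plus, IH.
Qed.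

Lemma Cmod_sumC {A} (l : list A) f : Cmod (sumC l f) <= sumR l (fun a => Cmod (f a)).
Proof.
  unfold sumC, sumR; induction l as [|a l IH]; simpl; [rewrite Cmod_0; lra|].
  eapply Rle_trans; [apply Cmod_triangle|lra].
Qed.

Lemma Cmod_minus_sym (x y : C) : Cmod (Cminus x y) = Cmod (Cminus y x).
Proof. rewrite <- Cmod_opp; f_equal; ring. Qed.

Lemma Cmod_triangle3 (x y z : C) :
  Cmod (Cminus x z) <= Cmod (Cminus x y) + Cmod (Cminus y z).
Proof. replace (Cminus x z) with (Cplus (Cminus x y) (Cminus y z)) by ring;
  apply Cmod_triangle. Qed.

Lemma re_le_Cmod (z : C) : Rabs (Re z) <= Cmod z.
Proof. eapply Rle_trans; [|apply Rmax_Cmod]; apply Rmax_l. Qed.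

Lemma im_le_Cmod (z : C) : Rabs (Im z) <= Cmod z.
Proof. eapply Rle_trans; [|apply Rmax_Cmod]; apply Rmax_r. Qed.

Lemma Cmod_le_parts (z : C) : Cmod z <= Rabs (Re z) + Rabs (Im z).
Proof.
  replace z with (Cplus (RtoC (Re z)) (Cmult Ci (RtoC (Im z)))) at 1.
  - eapply Rle_trans; [apply Cmod_triangle|].
    rewrite Cmod_mult, !Cmod_R, Cmod_Ci; lra.
  - destruct z; unfold Cplus, Cmult, Ci, RtoC; simpl; f_equal; ring.
Qed.

Lemma cauchy_schwarz {A} (l : list A) f g :
  sumR l (fun a => f a * g a) ^ 2 <= sumR l (fun a => f a ^ 2) * sumR l (fun a => g a ^ 2).
Proof.
  set (F := sumR l (fun a => f a ^ 2)); set (G := sumR l (fun a => g a ^ 2)).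
  set (P := sumR l (fun a => f a * g a)).
  assert (HF : 0 <= F) by (apply sumR_nonneg; intros; apply pow2_ge_0).
  assert (H : forall s t, 0 <= s ^ 2 * F + 2 * (s * t) * P + t ^ 2 * G).
  { intros s t; unfold F, G, P; rewrite <- !sumR_scal, <- !sumR_plus.
    apply sumR_nonneg; intros a _.
    replace (_ + _) with ((s * f a + t * g a) ^ 2) by ring; apply pow2_ge_0. }
  destruct (Req_dec F 0) as [E|E].
  (* For [F = 0] the second instance of the quadratic form reads [-(G + 2) * P^4 >= 0], which forces
     [P = 0]. *)
  - assert (H1 := H (- P * (G + 1)) 1); assert (H2 := H (- (G+1) * P) (P ^ 2)).
    rewrite E in *.
    assert (0 <= G) by (apply sumR_nonneg; intros; apply pow2_ge_0).
    nra.
  - assert (H1 := H (- P) F). assert (F > 0) by lra.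
    assert (0 <= F * (F * G - P ^ 2)) by nra.
    assert (0 <= F * G - P ^ 2); [|lra].
    apply Rnot_lt_le; intros H3; nra.
Qed.

Lemma cauchy_schwarz_sqrt {A} (l : list A) f g F G :
  0 <= F -> 0 <= G ->
  sumR l (fun a => f a ^ 2) <= F ^ 2 -> sumR l (fun a => g a ^ 2) <= G ^ 2 ->
  sumR l (fun a => f a * g a) <= F * G.
Proof.
  intros HF HG H1 H2; assert (H := cauchy_schwarz l f g).
  assert (0 <= sumR l (fun a => f a ^ 2)) by (apply sumR_nonneg; intros; apply pow2_ge_0).
  assert (0 <= sumR l (fun a => g a ^ 2)) by (apply sumR_nonneg; intros; apply pow2_ge_0).
  assert (sumR l (fun a => f a * g a) ^ 2 <= (F * G) ^ 2).
  { eapply Rle_trans; [exact H|]; rewrite Rpow_mult_distr; apply Rmult_le_compat; auto. }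
  assert (0 <= F * G) by now apply Rmult_le_pos.
  apply Rnot_lt_le; intros H6; nra.
Qed.

Lemma minkowski {A} (l : list A) f g F G :
  0 <= F -> 0 <= G ->
  sumR l (fun a => f a ^ 2) <= F ^ 2 -> sumR l (fun a => g a ^ 2) <= G ^ 2 ->
  sumR l (fun a => (f a + g a) ^ 2) <= (F + G) ^ 2.
Proof.
  intros HF HG H1 H2; assert (H := cauchy_schwarz_sqrt l f g F G HF HG H1 H2).
  rewrite (sumR_ext l _ (fun a => (f a ^ 2 + g a ^ 2) + 2 * (f a * g a))) by (intros; ring).
  rewrite sumR_plus, sumR_plus, sumR_scal; nra.
Qed.

(** The embedding of l^1 into l^2, by which Wiener bounds on the constructed series give the
    square-summability that the notion of solution asks for. *)
Lemma sumR_sq_le {A} (l : list A) f :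
  (forall a, 0 <= f a) -> sumR l (fun a => f a ^ 2) <= sumR l f ^ 2.
Proof.
  intros H; induction l as [|a l IH]; [simpl; lra|].
  change (f a ^ 2 + sumR l (fun a => f a ^ 2) <= (f a + sumR l f) ^ 2).
  assert (0 <= sumR l f) by (apply sumR_nonneg; auto). assert (Ha := H a); nra.
Qed.

Lemma NoDup_app_disjoint {A} (l l' : list A) :
  NoDup l -> NoDup l' -> (forall a, In a l -> ~ In a l') -> NoDup (l ++ l').
Proof.
  intros Hl Hl'; induction Hl as [|a l Ha Hl IH]; intros H; simpl; auto.
  constructor; [rewrite in_app_iff; intros [?|?]; [easy|]|].
  - apply (H a); simpl; auto.
  - apply IH; intros; apply H; simpl; auto.
Qed.

Lemma NoDup_map_injective {A B} (h : A -> B) (l : list A) :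
  (forall a a', h a = h a' -> a = a') -> NoDup l -> NoDup (map h l).
Proof. intros Hi; apply FinFun.Injective_map_NoDup; exact Hi. Qed.

Lemma NoDup_list_prod {A B} (l : list A) (l' : list B) :
  NoDup l -> NoDup l' -> NoDup (list_prod l l').
Proof.
  intros Hl Hl'; induction Hl as [|a l Ha Hl IH]; simpl; [constructor|].
  apply NoDup_app_disjoint; auto.
  - apply NoDup_map_injective; congruence.
  - intros [a' b] H1 H2; apply in_prod_iff in H2 as [H2 _].
    apply in_map_iff in H1 as (b' & E & _); congruence.
Qed.

Lemma incl_seq (l : list nat) : exists N, incl l (seq 0 N).
Proof.
  induction l as [|b l [N IH]]; [exists O; easy|].
  exists (N + S b)%nat; intros a [<-|Ha]; apply in_seq; [lia|].
  apply IH, in_seq in Ha; lia.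
Qed.

(** * Unconditionally convergent families *)

(** For nonnegative [f] this is summability with total at most [M], expressed without enumerating
    the index type; [RS] below is then the total. *)
Definition bsum {A} (f : A -> R) (M : R) := forall l, NoDup l -> sumR l f <= M.

Definition RS {A} (f : A -> R) : R :=
  real (Lub_Rbar (fun x => exists l, NoDup l /\ x = sumR l f)).

Lemma list_union {A} (l l' : list A) :
  exists m, NoDup m /\ (forall a, In a m <-> In a l \/ In a l').
Proof.
  exists (nodup (fun x y => excluded_middle_informative (x = y)) (l ++ l')); split.
  - apply NoDup_nodup.
  - intros a; rewrite nodup_In; apply in_app_iff.
Qed.

Lemma RS_lub {A} (f : A -> R) M : bsum f M ->
  bsum f (RS f) /\ (forall M', bsum f M' -> RS f <= M').
Proof.
  intros H; unfold RS.
  destruct (Lub_Rbar_correct (fun x => exists l, NoDup l /\ x = sumR l f)) as [H1 H2].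
  destruct (Lub_Rbar _) as [x| |]; simpl.
  - split; [intros l Hl; apply (H1 (sumR l f)); eauto|].
    intros M' HM'; apply (H2 (Finite M')); intros y (l & Hl & ->); now apply HM'.
  - exfalso; apply (H2 (Finite M)); intros y (l & Hl & ->); now apply H.
  - exfalso; apply (H1 0); exists nil; split; [constructor|easy].
Qed.

Lemma RS_ub {A} (f : A -> R) M : bsum f M -> bsum f (RS f).
Proof. intros H; apply (RS_lub f M H). Qed.

Lemma RS_le {A} (f : A -> R) M : bsum f M -> RS f <= M.
Proof. intros H; now apply (RS_lub f M H). Qed.

Lemma RS_nonneg {A} (f : A -> R) M : bsum f M -> 0 <= RS f.
Proof. intros H; apply (RS_ub f M H nil); constructor. Qed.

Lemma RS_mono {A} (f g : A -> R) M : (forall a, f a <= g a) -> bsum g M -> RS f <= RS g.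
Proof.
  intros H HM; apply RS_le; intros l Hl.
  eapply Rle_trans; [apply sumR_le; intros; apply H|]; now apply (RS_ub g M).
Qed.

Lemma RS_approx {A} (f : A -> R) M eps : (forall a, 0 <= f a) -> bsum f M -> 0 < eps ->
  exists l0, forall l, incl l0 l -> RS f - eps < sumR l f.
Proof.
  intros Hf H He; apply NNPP; intros Hn.
  assert (RS f <= RS f - eps); [|lra].
  apply RS_le; intros l Hl; apply Rnot_lt_le; intros Hlt; apply Hn; exists l.
  intros l' Hl'; assert (sumR l f <= sumR l' f) by now apply sumR_incl_le. lra.
Qed.

Lemma RS_fin_approx {A B} (lb : list B) (F : B -> A -> R) (M : B -> R) eps :
  (forall b a, 0 <= F b a) -> (forall b, In b lb -> bsum (F b) (M b)) -> 0 < eps ->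
  exists l, NoDup l /\ forall b, In b lb -> RS (F b) - eps < sumR l (F b).
Proof.
  intros HF HM He; induction lb as [|b lb IH].
  - exists nil; split; [constructor|easy].
  - destruct IH as (l & Hl & IH); [intros; apply HM; now right|].
    destruct (RS_approx (F b) (M b) eps) as [l0 H0]; auto; [apply HM; now left|].
    destruct (list_union l l0) as (m & Hm & Hm').
    exists m; split; auto; intros b' [<-|Hb].
    + apply H0; intros a Ha; apply Hm'; auto.
    + eapply Rlt_le_trans; [now apply IH|].
      apply sumR_incl_le; auto; intros a Ha; apply Hm'; auto.
Qed.

(** Monotone convergence for finitely many sums: one list of indices nearly attains all the suprema
    at once, so a bound on finite rectangles passes to the limit. The [+ 1] in [n] keeps the
    division legitimate for empty [lb]. *)
Lemma sumR_RS_le {A B} (lb : list B) (F : B -> A -> R) (M : B -> R) S :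
  (forall b a, 0 <= F b a) -> (forall b, In b lb -> bsum (F b) (M b)) ->
  (forall la, NoDup la -> sumR lb (fun b => sumR la (F b)) <= S) ->
  sumR lb (fun b => RS (F b)) <= S.
Proof.
  intros HF HM HS; apply le_epsilon; intros eps He.
  set (n := INR (length lb) + 1).
  assert (Hn : 0 < n) by (unfold n; assert (H := pos_INR (length lb)); lra).
  destruct (RS_fin_approx lb F M (eps / n)) as (l & Hl & H); auto.
  { now apply Rdiv_lt_0_compat. }
  eapply Rle_trans; [apply (sumR_le lb _ (fun b => sumR l (F b) + eps / n))|].
  - intros b Hb; assert (H' := H b Hb); lra.
  - rewrite sumR_plus, sumR_const; assert (H' := HS l Hl).
    assert (INR (length lb) * (eps / n) <= eps); [|lra].
    apply Rmult_le_reg_r with n; auto.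
    replace (INR (length lb) * (eps / n) * n) with (INR (length lb) * eps) by (field; lra).
    unfold n; nra.
Qed.

(** Convergence along the directed set of finite index sets, hence invariant under every
    rearrangement; convergence along boxes is deduced in [conv_to_has_sum]. *)
Definition has_sum {A} (f : A -> C) (s : C) :=
  forall eps, 0 < eps -> exists l0, forall l, NoDup l -> incl l0 l ->
    Cmod (Cminus (sumC l f) s) < eps.

(** Positive and negative parts are handled separately, each being close to its supremum on all
    large lists. *)
Lemma has_sum_real {A} (f : A -> R) M : bsum (fun a => Rabs (f a)) M ->
  exists s, forall eps, 0 < eps -> exists l0, forall l, NoDup l -> incl l0 l ->
    Rabs (sumR l f - s) < eps.
Proof.
  intros H.
  set (p := fun a => (Rabs (f a) + f a) / 2); set (q := fun a => (Rabs (f a) - f a) / 2).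
  assert (Hp : forall a, 0 <= p a <= Rabs (f a)).
  { intros a; unfold p; assert (Ha := Rabs_le_between (f a) (Rabs (f a))); lra. }
  assert (Hq : forall a, 0 <= q a <= Rabs (f a)).
  { intros a; unfold q; assert (Ha := Rabs_le_between (f a) (Rabs (f a))); lra. }
  assert (Bp : bsum p M).
  { intros l Hl; eapply Rle_trans; [|now apply (H l)]; apply sumR_le; intros; apply Hp. }
  assert (Bq : bsum q M).
  { intros l Hl; eapply Rle_trans; [|now apply (H l)]; apply sumR_le; intros; apply Hq. }
  exists (RS p - RS q); intros eps He.
  destruct (RS_approx p M eps) as [l1 H1]; auto; [apply Hp|].
  destruct (RS_approx q M eps) as [l2 H2]; auto; [apply Hq|].
  exists (l1 ++ l2); intros l Hl Hi.
  assert (Hpl := RS_ub p M Bp l Hl); assert (Hql := RS_ub q M Bq l Hl).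
  assert (H1' := H1 l (fun a Ha => Hi a (in_or_app _ _ _ (or_introl Ha)))).
  assert (H2' := H2 l (fun a Ha => Hi a (in_or_app _ _ _ (or_intror Ha)))).
  assert (E : sumR l f = sumR l p - sumR l q).
  { assert (E : sumR l p = sumR l q + sumR l f); [|lra].
    rewrite <- sumR_plus; apply sumR_ext; intros; unfold p, q; lra. }
  rewrite E; apply Rabs_lt_between; lra.
Qed.

Lemma has_sum_ex {A} (f : A -> C) M : bsum (fun a => Cmod (f a)) M -> exists s, has_sum f s.
Proof.
  intros H.
  destruct (has_sum_real (fun a => Re (f a)) M) as [x Hx].
  { intros l Hl; eapply Rle_trans; [|now apply (H l)]; apply sumR_le; intros; apply re_le_Cmod. }
  destruct (has_sum_real (fun a => Im (f a)) M) as [y Hy].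
  { intros l Hl; eapply Rle_trans; [|now apply (H l)]; apply sumR_le; intros; apply im_le_Cmod. }
  exists (x, y); intros eps He.
  destruct (Hx (eps / 2)) as [l1 H1]; [lra|]; destruct (Hy (eps / 2)) as [l2 H2]; [lra|].
  exists (l1 ++ l2); intros l Hl Hi.
  assert (H1' := H1 l Hl (fun a Ha => Hi a (in_or_app _ _ _ (or_introl Ha)))).
  assert (H2' := H2 l Hl (fun a Ha => Hi a (in_or_app _ _ _ (or_intror Ha)))).
  eapply Rle_lt_trans; [apply Cmod_le_parts|]; rewrite sumC_parts; simpl.
  unfold Rminus in *; lra.
Qed.

(** The choice operator makes the sum total, so that Taylor coefficients can be defined by recursion
    before any convergence is known. *)
Definition tsum {A} (f : A -> C) : C := epsilon (inhabits (RtoC 0)) (has_sum f).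

Lemma tsum_spec {A} (f : A -> C) M : bsum (fun a => Cmod (f a)) M -> has_sum f (tsum f).
Proof.
  intros H; unfold tsum.
  apply (epsilon_spec (inhabits (RtoC 0)) (has_sum f)), (has_sum_ex f M H).
Qed.

Lemma Cmod_small_eq (x y : C) : (forall eps, 0 < eps -> Cmod (Cminus x y) <= eps) -> x = y.
Proof.
  intros H; assert (E : Cmod (Cminus x y) = 0).
  { apply Rle_antisym; [|apply Cmod_ge_0]; apply le_epsilon; intros; rewrite Rplus_0_l; auto. }
  apply Cmod_eq_0 in E; replace x with (Cplus (Cminus x y) y) by ring; rewrite E; ring.
Qed.

Lemma has_sum_unique {A} (f : A -> C) s t : has_sum f s -> has_sum f t -> s = t.
Proof.
  intros Hs Ht; apply Cmod_small_eq; intros eps He.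
  destruct (Hs (eps / 2)) as [l1 H1]; [lra|]; destruct (Ht (eps / 2)) as [l2 H2]; [lra|].
  destruct (list_union l1 l2) as (m & Hm & Hm').
  assert (A1 := H1 m Hm (fun a Ha => proj2 (Hm' a) (or_introl Ha))).
  assert (A2 := H2 m Hm (fun a Ha => proj2 (Hm' a) (or_intror Ha))).
  assert (A3 := Cmod_triangle3 s (sumC m f) t);
    rewrite (Cmod_minus_sym s (sumC m f)) in A3; lra.
Qed.

Lemma tsum_eq {A} (f : A -> C) s : has_sum f s -> tsum f = s.
Proof.
  intros H; apply (has_sum_unique f); auto; unfold tsum.
  apply (epsilon_spec (inhabits (RtoC 0)) (has_sum f)); eauto.
Qed.

Lemma has_sum_ext {A} (f g : A -> C) s : (forall a, f a = g a) -> has_sum f s -> has_sum g s.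
Proof. intros H; replace g with f; auto; now apply functional_extensionality. Qed.

Lemma has_sum_plus {A} (f g : A -> C) s t :
  has_sum f s -> has_sum g t -> has_sum (fun a => Cplus (f a) (g a)) (Cplus s t).
Proof.
  intros Hs Ht eps He.
  destruct (Hs (eps / 2)) as [l1 H1]; [lra|]; destruct (Ht (eps / 2)) as [l2 H2]; [lra|].
  exists (l1 ++ l2); intros l Hl Hi.
  assert (A1 := H1 l Hl (fun a Ha => Hi a (in_or_app _ _ _ (or_introl Ha)))).
  assert (A2 := H2 l Hl (fun a Ha => Hi a (in_or_app _ _ _ (or_intror Ha)))).
  rewrite sumC_plus.
  replace (Cminus _ _) with (Cplus (Cminus (sumC l f) s) (Cminus (sumC l g) t)) by ring.
  eapply Rle_lt_trans; [apply Cmod_triangle|lra].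
Qed.

Lemma has_sum_scal {A} (f : A -> C) c s :
  has_sum f s -> has_sum (fun a => Cmult c (f a)) (Cmult c s).
Proof.
  intros Hs eps He.
  assert (Hc := Cmod_ge_0 c).
  destruct (Hs (eps / (Cmod c + 1))) as [l0 H0]; [apply Rdiv_lt_0_compat; lra|].
  exists l0; intros l Hl Hi; rewrite sumC_scal.
  replace (Cminus _ _) with (Cmult c (Cminus (sumC l f) s)) by ring.
  rewrite Cmod_mult; assert (A1 := H0 l Hl Hi).
  apply Rle_lt_trans with (Cmod c * (eps / (Cmod c + 1))).
  - apply Rmult_le_compat_l; lra.
  - apply Rmult_lt_reg_r with (Cmod c + 1); [lra|].
    replace (Cmod c * (eps / (Cmod c + 1)) * (Cmod c + 1)) with (Cmod c * eps) by (field; lra).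
    nra.
Qed.

Lemma has_sum_minus {A} (f g : A -> C) s t :
  has_sum f s -> has_sum g t -> has_sum (fun a => Cminus (f a) (g a)) (Cminus s t).
Proof.
  intros Hs Ht.
  replace (Cminus s t) with (Cplus s (Cmult (Copp (RtoC 1)) t)).
  - eapply has_sum_ext; [|exact (has_sum_plus _ _ _ _ Hs (has_sum_scal _ (Copp (RtoC 1)) _ Ht))].
    intros a; simpl; ring.
  - ring.
Qed.

Lemma has_sum_zero {A} (f : A -> C) : (forall a, f a = RtoC 0) -> has_sum f (RtoC 0).
Proof.
  intros H eps He; exists nil; intros l _ _; rewrite sumC_zero; auto.
  replace (Cminus (RtoC 0) (RtoC 0)) with (RtoC 0) by ring; now rewrite Cmod_0.
Qed.

Lemma has_sum_sumC {A B} (lb : list B) (f : B -> A -> C) s :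
  (forall b, In b lb -> has_sum (f b) (s b)) ->
  has_sum (fun a => sumC lb (fun b => f b a)) (sumC lb s).
Proof.
  induction lb as [|b lb IH]; intros H.
  - now apply has_sum_zero.
  - apply (has_sum_plus (f b) (fun a => sumC lb (fun b => f b a)) (s b) (sumC lb s)).
    + apply H; now left.
    + apply IH; intros; apply H; now right.
Qed.

Lemma has_sum_bound {A} (f : A -> C) s M :
  has_sum f s -> bsum (fun a => Cmod (f a)) M -> Cmod s <= M.
Proof.
  intros Hs HM; apply le_epsilon; intros eps He.
  destruct (Hs eps He) as [l0 H0]; destruct (list_union l0 l0) as (m & Hm & Hm').
  assert (A1 := H0 m Hm (fun a Ha => proj2 (Hm' a) (or_introl Ha))).
  assert (A2 := HM m Hm); assert (A3 := Cmod_sumC m f).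
  assert (A4 := Cmod_triangle3 s (sumC m f) (RtoC 0)); rewrite (Cmod_minus_sym s (sumC m f)) in A4.
  replace (Cminus s (RtoC 0)) with s in A4 by ring.
  replace (Cminus (sumC m f) (RtoC 0)) with (sumC m f) in A4 by ring. lra.
Qed.

Lemma Cmod_tsum {A} (f : A -> C) M : bsum (fun a => Cmod (f a)) M ->
  Cmod (tsum f) <= RS (fun a => Cmod (f a)).
Proof.
  intros H; apply (has_sum_bound f); [now apply (tsum_spec f M)|now apply (RS_ub _ M)].
Qed.

Lemma has_sum_finite {A} (f : A -> C) l0 : NoDup l0 ->
  (forall a, ~ In a l0 -> f a = RtoC 0) -> has_sum f (sumC l0 f).
Proof.
  intros Hl0 H eps He; exists l0; intros l Hl Hi.
  destruct (incl_perm_app _ _ Hl0 Hi) as [r Hr].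
  rewrite (sumC_perm _ _ _ Hr), sumC_app, (sumC_zero r).
  - replace (Cminus _ _) with (RtoC 0) by ring; now rewrite Cmod_0.
  - intros a Ha; apply H; intros Ha'.
    apply (Permutation_NoDup Hr) in Hl.
    destruct (in_split _ _ Ha) as (r1 & r2 & ->).
    rewrite app_assoc in Hl; apply NoDup_remove_2 in Hl; apply Hl.
    apply in_or_app; left; apply in_or_app; now left.
Qed.

Lemma has_sum_succ (f : nat -> C) s :
  has_sum f s -> has_sum (fun n => f (S n)) (Cminus s (f O)).
Proof.
  intros H eps He; destruct (H eps He) as [l0 H0].
  exists (map pred l0); intros l Hl Hi.
  replace (Cminus _ _) with (Cminus (sumC (O :: map S l) f) s).
  - apply H0.
    + constructor; [rewrite in_map_iff; intros (x & Hx & _); easy|].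
      apply FinFun.Injective_map_NoDup; auto; intros x y; congruence.
    + intros [|n] Hn; [now left|right]; apply in_map, Hi.
      now apply (in_map pred) in Hn.
  - change (sumC (O :: map S l) f) with (Cplus (f O) (sumC (map S l) f)).
    rewrite sumC_map; ring.
Qed.

Lemma has_sum_shift (f : nat -> C) s i :
  has_sum f s -> has_sum (fun n => if Nat.leb i n then f (n - i)%nat else RtoC 0) s.
Proof.
  revert f s; induction i as [|i IH]; intros f s H.
  - eapply has_sum_ext; [|exact H]; intros n; simpl; now rewrite Nat.sub_0_r.
  - specialize (IH f s H); intros eps He; destruct (IH eps He) as [l0 H0].
    exists (O :: map S l0); intros l Hl Hi.
    destruct (incl_perm_app (O :: nil) l) as [r Hr].
    { constructor; [easy|constructor]. }
    { intros a [<-|[]]; apply Hi; now left. }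
    assert (Hr0 : NoDup (O :: r)) by now apply (Permutation_NoDup Hr).
    inversion Hr0 as [|? ? Hr1 Hr2]; subst.
    assert (Er : r = map S (map pred r)).
    { rewrite map_map; rewrite <- (map_id r) at 1; apply map_ext_in; intros [|a] Ha; easy. }
    rewrite (sumC_perm _ _ _ Hr); simpl app.
    replace (sumC (O :: r) _)
      with (sumC (map pred r) (fun n => if Nat.leb i n then f (n - i)%nat else RtoC 0)).
    + apply H0.
      * apply (NoDup_map_inv S); now rewrite <- Er.
      * intros a Ha; assert (Ha' : In (S a) l) by (apply Hi; right; now apply in_map).
        apply (Permutation_in _ Hr) in Ha'; destruct Ha' as [Ha'|Ha']; [easy|].
        now apply (in_map pred) in Ha'.
    + change (sumC (O :: r) ?g) with (Cplus (RtoC 0) (sumC r g)).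
      rewrite Er at 2; rewrite (sumC_map S); simpl; ring.
Qed.

(** A finite sum of complete rows is approximated by rectangles over larger [lb']; the part added to
    the rectangle over [lb] is bounded in absolute value by the hypothesis on tails. *)
Lemma row_sums_near_rectangle {A B} (F : A -> B -> C) r la lb eps :
  NoDup lb -> (forall a, has_sum (F a) (r a)) ->
  (forall lb', NoDup lb' -> incl lb lb' ->
     sumR la (fun a => sumR lb' (fun b => Cmod (F a b))) -
     sumR la (fun a => sumR lb (fun b => Cmod (F a b))) <= eps) ->
  Cmod (Cminus (sumC la r) (sumC la (fun a => sumC lb (F a)))) <= eps.
Proof.
  intros Hlb Hr tail.
  assert (Hs : has_sum (fun b => sumC la (fun a => F a b)) (sumC la r)).
  { apply (has_sum_sumC la F r); intros; apply Hr. }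
  apply le_epsilon; intros e He.
  destruct (Hs e He) as [l1 H1]; destruct (list_union lb l1) as (lb' & Hlb' & Hin).
  assert (A1 := H1 lb' Hlb' (fun b Hb => proj2 (Hin b) (or_intror Hb))).
  assert (Ib' : incl lb lb') by (intros b Hb; apply Hin; auto).
  assert (A2 := tail lb' Hlb' Ib').
  destruct (incl_perm_app _ _ Hlb Ib') as [rr Hrr].
  assert (A3 : Cmod (Cminus (sumC lb' (fun b => sumC la (fun a => F a b)))
                            (sumC la (fun a => sumC lb (F a)))) <= eps).
  { rewrite (sumC_exchange la lb), (sumC_perm _ _ _ Hrr), sumC_app.
    replace (Cminus _ _) with (sumC rr (fun b => sumC la (fun a => F a b))) by ring.
    eapply Rle_trans; [apply Cmod_sumC|].
    eapply Rle_trans; [apply sumR_le; intros; apply Cmod_sumC|].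
    rewrite !(sumR_exchange la), (sumR_perm _ _ _ Hrr), sumR_app in A2; lra. }
  eapply Rle_trans; [apply Cmod_triangle3|].
  rewrite (Cmod_minus_sym (sumC la r)); apply Rlt_le in A1.
  rewrite Rplus_comm; apply Rplus_le_compat; eauto.
Qed.

(** Both iterated sums are compared with the finite rectangle on which the absolute sum is
    almost maximal. *)
Lemma has_sum_fubini {A B} (F : A -> B -> C) M r c s :
  (forall la lb, NoDup la -> NoDup lb ->
     sumR la (fun a => sumR lb (fun b => Cmod (F a b))) <= M) ->
  (forall a, has_sum (F a) (r a)) -> (forall b, has_sum (fun a => F a b) (c b)) ->
  has_sum r s -> has_sum c s.
Proof.
  intros HM Hr Hc Hs.
  set (G := fun p : A * B => Cmod (F (fst p) (snd p))).
  assert (HG : forall p, 0 <= G p) by (intros; apply Cmod_ge_0).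
  assert (BG : bsum G M).
  { intros l Hl.
    destruct (list_union (map fst l) nil) as (la & Hla & Hla').
    destruct (list_union (map snd l) nil) as (lb & Hlb & Hlb').
    eapply Rle_trans; [apply (sumR_incl_le l (list_prod la lb)); auto|].
    - intros [a b] Hab; apply in_prod; [apply Hla'|apply Hlb']; left.
      + now apply (in_map fst) in Hab.
      + now apply (in_map snd) in Hab.
    - rewrite sumR_list_prod; now apply HM. }
  intros eps He.
  destruct (RS_approx G M (eps / 4) HG BG) as [l0 H0]; [lra|].
  destruct (Hs (eps / 4)) as [a1 H1]; [lra|].
  destruct (list_union (map fst l0) a1) as (la & Hla & Hin).
  assert (A1 := H1 la Hla (fun b Hb => proj2 (Hin b) (or_intror Hb))).
  exists (map snd l0); intros lb Hlb Ib.
  assert (tail : forall la' lb', NoDup la' -> NoDup lb' ->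
     sumR la' (fun a => sumR lb' (fun b => Cmod (F a b))) -
     sumR la (fun a => sumR lb (fun b => Cmod (F a b))) <= eps / 4).
  { intros la' lb' Hla' Hlb'.
    assert (I0 : incl l0 (list_prod la lb)).
    { intros [a b] Hab; apply in_prod; [apply Hin; left|apply Ib].
      - now apply (in_map fst) in Hab.
      - now apply (in_map snd) in Hab. }
    assert (A2 := H0 _ I0).
    assert (A3 := RS_ub G M BG (list_prod la' lb') (NoDup_list_prod _ _ Hla' Hlb')).
    rewrite sumR_list_prod in A2, A3; unfold G in A2 at 2, A3 at 1; simpl in A2, A3; lra. }
  set (m := sumC la (fun a => sumC lb (F a))).
  assert (K1 : Cmod (Cminus (sumC la r) m) <= eps / 4).
  { apply row_sums_near_rectangle; auto. }
  assert (K2 : Cmod (Cminus (sumC lb c) m) <= eps / 4).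
  { unfold m; rewrite sumC_exchange.
    apply (row_sums_near_rectangle (fun b a => F a b)); auto.
    intros la' Hla' _; rewrite !(sumR_exchange lb); auto. }
  assert (T1 := Cmod_triangle3 (sumC lb c) m s).
  assert (T2 := Cmod_triangle3 m (sumC la r) s).
  rewrite (Cmod_minus_sym m (sumC la r)) in T2; lra.
Qed.

(** Fubini on the triangular array [F i n]: row [i] is the sequence [y] delayed by [i] places and
    multiplied by [x i], with sum [x i * Y], and column [n] is the finite convolution. *)
Lemma has_sum_cauchy_product (x y : nat -> C) X Y M :
  bsum (fun n => Cmod (x n)) M -> bsum (fun n => Cmod (y n)) M ->
  has_sum x X -> has_sum y Y ->
  has_sum (fun n => sumC (seq 0 (S n)) (fun i => Cmult (x i) (y (n - i)%nat))) (Cmult X Y).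
Proof.
  intros Mx My Hx Hy.
  set (F := fun i n => if Nat.leb i n then Cmult (x i) (y (n - i)%nat) else RtoC 0).
  assert (M0 : 0 <= M) by (apply (Mx nil); constructor).
  apply (has_sum_fubini F (M * M) (fun i => Cmult (x i) Y)).
  - intros la lb Hla Hlb.
    apply Rle_trans with (sumR la (fun i => Cmod (x i) * M)).
    + apply sumR_le; intros i _.
      set (lb' := map (fun n => n - i)%nat (filter (fun n => Nat.leb i n) lb)).
      replace (sumR lb (fun b => Cmod (F i b))) with (Cmod (x i) * sumR lb' (fun n => Cmod (y n))).
      * apply Rmult_le_compat_l; [apply Cmod_ge_0|]; apply My.
        unfold lb'; clear - Hlb; induction lb as [|b lb IH]; simpl; [constructor|].
        inversion Hlb as [|? ? H1 H2]; subst; destruct (Nat.leb_spec i b); auto.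
        simpl; constructor; auto; rewrite in_map_iff; intros (b' & E & Hb').
        apply filter_In in Hb' as [Hb' Hle]; apply Nat.leb_le in Hle.
        apply H1; replace b with b' by lia; easy.
      * rewrite <- sumR_scal; unfold lb'; rewrite sumR_map.
        clear; induction lb as [|b lb IH]; [easy|].
        change (sumR (b :: lb) (fun b => Cmod (F i b)))
          with (Cmod (F i b) + sumR lb (fun b => Cmod (F i b))).
        rewrite <- IH; unfold F; simpl; destruct (Nat.leb i b).
        -- simpl; rewrite Cmod_mult; easy.
        -- rewrite Cmod_0; lra.
    + rewrite (sumR_ext la _ (fun i => M * Cmod (x i))) by (intros; ring).
      rewrite sumR_scal; apply Rmult_le_compat_l; auto.
  - intros i; eapply has_sum_ext; [|exact (has_sum_scal _ (x i) _ (has_sum_shift y Y i Hy))].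
    intros n; unfold F; simpl; destruct (Nat.leb i n); ring.
  - intros n.
    replace (sumC (seq 0 (S n)) (fun i => Cmult (x i) (y (n - i)%nat)))
      with (sumC (seq 0 (S n)) (fun i => F i n)).
    + apply (has_sum_finite (fun i => F i n)); [apply seq_NoDup|].
      intros i Hi; unfold F; rewrite in_seq in Hi; destruct (Nat.leb_spec i n); [lia|easy].
    + apply sumC_ext; intros i Hi; apply in_seq in Hi; unfold F.
      destruct (Nat.leb_spec i n); [easy|lia].
  - eapply has_sum_ext; [|replace (Cmult X Y) with (Cmult Y X) by ring;
                           exact (has_sum_scal _ Y _ Hx)].
    intros i; simpl; ring.
Qed.

(** * The lattice of wavevectors *)

Lemma in_zrange z N : In z (zrange N) <-> (Z.abs z <= Z.of_nat N)%Z.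
Proof.
  unfold zrange; rewrite in_map_iff; split.
  - intros (m & <- & Hm); apply in_seq in Hm; lia.
  - intros H; exists (Z.to_nat (z + Z.of_nat N)); split; [lia|apply in_seq; lia].
Qed.

Lemma NoDup_zrange N : NoDup (zrange N).
Proof. apply NoDup_map_injective; [intros; lia|apply seq_NoDup]. Qed.

Lemma in_box n N k :
  In k (box n N) <-> (forall j, (j < n)%nat -> (Z.abs (k j) <= Z.of_nat N)%Z) /\ validk n k.
Proof.
  revert k; induction n as [|n IH]; intros k; simpl.
  - split.
    + intros [<-|[]]; split; [lia|now intros j _].
    + intros [_ H]; left; apply functional_extensionality; intros j; symmetry; apply H; lia.
  - rewrite in_flat_map; split.
    + intros (z & Hz & Hk); apply in_zrange in Hz.
      apply in_map_iff in Hk as (k' & <- & Hk'); apply IH in Hk' as [H1 H2]; split.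
      * intros j Hj; destruct (Nat.eqb_spec j n); auto; apply H1; lia.
      * intros j Hj; destruct (Nat.eqb_spec j n); [lia|apply H2; lia].
    + intros [H1 H2]; exists (k n); split; [apply in_zrange, H1; lia|].
      apply in_map_iff; exists (fun j => if Nat.eqb j n then 0%Z else k j); split.
      * apply functional_extensionality; intros j; destruct (Nat.eqb_spec j n); congruence.
      * apply IH; split.
        -- intros j Hj; destruct (Nat.eqb_spec j n); [lia|apply H1; lia].
        -- intros j Hj; destruct (Nat.eqb_spec j n); auto; apply H2; lia.
Qed.

Lemma NoDup_box n N : NoDup (box n N).
Proof.
  induction n as [|n IH]; simpl; [constructor; [easy|constructor]|].
  assert (E : flat_map (fun z => map (fun k : Vec => fun j => if Nat.eqb j n then z else k j)
             (box n N)) (zrange N) =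
             map (fun p : Z * Vec => fun j => if Nat.eqb j n then fst p else snd p j)
             (list_prod (zrange N) (box n N))).
  { induction (zrange N) as [|z l IHl]; simpl; auto.
    rewrite map_app, map_map, IHl; easy. }
  rewrite E; assert (Hn := NoDup_list_prod _ _ (NoDup_zrange N) IH).
  assert (Hv : forall p, In p (list_prod (zrange N) (box n N)) -> validk n (snd p)).
  { intros [z k] Hp; apply in_prod_iff in Hp as [_ Hp]; now apply in_box in Hp. }
  clear E; induction Hn as [|p l Hp Hl IHl]; simpl; constructor.
  - rewrite in_map_iff; intros (q & Eq & Hq); apply Hp; replace p with q; auto.
    destruct p as [z k], q as [z' k']; simpl in *.
    assert (E1 := f_equal (fun h => h n) Eq); simpl in E1; rewrite Nat.eqb_refl in E1.
    f_equal; auto; apply functional_extensionality; intros j.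
    assert (E2 := f_equal (fun h => h j) Eq); simpl in E2.
    destruct (Nat.eqb_spec j n) as [e|]; auto; rewrite e.
    assert (V1 := Hv (z, k) (or_introl eq_refl) n (le_n n)).
    assert (V2 := Hv (z', k') (or_intror Hq) n (le_n n)).
    simpl in V1, V2; congruence.
  - apply IHl; intros; apply Hv; now right.
Qed.

Lemma box_mono n N M : (N <= M)%nat -> incl (box n N) (box n M).
Proof.
  intros H k Hk; apply in_box in Hk as [H1 H2]; apply in_box; split; auto.
  intros j Hj; specialize (H1 j Hj); lia.
Qed.

Lemma validk_in_box d k : validk d k -> exists N, In k (box d N).
Proof.
  intros H; assert (E : forall n, exists N, forall j, (j < n)%nat -> (Z.abs (k j) <= Z.of_nat N)%Z).
  { induction n as [|n [N HN]]; [exists O; lia|].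
    exists (N + Z.to_nat (Z.abs (k n)))%nat; intros j Hj.
    destruct (Nat.eq_dec j n) as [->|]; [lia|]; assert (j < n)%nat by lia.
    specialize (HN j H0); lia. }
  destruct (E d) as [N HN]; exists N; now apply in_box.
Qed.

(** Bridge between the boxes in which the system is stated and the arbitrary finite sets used for
    unconditional sums. *)
Lemma box_cofinal d (l : list Vec) :
  exists N0, forall N, (N0 <= N)%nat -> forall k, In k l -> validk d k -> In k (box d N).
Proof.
  induction l as [|k l [N0 IH]]; [exists O; easy|].
  destruct (classic (validk d k)) as [Hk|Hk].
  - destruct (validk_in_box d k Hk) as [N1 H1].
    exists (N0 + N1)%nat; intros N HN k' [<-|Hk'] Hv.
    + apply (box_mono d N1); auto; lia.
    + apply IH; auto; lia.
  - exists N0; intros N HN k' [<-|Hk'] Hv; [easy|apply IH; auto].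
Qed.

(** Admissibility constrains infinitely many coordinates, so the boolean test is classical; it
    serves to filter lists and to cut off states. *)
Definition validb d (k : Vec) : bool :=
  if excluded_middle_informative (validk d k) then true else false.

Lemma validb_spec d k : validb d k = true <-> validk d k.
Proof. unfold validb; destruct (excluded_middle_informative _); easy. Qed.

Lemma bsum_box d f M :
  (forall k, 0 <= f k) -> (forall k, ~ validk d k -> f k = 0) ->
  (forall N, sumR (box d N) f <= M) -> bsum f M.
Proof.
  intros H0 H1 H2 l Hl; destruct (box_cofinal d l) as [N HN].
  apply Rle_trans with (sumR (filter (validb d) l) f).
  - apply Req_le; clear HN Hl; induction l as [|k l IH]; simpl; auto.
    change (sumR (k :: l) f) with (f k + sumR l f); rewrite IH.
    destruct (validb d k) eqn:E; [easy|]; rewrite H1; [lra|].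
    rewrite <- validb_spec; congruence.
  - eapply Rle_trans; [apply (sumR_incl_le _ (box d N)); auto|auto].
    + now apply NoDup_filter.
    + intros k Hk; apply filter_In in Hk as [Hk Hv]; apply validb_spec in Hv; auto.
Qed.

Lemma conv_to_has_sum d f s :
  (forall k, ~ validk d k -> f k = RtoC 0) -> has_sum f s -> conv_to d f s.
Proof.
  intros Hf Hs.
  assert (key : forall eps, 0 < eps -> exists N0, forall N, (N0 <= N)%nat ->
            Cmod (Cminus (sumC (box d N) f) s) < eps).
  { intros eps He; destruct (Hs eps He) as [l0 H0].
    destruct (box_cofinal d l0) as [N0 HN]; exists N0; intros N HN'.
    (* The list [l0] may contain inadmissible vectors, which lie in no box; [m] collects them and
       contributes zero to the sum. *)
    destruct (list_union (filter (fun k => negb (validb d k)) l0) nil) as (m & Hm & Hm').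
    replace (sumC (box d N) f) with (sumC (box d N ++ m) f).
    - apply H0.
      + apply NoDup_app_disjoint; auto; [apply NoDup_box|].
        intros k Hk Hk'; apply in_box in Hk as [_ Hk].
        apply Hm' in Hk' as [Hk'|[]]; apply filter_In in Hk' as [_ Hk'].
        apply validb_spec in Hk; rewrite Hk in Hk'; easy.
      + intros k Hk; apply in_or_app; destruct (validb d k) eqn:E.
        * left; apply HN; auto; now apply validb_spec.
        * right; apply Hm'; left; apply filter_In; split; auto; now rewrite E.
    - rewrite sumC_app, (sumC_zero m); [ring|].
      intros k Hk; apply Hm' in Hk as [Hk|[]]; apply filter_In in Hk as [_ Hk].
      apply Hf; rewrite <- validb_spec; destruct (validb d k); easy. }
  split; apply is_lim_seq_spec; intros eps; destruct (key eps (cond_pos eps)) as [N0 HN];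
    exists N0; intros N HN'; (eapply Rle_lt_trans; [|apply (HN N HN')]).
  - apply (re_le_Cmod (Cminus (sumC (box d N) f) s)).
  - apply (im_le_Cmod (Cminus (sumC (box d N) f) s)).
Qed.

Lemma sum_lt_S n f : sum_lt (S n) f = sum_lt n f + f n.
Proof.
  unfold sum_lt; rewrite seq_S, sumR_app; simpl; lra.
Qed.

Lemma knorm_pos d k : 0 <= knorm d k.
Proof. apply sqrt_pos. Qed.

Lemma knorm_sq d k : knorm d k ^ 2 = sum_lt d (fun i => IZR (k i) ^ 2).
Proof.
  apply pow2_sqrt, sumR_nonneg; intros; apply pow2_ge_0.
Qed.

Lemma knorm_triangle d k j : knorm d k <= knorm d j + knorm d (vsub k j).
Proof.
  assert (H0 := knorm_pos d j); assert (H1 := knorm_pos d (vsub k j)).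
  assert (H := minkowski (seq 0 d) (fun i => IZR (j i)) (fun i => IZR (vsub k j i))
     (knorm d j) (knorm d (vsub k j)) H0 H1).
  specialize (H (Req_le _ _ (eq_sym (knorm_sq d j))) (Req_le _ _ (eq_sym (knorm_sq d (vsub k j))))).
  apply Rsqr_incr_0_var; [|lra].
  rewrite !Rsqr_pow2, knorm_sq; unfold sum_lt; eapply Rle_trans; [|exact H].
  apply Req_le, sumR_ext; intros i _; unfold vsub; rewrite minus_IZR; f_equal; ring.
Qed.

Lemma coord_le_knorm d k i : (i < d)%nat -> Rabs (IZR (k i)) <= knorm d k.
Proof.
  intros H; apply Rsqr_incr_0_var; [|apply knorm_pos].
  rewrite !Rsqr_pow2, knorm_sq, pow2_abs.
  apply (sumR_in_le (seq 0 d) (fun i => IZR (k i) ^ 2)); [intros; apply pow2_ge_0|].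
  apply in_seq; lia.
Qed.

Lemma knorm_zero d : knorm d zerok = 0.
Proof.
  unfold knorm, sum_lt; rewrite sumR_zero, sqrt_0; auto; intros; unfold zerok; simpl; ring.
Qed.

Lemma knorm_ge_1 d k : validk d k -> k <> zerok -> 1 <= knorm d k.
Proof.
  intros Hv Hk; apply Rnot_lt_le; intros H; apply Hk.
  apply functional_extensionality; intros i; destruct (Nat.lt_ge_cases i d) as [Hi|Hi]; auto.
  assert (H' := coord_le_knorm d k i Hi); rewrite <- abs_IZR in H'.
  assert (H2 : IZR (Z.abs (k i)) < 1) by lra; apply lt_IZR in H2; unfold zerok; lia.
Qed.

Lemma knorm_le_0 d k : validk d k -> knorm d k <= 0 -> k = zerok.
Proof.
  intros Hv H; apply NNPP; intros Hk; assert (H' := knorm_ge_1 d k Hv Hk); lra.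
Qed.

Lemma vsub_inj_l j k k' : vsub k j = vsub k' j -> k = k'.
Proof.
  intros H; apply functional_extensionality; intros i.
  assert (E := f_equal (fun h => h i) H); unfold vsub in E; simpl in E; lia.
Qed.

Lemma vsub_inj_r k j j' : vsub k j = vsub k j' -> j = j'.
Proof.
  intros H; apply functional_extensionality; intros i.
  assert (E := f_equal (fun h => h i) H); unfold vsub in E; simpl in E; lia.
Qed.

Lemma validk_vsub d k j : validk d j -> validk d (vsub k j) -> validk d k.
Proof.
  intros H1 H2 i Hi; assert (E1 := H1 i Hi); assert (E2 := H2 i Hi); unfold vsub in E2; lia.
Qed.

(** * Exponentially weighted Wiener norms *)

(** A bound on the weighted Wiener norm rather than the norm itself, so that finiteness needs no
    separate hypothesis. *)
Definition nb (d : nat) (beta : R) (f : Vec -> R) (M : R) :=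
  bsum (fun k => f k * exp (beta * knorm d k)) M.

Lemma exp_ge_1 x : 0 <= x -> 1 <= exp x.
Proof. intros H; assert (H' := exp_ineq1_le x); lra. Qed.

Lemma exp_mono x y : x <= y -> exp x <= exp y.
Proof. intros [H| ->]; [now apply Rlt_le, exp_increasing|apply Rle_refl]. Qed.

Lemma nb_mono_beta d b b' f M :
  (forall k, 0 <= f k) -> b <= b' -> nb d b' f M -> nb d b f M.
Proof.
  intros Hf H Hg l Hl; eapply Rle_trans; [|now apply (Hg l)].
  apply sumR_le; intros k _; apply Rmult_le_compat_l; auto.
  apply exp_mono, Rmult_le_compat_r; auto; apply knorm_pos.
Qed.

Lemma nb_bsum d beta f M :
  (forall k, 0 <= f k) -> 0 <= beta -> nb d beta f M -> bsum f M.
Proof.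
  intros Hf H Hg l Hl; eapply Rle_trans; [|now apply (Hg l)].
  apply sumR_le; intros k _; rewrite <- (Rmult_1_r (f k)) at 1.
  apply Rmult_le_compat_l; auto; apply exp_ge_1, Rmult_le_pos; auto; apply knorm_pos.
Qed.

Lemma bsum_pos {A} (f : A -> R) M : bsum f M -> 0 <= M.
Proof. intros H; apply (H nil); constructor. Qed.

Lemma bsum_point {A} (f : A -> R) M a : bsum f M -> f a <= M.
Proof.
  intros H; assert (E := H (a :: nil)); unfold sumR in E; simpl in E.
  rewrite Rplus_0_r in E; apply E; constructor; [easy|constructor].
Qed.

Lemma bsum_le {A} (f g : A -> R) M : (forall a, f a <= g a) -> bsum g M -> bsum f M.
Proof.
  intros H HM l Hl; eapply Rle_trans; [apply sumR_le; intros; apply H|auto].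
Qed.

Lemma bsum_scal {A} (f : A -> R) c M : 0 <= c -> bsum f M -> bsum (fun a => c * f a) (c * M).
Proof. intros H HM l Hl; rewrite sumR_scal; apply Rmult_le_compat_l; auto. Qed.

Lemma bsum_conv f g M M' k :
  (forall j, 0 <= f j) -> (forall j, 0 <= g j) -> bsum f M -> bsum g M' ->
  bsum (fun j => f j * g (vsub k j)) (M * M').
Proof.
  intros Hf Hg HM HM'; apply bsum_le with (fun j => M' * f j).
  - intros j; rewrite Rmult_comm; apply Rmult_le_compat_r; auto.
    now apply (bsum_point g).
  - rewrite Rmult_comm; apply bsum_scal; auto; now apply (bsum_pos g).
Qed.

Lemma conv_double_sum f g M M' l la :
  (forall j, 0 <= f j) -> (forall j, 0 <= g j) -> bsum f M -> bsum g M' ->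
  NoDup l -> NoDup la ->
  sumR l (fun k => sumR la (fun j => f j * g (vsub k j))) <= M * M'.
Proof.
  intros Hf Hg HM HM' Hl Hla; rewrite sumR_exchange.
  apply Rle_trans with (sumR la (fun j => M' * f j)).
  - apply sumR_le; intros j _; rewrite sumR_scal, Rmult_comm.
    apply Rmult_le_compat_r; auto; rewrite <- (sumR_map (fun k => vsub k j) l g).
    apply HM', NoDup_map_injective; auto; intros; eapply vsub_inj_l; eauto.
  - rewrite sumR_scal, Rmult_comm; apply Rmult_le_compat_r; auto; now apply (bsum_pos g).
Qed.

(** The algebra property of the weighted Wiener space: by the triangle inequality the weight at [k]
    is at most the product of the weights at [j] and [k - j]. *)
Lemma nb_conv d beta f g M M' :
  (forall j, 0 <= f j) -> (forall j, 0 <= g j) -> 0 <= beta ->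
  nb d beta f M -> nb d beta g M' ->
  nb d beta (fun k => RS (fun j => f j * g (vsub k j))) (M * M').
Proof.
  intros Hf Hg Hb HM HM' l Hl.
  assert (Bf := nb_bsum _ _ _ _ Hf Hb HM); assert (Bg := nb_bsum _ _ _ _ Hg Hb HM').
  assert (He : forall k, 0 <= exp (beta * knorm d k)) by (intros; apply Rlt_le, exp_pos).
  set (F := fun k j => exp (beta * knorm d k) * (f j * g (vsub k j))).
  assert (HF : forall k j, 0 <= F k j).
  { intros; unfold F; apply Rmult_le_pos; auto; apply Rmult_le_pos; auto. }
  assert (BF : forall k, bsum (F k) (exp (beta * knorm d k) * (M * M'))).
  { intros k; apply bsum_scal; auto; now apply bsum_conv. }
  apply Rle_trans with (sumR l (fun k => RS (F k))).
  - apply sumR_le; intros k _.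
    (* The weight depends on [k] only; dividing by it and multiplying back moves it inside the
       supremum over [j]. *)
    rewrite Rmult_comm; apply Rmult_le_reg_l with (/ exp (beta * knorm d k)).
    { apply Rinv_0_lt_compat, exp_pos. }
    rewrite <- Rmult_assoc, Rinv_l, Rmult_1_l by (apply Rgt_not_eq, exp_pos).
    apply RS_le; intros la Hla.
    apply Rmult_le_reg_l with (exp (beta * knorm d k)); [apply exp_pos|].
    rewrite <- Rmult_assoc, Rinv_r, Rmult_1_l by (apply Rgt_not_eq, exp_pos).
    rewrite <- sumR_scal; now apply (RS_ub (F k) _ (BF k)).
  - apply (sumR_RS_le l F (fun k => exp (beta * knorm d k) * (M * M'))); auto.
    intros la Hla.
    eapply Rle_trans; [|apply (conv_double_sum (fun j => f j * exp (beta * knorm d j))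
      (fun j => g j * exp (beta * knorm d j)) M M' l la); auto;
      intros; apply Rmult_le_pos; auto].
    apply sumR_le; intros k _; apply sumR_le; intros j _; unfold F.
    replace (f j * _ * _) with (exp (beta * knorm d j + beta * knorm d (vsub k j)) *
      (f j * g (vsub k j))) by (rewrite exp_plus; ring).
    apply Rmult_le_compat_r; [now apply Rmult_le_pos|].
    apply exp_mono; rewrite <- Rmult_plus_distr_l; apply Rmult_le_compat_l; auto.
    apply knorm_triangle.
Qed.

(** Suprema of sums are in general only subadditive; the opposite inequality holds here because
    partial sums of nonnegative families increase along a directed set. *)
Lemma sumR_RS_sum {A B} (lb : list B) (F : B -> A -> R) (M : B -> R) :
  (forall b a, 0 <= F b a) -> (forall b, In b lb -> bsum (F b) (M b)) ->
  sumR lb (fun b => RS (F b)) <= RS (fun a => sumR lb (fun b => F b a)).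
Proof.
  intros HF HM; apply (sumR_RS_le lb F M); auto.
  intros la Hla; rewrite sumR_exchange.
  refine (RS_ub _ (sumR lb M) _ la Hla).
  intros l Hl; rewrite sumR_exchange; apply sumR_le; intros; now apply HM.
Qed.

(** * Lattice sums *)

(** Discrete form of the integral test. After clearing denominators it reduces to
    [(x - 1) * (x + 1) <= x * x]. *)
Lemma inv_pow_telescope x m :
  1 < x -> (1 <= m)%nat -> / x ^ (S m) <= / (x - 1) ^ m - / x ^ m.
Proof.
  intros Hx Hm.
  assert (P1 : 0 < x ^ m) by (apply pow_lt; lra).
  assert (P2 : 0 < (x - 1) ^ m) by (apply pow_lt; lra).
  assert (H : (x - 1) ^ m * (x + 1) <= x ^ m * x).
  { destruct m as [|m]; [lia|]; clear Hm.
    assert (Q : (x - 1) ^ m <= x ^ m) by (apply pow_incr; lra).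
    assert (Q0 : 0 <= (x - 1) ^ m) by (apply pow_le; lra).
    simpl; nra. }
  apply Rmult_le_reg_r with (x ^ S m * (x - 1) ^ m).
  - apply Rmult_lt_0_compat; auto; apply pow_lt; lra.
  - simpl; field_simplify; try lra; nra.
Qed.

Lemma zrange_sum_le A m N : 1 <= A -> (1 <= m)%nat ->
  sumR (zrange N) (fun z => / (A + IZR (Z.abs z)) ^ (S m)) <= 3 * / A ^ m.
Proof.
  intros HA Hm.
  assert (P : forall n : nat, 0 < / (A + INR n) ^ m).
  { intros n; apply Rinv_0_lt_compat, pow_lt; assert (H := pos_INR n); lra. }
  (* The middle term plus two equal telescoping halves; since [A >= 1] each of these three parts is
     at most [/ A ^ m], whence the constant 3. *)
  assert (H : sumR (zrange N) (fun z => / (A + IZR (Z.abs z)) ^ (S m)) <=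
              / A ^ S m + 2 * (/ A ^ m - / (A + INR N) ^ m)).
  { induction N as [|N IH].
    - unfold zrange, sumR; simpl; rewrite !Rplus_0_r; lra.
    - set (F := fun z => / (A + IZR (Z.abs z)) ^ (S m)) in *.
      assert (E : sumR (zrange (S N)) F = 2 * F (Z.of_nat (S N)) + sumR (zrange N) F).
      { unfold zrange; rewrite !sumR_map.
        replace (2 * S N + 1)%nat with (S (S (2 * N + 1)))%nat by lia.
        rewrite seq_S, sumR_app.
        change (seq 0 (S (2 * N + 1))) with (O :: seq 1 (2 * N + 1)).
        rewrite <- seq_shift.
        change (sumR (O :: ?l) ?f) with (f O + sumR l f).
        rewrite sumR_map.
        match goal with |- context [sumR (?x :: nil) ?f] =>
          change (sumR (x :: nil) f) with (f x + 0) end.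
        cbv beta.
        rewrite (sumR_ext (seq 0 (2 * N + 1)) _
          (fun m0 => F (Z.of_nat m0 - Z.of_nat N)%Z)) by (intros; f_equal; lia).
        replace (F (Z.of_nat 0 - Z.of_nat (S N))%Z) with (F (Z.of_nat (S N)))
          by (unfold F; do 4 f_equal; lia).
        replace (F (Z.of_nat (0 + S (2 * N + 1)) - Z.of_nat (S N))%Z)
          with (F (Z.of_nat (S N))) by (f_equal; lia).
        lra. }
      rewrite E.
      assert (T : F (Z.of_nat (S N)) <= / (A + INR N) ^ m - / (A + INR (S N)) ^ m).
      { unfold F; replace (Z.abs (Z.of_nat (S N))) with (Z.of_nat (S N)) by lia.
        rewrite <- INR_IZR_INZ.
        assert (T := inv_pow_telescope (A + INR (S N)) m).
        rewrite S_INR in *; replace (A + (INR N + 1) - 1) with (A + INR N) in T by ring.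
        apply T; auto; assert (Hp := pos_INR N); lra. }
      lra. }
  assert (/ A ^ S m <= / A ^ m).
  { apply Rinv_le_contravar; [apply pow_lt; lra|].
    simpl; assert (0 < A ^ m) by (apply pow_lt; lra); nra. }
  specialize (P N); lra.
Qed.

(** Summing out one coordinate costs one power and a factor 3. The exponent [m + n] carries one
    power for each coordinate still to be summed, and [A] absorbs the coordinate just fixed. *)
Lemma box_sum_le n N : forall A m, 1 <= A -> (1 <= m)%nat ->
  sumR (box n N) (fun k => / (A + sum_lt n (fun i => IZR (Z.abs (k i)))) ^ (m + n)) <=
  3 ^ n * / A ^ m.
Proof.
  induction n as [|n IH]; intros A m HA Hm.
  - unfold sumR, sum_lt, sumR; simpl; rewrite !Rplus_0_r, Nat.add_0_r; lra.
  - simpl box; rewrite sumR_flat_map.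
    apply Rle_trans with (sumR (zrange N) (fun z => 3 ^ n * / (A + IZR (Z.abs z)) ^ (S m))).
    + apply sumR_le; intros z _; rewrite sumR_map.
      eapply Rle_trans; [|apply IH; [|lia]].
      * apply Req_le, sumR_ext; intros k _.
        replace (m + S n)%nat with (S m + n)%nat by lia.
        do 2 f_equal; rewrite sum_lt_S, Nat.eqb_refl.
        assert (E : sum_lt n (fun i => IZR (Z.abs (if Nat.eqb i n then z else k i))) =
                    sum_lt n (fun i => IZR (Z.abs (k i)))).
        { apply sumR_ext; intros i Hi; apply in_seq in Hi.
          destruct (Nat.eqb_spec i n); [lia|easy]. }
        rewrite E; ring.
      * assert (0 <= IZR (Z.abs z)) by (apply (IZR_le 0); lia); lra.
    + rewrite sumR_scal; assert (H := zrange_sum_le A m N HA Hm).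
      replace (3 ^ S n * / A ^ m) with (3 ^ n * (3 * / A ^ m)) by (simpl; ring).
      apply Rmult_le_compat_l; [apply pow_le; lra|exact H].
Qed.

(** The factor [3 ^ d] is that of [box_sum_le] at [A = m = 1]; the other one comes from
    [1 + |k|_1 <= (d + 1) * |k|] on nonzero wavevectors, raised to the power [d + 1]. *)
Definition lattice_const (d : nat) : R := INR (S d) ^ (S d) * 3 ^ d.

Lemma lattice_sum d N :
  sumR (box d N) (fun k => if Rle_dec (knorm d k) 0 then 0 else / knorm d k ^ (S d)) <=
  lattice_const d.
Proof.
  assert (HS : 0 < INR (S d)) by (apply lt_0_INR; lia).
  assert (H := box_sum_le d N 1 1 (Rle_refl 1) (le_n 1)).
  rewrite pow1, Rinv_1, Rmult_1_r in H.
  unfold lattice_const; eapply Rle_trans; [|apply Rmult_le_compat_l; [|exact H]].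
  2: now apply pow_le, Rlt_le.
  rewrite <- sumR_scal; apply sumR_le; intros k Hk; apply in_box in Hk as [_ Hv].
  set (T := sum_lt d (fun i => IZR (Z.abs (k i)))).
  assert (HT : 0 <= T) by (apply sumR_nonneg; intros; apply (IZR_le 0); lia).
  assert (P : 0 < (1 + T) ^ S d) by (apply pow_lt; lra).
  destruct (Rle_dec (knorm d k) 0) as [Hk|Hk].
  - apply Rmult_le_pos; [now apply pow_le, Rlt_le|now apply Rlt_le, Rinv_0_lt_compat].
  - assert (H1 : 1 <= knorm d k).
    { apply knorm_ge_1; auto; intros ->; apply Hk; rewrite knorm_zero; lra. }
    assert (HTk : 1 + T <= INR (S d) * knorm d k).
    { rewrite S_INR.
      assert (T <= INR d * knorm d k); [|lra].
      unfold T, sum_lt; replace (INR d) with (INR (length (seq 0 d))) by now rewrite length_seq.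
      rewrite <- sumR_const.
      apply sumR_le; intros i Hi; apply in_seq in Hi; rewrite abs_IZR.
      apply coord_le_knorm; lia. }
    apply Rmult_le_reg_l with (knorm d k ^ S d * (1 + T) ^ S d).
    { apply Rmult_lt_0_compat; auto; apply pow_lt; lra. }
    change (1 + d)%nat with (S d).
    replace (knorm d k ^ S d * (1 + T) ^ S d * / knorm d k ^ S d) with ((1 + T) ^ S d).
    2: field; apply pow_nonzero; lra.
    replace (knorm d k ^ S d * (1 + T) ^ S d * (INR (S d) ^ S d * / (1 + T) ^ S d))
      with ((INR (S d) * knorm d k) ^ S d).
    2: rewrite Rpow_mult_distr; field; lra.
    apply pow_incr; lra.
Qed.

(** * A Schwarz lemma for continuously differentiable holomorphic functions *)

Definition cderiv (f : C -> C) (z l : C) :=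
  forall eps, 0 < eps -> exists delta, 0 < delta /\ forall h, Cmod h < delta ->
    Cmod (Cminus (Cminus (f (Cplus z h)) (f z)) (Cmult l h)) <= eps * Cmod h.

Definition ccont (g : C -> C) (z : C) :=
  forall eps, 0 < eps -> exists delta, 0 < delta /\ forall w, Cmod (Cminus w z) < delta ->
    Cmod (Cminus (g w) (g z)) < eps.

Definition pcont (p : R -> C) (x : R) :=
  continuity_pt (fun t => Re (p t)) x /\ continuity_pt (fun t => Im (p t)) x.

Definition pderiv (p : R -> C) (x : R) (l : C) :=
  derivable_pt_lim (fun t => Re (p t)) x (Re l) /\ derivable_pt_lim (fun t => Im (p t)) x (Im l).

Lemma pderiv_pcont p x l : pderiv p x l -> pcont p x.
Proof.
  intros [H1 H2]; split; apply derivable_continuous_pt; eexists; eauto.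
Qed.

Lemma pderiv_const c x : pderiv (fun _ => c) x (RtoC 0).
Proof. split; apply derivable_pt_lim_const. Qed.

Lemma pderiv_eq p x l l' : l = l' -> pderiv p x l -> pderiv p x l'.
Proof. now intros ->. Qed.

Lemma pderiv_plus p q x l l' :
  pderiv p x l -> pderiv q x l' -> pderiv (fun t => Cplus (p t) (q t)) x (Cplus l l').
Proof.
  intros [H1 H2] [H3 H4]; split.
  - apply (derivable_pt_lim_plus (fun t => Re (p t)) (fun t => Re (q t))); auto.
  - apply (derivable_pt_lim_plus (fun t => Im (p t)) (fun t => Im (q t))); auto.
Qed.

Lemma pderiv_mult p q x l l' :
  pderiv p x l -> pderiv q x l' ->
  pderiv (fun t => Cmult (p t) (q t)) x (Cplus (Cmult l (q x)) (Cmult (p x) l')).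
Proof.
  intros [H1 H2] [H3 H4]; split.
  - replace (Re _) with ((Re l * Re (q x) + Re (p x) * Re l') -
                         (Im l * Im (q x) + Im (p x) * Im l')) by (simpl; unfold Re, Im; ring).
    apply (derivable_pt_lim_minus (fun t => Re (p t) * Re (q t)) (fun t => Im (p t) * Im (q t))).
    + apply (derivable_pt_lim_mult (fun t => Re (p t)) (fun t => Re (q t))); auto.
    + apply (derivable_pt_lim_mult (fun t => Im (p t)) (fun t => Im (q t))); auto.
  - replace (Im _) with ((Re l * Im (q x) + Re (p x) * Im l') +
                         (Im l * Re (q x) + Im (p x) * Re l')) by (simpl; unfold Re, Im; ring).
    apply (derivable_pt_lim_plus (fun t => Re (p t) * Im (q t)) (fun t => Im (p t) * Re (q t))).
    + apply (derivable_pt_lim_mult (fun t => Re (p t)) (fun t => Im (q t))); auto.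
    + apply (derivable_pt_lim_mult (fun t => Im (p t)) (fun t => Re (q t))); auto.
Qed.

Lemma pderiv_scal c p x l : pderiv p x l -> pderiv (fun t => Cmult c (p t)) x (Cmult c l).
Proof.
  intros H; eapply pderiv_eq; [|exact (pderiv_mult _ _ _ _ _ (pderiv_const c x) H)].
  simpl; ring.
Qed.

Lemma pderiv_RtoC x : pderiv (fun t => RtoC t) x (RtoC 1).
Proof. split; [apply derivable_pt_lim_id|apply derivable_pt_lim_const]. Qed.

Lemma pcont_const c x : pcont (fun _ => c) x.
Proof. eapply pderiv_pcont, pderiv_const. Qed.

Lemma pcont_mult p q x : pcont p x -> pcont q x -> pcont (fun t => Cmult (p t) (q t)) x.
Proof.
  intros [H1 H2] [H3 H4]; split.
  - apply (continuity_pt_minus (fun t => Re (p t) * Re (q t)) (fun t => Im (p t) * Im (q t)));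
      [apply (continuity_pt_mult (fun t => Re (p t)) (fun t => Re (q t)))|
       apply (continuity_pt_mult (fun t => Im (p t)) (fun t => Im (q t)))]; auto.
  - apply (continuity_pt_plus (fun t => Re (p t) * Im (q t)) (fun t => Im (p t) * Re (q t)));
      [apply (continuity_pt_mult (fun t => Re (p t)) (fun t => Im (q t)))|
       apply (continuity_pt_mult (fun t => Im (p t)) (fun t => Re (q t)))]; auto.
Qed.

Lemma Cmod_sq (z : C) : Cmod z ^ 2 = Re z ^ 2 + Im z ^ 2.
Proof.
  unfold Cmod, Re, Im; apply pow2_sqrt.
  assert (H1 := pow2_ge_0 (fst z)); assert (H2 := pow2_ge_0 (snd z)); lra.
Qed.

Lemma pcont_scal c p x : pcont p x -> pcont (fun t => Cmult c (p t)) x.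
Proof. intros H; apply (pcont_mult (fun _ => c)); auto using pcont_const. Qed.

Lemma pcont_plus p q x : pcont p x -> pcont q x -> pcont (fun t => Cplus (p t) (q t)) x.
Proof.
  intros [H1 H2] [H3 H4]; split.
  - apply (continuity_pt_plus (fun t => Re (p t)) (fun t => Re (q t))); auto.
  - apply (continuity_pt_plus (fun t => Im (p t)) (fun t => Im (q t))); auto.
Qed.

Lemma pcont_inv p x : p x <> RtoC 0 -> pcont p x -> pcont (fun t => Cinv (p t)) x.
Proof.
  intros Hp [H1 H2].
  assert (Hd : continuity_pt (fun t => Re (p t) * Re (p t) + Im (p t) * Im (p t)) x).
  { apply (continuity_pt_plus (fun t => Re (p t) * Re (p t)) (fun t => Im (p t) * Im (p t)));
      [apply (continuity_pt_mult (fun t => Re (p t)) (fun t => Re (p t)))|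
       apply (continuity_pt_mult (fun t => Im (p t)) (fun t => Im (p t)))]; auto. }
  assert (Hn : Re (p x) * Re (p x) + Im (p x) * Im (p x) <> 0).
  { assert (H := Cmod_sq (p x)); assert (H' := Cmod_gt_0 (p x)); apply H' in Hp.
    assert (0 < Cmod (p x) ^ 2) by now apply pow_lt. lra. }
  split.
  - eapply (continuity_pt_ext (fun t => Re (p t) / (Re (p t) * Re (p t) + Im (p t) * Im (p t)))).
    + intros t; unfold Cinv, Re, Im; simpl; f_equal; ring.
    + apply (continuity_pt_div (fun t => Re (p t)) _ x); auto.
  - eapply (continuity_pt_ext (fun t => - Im (p t) / (Re (p t) * Re (p t) + Im (p t) * Im (p t)))).
    + intros t; unfold Cinv, Re, Im; simpl; f_equal; ring.
    + apply (continuity_pt_div (fun t => - Im (p t)) _ x); auto.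
      now apply (continuity_pt_opp (fun t => Im (p t))).
Qed.

(** The Cauchy-Riemann equations, put in the form of a real differential so that the two-variable
    chain rule applies to [f] along a path. *)
Lemma cderiv_differentiable f z l : cderiv f z l ->
  differentiable_pt_lim (fun x y => Re (f (x, y))) (Re z) (Im z) (Re l) (- Im l) /\
  differentiable_pt_lim (fun x y => Im (f (x, y))) (Re z) (Im z) (Im l) (Re l).
Proof.
  intros H.
  assert (key : forall eps : posreal, exists delta : posreal, forall u v,
    Rabs (u - Re z) < delta -> Rabs (v - Im z) < delta ->
    Cmod (Cminus (Cminus (f (u, v)) (f z)) (Cmult l (u - Re z, v - Im z))) <=
    eps * Rmax (Rabs (u - Re z)) (Rabs (v - Im z))).
  (* Half of [eps], because the modulus is at most twice the larger coordinate. *)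
  { intros eps; destruct (H (eps / 2)) as (delta & Hd & Hf).
    { apply Rdiv_lt_0_compat; [apply cond_pos|lra]. }
    assert (Hd2 : 0 < delta / 2) by lra.
    exists (mkposreal _ Hd2); simpl; intros u v Hu Hv.
    assert (Hm := Cmod_le_parts (u - Re z, v - Im z)); simpl in Hm.
    specialize (Hf (u - Re z, v - Im z)).
    replace (Cplus z (u - Re z, v - Im z)) with ((u, v) : C) in Hf
      by (destruct z; unfold Cplus; simpl; f_equal; ring).
    eapply Rle_trans; [apply Hf; lra|].
    assert (M1 := Rmax_l (Rabs (u - Re z)) (Rabs (v - Im z))).
    assert (M2 := Rmax_r (Rabs (u - Re z)) (Rabs (v - Im z))).
    assert (He := cond_pos eps).
    apply Rle_trans with (eps / 2 * (2 * Rmax (Rabs (u - Re z)) (Rabs (v - Im z)))); [|lra].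
    apply Rmult_le_compat_l; lra. }
  split; intros eps; destruct (key eps) as [delta Hd]; exists delta; intros u v Hu Hv;
    (eapply Rle_trans; [|apply (Hd u v Hu Hv)]).
  - eapply Rle_trans; [|apply re_le_Cmod]; apply Req_le; f_equal.
    destruct z; unfold Re, Im; simpl; ring.
  - eapply Rle_trans; [|apply im_le_Cmod]; apply Req_le; f_equal.
    destruct z; unfold Re, Im; simpl; ring.
Qed.

Lemma pderiv_comp f p x l l' :
  cderiv f (p x) l -> pderiv p x l' -> pderiv (fun t => f (p t)) x (Cmult l l').
Proof.
  intros Hf [H1 H2]; destruct (cderiv_differentiable f (p x) l Hf) as [D1 D2].
  split; apply is_derive_Reals.
  - apply (is_derive_ext (fun t => Re (f (Re (p t), Im (p t))))).
    { intros t; now destruct (p t). }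
    apply is_derive_Reals.
    replace (Re (Cmult l l')) with (Re l * Re l' + - Im l * Im l') by (unfold Re, Im; simpl; ring).
    apply (derivable_pt_lim_comp_2d (fun x y => Re (f (x, y)))); auto.
  - apply (is_derive_ext (fun t => Im (f (Re (p t), Im (p t))))).
    { intros t; now destruct (p t). }
    apply is_derive_Reals.
    replace (Im (Cmult l l')) with (Im l * Re l' + Re l * Im l') by (unfold Re, Im; simpl; ring).
    apply (derivable_pt_lim_comp_2d (fun x y => Im (f (x, y)))); auto.
Qed.

(** Joint continuity in the parameter and the angle, as differentiation under the integral sign
    requires. *)
Definition cont2 (F : R -> R -> C) (s x : R) :=
  continuity_2d_pt (fun u v => Re (F u v)) s x /\ continuity_2d_pt (fun u v => Im (F u v)) s x.

Lemma cont2_mult F G s x : cont2 F s x -> cont2 G s x -> cont2 (fun u v =>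
  Cmult (F u v) (G u v)) s x.
Proof.
  intros [H1 H2] [H3 H4]; split.
  - apply (continuity_2d_pt_minus (fun u v => Re (F u v) * Re (G u v))
             (fun u v => Im (F u v) * Im (G u v))); apply continuity_2d_pt_mult; auto.
  - apply (continuity_2d_pt_plus (fun u v => Re (F u v) * Im (G u v))
             (fun u v => Im (F u v) * Re (G u v))); apply continuity_2d_pt_mult; auto.
Qed.

Lemma cont2_plus F G s x : cont2 F s x -> cont2 G s x -> cont2 (fun u v =>
  Cplus (F u v) (G u v)) s x.
Proof.
  intros [H1 H2] [H3 H4]; split.
  - apply (continuity_2d_pt_plus (fun u v => Re (F u v)) (fun u v => Re (G u v))); auto.
  - apply (continuity_2d_pt_plus (fun u v => Im (F u v)) (fun u v => Im (G u v))); auto.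
Qed.

Lemma cont2_const c s x : cont2 (fun _ _ => c) s x.
Proof. split; apply continuity_2d_pt_const. Qed.

Lemma cont2_RtoC (h : R -> R -> R) s x :
  continuity_2d_pt h s x -> cont2 (fun u v => RtoC (h u v)) s x.
Proof. intros H; split; [exact H|apply (continuity_2d_pt_const s x 0)]. Qed.

Lemma cont2_snd p s x : pcont p x -> cont2 (fun _ v => p v) s x.
Proof.
  intros [H1 H2]; split.
  - apply (continuity_1d_2d_pt_comp (fun t => Re (p t)) (fun _ v => v)); auto.
    apply continuity_2d_pt_id2.
  - apply (continuity_1d_2d_pt_comp (fun t => Im (p t)) (fun _ v => v)); auto.
    apply continuity_2d_pt_id2.
Qed.

Lemma cont2_comp g F s x : ccont g (F s x) -> cont2 F s x -> cont2 (fun u v => g (F u v)) s x.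
Proof.
  intros Hg [H1 H2].
  assert (key : forall eps : posreal, locally_2d (fun u v =>
     Cmod (Cminus (g (F u v)) (g (F s x))) < eps) s x).
  { intros eps; destruct (Hg eps (cond_pos eps)) as (delta & Hd & H).
    assert (Hd2 : 0 < delta / 2) by lra.
    generalize (locally_2d_and _ _ _ _ (H1 (mkposreal _ Hd2)) (H2 (mkposreal _ Hd2))).
    apply locally_2d_impl, locally_2d_forall; simpl; intros u v [A1 A2].
    apply H; eapply Rle_lt_trans; [apply Cmod_le_parts|].
    change (Rabs (Re (F u v) - Re (F s x)) + Rabs (Im (F u v) - Im (F s x)) < delta); lra. }
  split; intros eps; generalize (key eps); apply locally_2d_impl, locally_2d_forall;
    intros u v Huv; (eapply Rle_lt_trans; [|exact Huv]).
  - apply (re_le_Cmod (Cminus (g (F u v)) (g (F s x)))).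
  - apply (im_le_Cmod (Cminus (g (F u v)) (g (F s x)))).
Qed.

(** Only the real part of the integral over a period: it keeps all integrals real-valued, and
    a free complex factor in the integrand recovers the rest. *)
Definition circ (p : R -> C) : R := RInt (fun x => Re (p x)) 0 (2 * PI).

Lemma ex_circ p : (forall x, pcont p x) -> ex_RInt (fun x => Re (p x)) 0 (2 * PI).
Proof.
  intros H; apply (ex_RInt_continuous (V := R_CompleteNormedModule)); intros x _.
  now apply continuity_pt_filterlim, H.
Qed.

Lemma circ_ext p q : (forall x, p x = q x) -> circ p = circ q.
Proof. intros H; apply RInt_ext; intros; now rewrite H. Qed.

Lemma circ_plus p q : (forall x, pcont p x) -> (forall x, pcont q x) ->
  circ (fun x => Cplus (p x) (q x)) = circ p + circ q.
Proof.
  intros Hp Hq; unfold circ.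
  apply (RInt_plus (V := R_CompleteNormedModule)); now apply ex_circ.
Qed.

Lemma circ_bound p M : (forall x, pcont p x) -> (forall x, Cmod (p x) <= M) ->
  Rabs (circ p) <= 2 * PI * M.
Proof.
  intros Hp HM; assert (HPI := PI_RGT_0).
  eapply Rle_trans; [apply abs_RInt_le_const with (M := M)|]; try lra.
  - now apply ex_circ.
  - intros x _; eapply Rle_trans; [apply re_le_Cmod|apply HM].
Qed.

(** The tool for integrating by parts in the angle: an integrand recognised as the derivative of an
    explicit periodic primitive has mean zero. *)
Lemma circ_deriv P p : (forall x, pderiv P x (p x)) -> (forall x, pcont p x) ->
  P (2 * PI) = P 0 -> circ p = 0.
Proof.
  intros HP Hp HE; unfold circ.
  assert (H := is_RInt_derive (V := R_CompleteNormedModule) (fun x => Re (P x)) (fun x => Re (p x))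
     0 (2 * PI)).
  apply is_RInt_unique in H.
  - rewrite H, HE; unfold minus, plus, opp; simpl; ring.
  - intros x _; apply is_derive_Reals, HP.
  - intros x _; now apply continuity_pt_filterlim, Hp.
Qed.

Lemma circ_param (G G' : R -> R -> C) s0 eta : 0 < eta ->
  (forall s x, Rabs (s - s0) < eta -> pderiv (fun s => G s x) s (G' s x)) ->
  (forall s x, Rabs (s - s0) < eta -> pcont (G s) x) ->
  (forall x, cont2 G' s0 x) ->
  is_derive (fun s => circ (G s)) s0 (circ (G' s0)).
Proof.
  intros He HG HGc HG'.
  assert (Hloc : forall P : R -> Prop, (forall s, Rabs (s - s0) < eta -> P s) -> locally s0 P).
  { intros P HP; exists (mkposreal _ He); intros s Hs; apply HP; exact Hs. }
  assert (HD : forall s x, Rabs (s - s0) < eta -> Derive (fun s => Re (G s x)) s = Re (G' s x)).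
  { intros s x Hs; apply is_derive_unique, is_derive_Reals, HG, Hs. }
  unfold circ.
  rewrite (RInt_ext (fun x => Re (G' s0 x)) (fun x => Derive (fun s => Re (G s x)) s0)).
  2:{ intros x _; rewrite HD; auto; rewrite Rminus_diag, Rabs_R0; auto. }
  apply (is_derive_RInt_param (fun s x => Re (G s x))).
  - apply Hloc; intros s Hs x _; exists (Re (G' s x)); apply is_derive_Reals, HG, Hs.
  - intros x _; apply (continuity_2d_pt_ext_loc (fun u v => Re (G' u v))).
    + exists (mkposreal _ He); intros u v Hu _; now rewrite HD.
    + apply HG'.
  - apply Hloc; intros s Hs; apply ex_circ; intros; now apply HGc.
Qed.

Lemma Ci_sq : Cmult Ci Ci = Copp (RtoC 1).
Proof. unfold Cmult, Ci, Copp, RtoC; simpl; f_equal; ring. Qed.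

(** * Exponentials on the circle and moments of holomorphic functions *)

Definition eix (x : R) : C := (cos x, sin x).
(** The character [e^(-i m x)]; only these characters occur when the Cauchy kernel [w / (w - z)] is
    expanded in powers of [z / w]. *)
Definition emx (m : nat) (x : R) : C := (cos (INR m * x), - sin (INR m * x)).

Lemma Cmod_eix x : Cmod (eix x) = 1.
Proof.
  unfold Cmod, eix; simpl; rewrite !Rmult_1_r.
  assert (H := sin2_cos2 x); unfold Rsqr in H; rewrite Rplus_comm, H; apply sqrt_1.
Qed.

Lemma Cmod_emx m x : Cmod (emx m x) = 1.
Proof.
  unfold Cmod, emx; simpl; rewrite !Rmult_1_r.
  assert (H := sin2_cos2 (INR m * x)); unfold Rsqr in H.
  rewrite Rmult_opp_opp, Rplus_comm, H; apply sqrt_1.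
Qed.

Lemma emx_0 x : emx 0 x = RtoC 1.
Proof. unfold emx; simpl; rewrite Rmult_0_l, cos_0, sin_0, Ropp_0; easy. Qed.

Lemma emx_S m x : emx (S m) x = Cmult (emx m x) (emx 1 x).
Proof.
  unfold emx, Cmult; rewrite S_INR, Rmult_plus_distr_r, cos_plus, sin_plus; simpl.
  f_equal; ring.
Qed.

Lemma eix_emx x : Cmult (eix x) (emx 1 x) = RtoC 1.
Proof.
  unfold eix, emx, Cmult, RtoC; simpl; rewrite Rmult_1_l.
  assert (H := sin2_cos2 x); unfold Rsqr in H; f_equal; [lra|ring].
Qed.

Lemma pderiv_eix x : pderiv eix x (Cmult Ci (eix x)).
Proof.
  split; simpl.
  - replace (0 * cos x - 1 * sin x) with (- sin x) by ring; apply derivable_pt_lim_cos.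
  - replace (0 * sin x + 1 * cos x) with (cos x) by ring; apply derivable_pt_lim_sin.
Qed.

Lemma pderiv_emx m x : pderiv (emx m) x (Cmult (Cmult (Copp Ci) (RtoC (INR m))) (emx m x)).
Proof.
  split; apply is_derive_Reals; simpl; unfold emx; simpl; auto_derive; auto; ring.
Qed.

Lemma eix_period : eix (2 * PI) = eix 0.
Proof. unfold eix; now rewrite cos_2PI, sin_2PI, cos_0, sin_0. Qed.

Lemma emx_period m : emx m (2 * PI) = emx m 0.
Proof.
  unfold emx; replace (INR m * (2 * PI)) with (0 + 2 * INR m * PI) by ring.
  rewrite cos_period, sin_period, Rmult_0_r; easy.
Qed.

Lemma pcont_eix x : pcont eix x.
Proof. eapply pderiv_pcont, pderiv_eix. Qed.

(** The derivative is carried as data and its continuity is part of the notion, because integrals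
    containing [Df] are formed and compared with derivatives of integrals containing [f]. *)
Definition holo (f Df : C -> C) (rho : R) :=
  forall z, Cmod z < rho -> cderiv f z (Df z) /\ ccont Df z.

Lemma cont2_pcont F s x : cont2 F s x -> pcont (F s) x.
Proof.
  intros [A1 A2]; split.
  - intros eps He; destruct (A1 (mkposreal eps He)) as [d Hd].
    exists d; split; [apply cond_pos|]; intros y [_ Hy]; apply Hd; auto.
    rewrite Rminus_diag, Rabs_R0; apply cond_pos.
  - intros eps He; destruct (A2 (mkposreal eps He)) as [d Hd].
    exists d; split; [apply cond_pos|]; intros y [_ Hy]; apply Hd; auto.
    rewrite Rminus_diag, Rabs_R0; apply cond_pos.
Qed.

(** The [m]-th moment of [f] on the circle of radius [s * t] is homogeneous of degree [m] in [s].
    Indeed, for a holomorphic function the radial derivative is [1 / (i s)] times the angular one,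
    and integration by parts moves the latter onto [emx m], which returns the factor [m / s]. *)
Lemma moment_derive f Df t c m s : 0 < t -> holo f Df (4 * t) -> 0 < s <= 1 ->
  is_derive (fun s => circ (fun x =>
    Cmult c (Cmult (f (Cmult (RtoC (s * t)) (eix x))) (emx m x)))) s
    (INR m / s * circ (fun x => Cmult c (Cmult (f (Cmult (RtoC (s * t)) (eix x))) (emx m x)))).
Proof.
  intros Ht Hfd Hs.
  assert (Hf : forall z, Cmod z < 4 * t -> cderiv f z (Df z)) by apply Hfd.
  assert (HDf : forall z, Cmod z < 4 * t -> ccont Df z) by apply Hfd.
  assert (Hin : forall u x, Rabs (u - s) < 1 -> Cmod (Cmult (RtoC (u * t)) (eix x)) < 4 * t).
  { intros u x Hu; rewrite Cmod_mult, Cmod_eix, Cmod_R, Rabs_mult, (Rabs_right t) by lra.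
    apply Rabs_lt_between in Hu; assert (Rabs u < 4) by (apply Rabs_lt_between; lra); nra. }
  assert (Hs0 : Rabs (s - s) < 1) by (rewrite Rminus_diag, Rabs_R0; lra).
  set (G' := fun s x => Cmult c (Cmult (Cmult (Df (Cmult (RtoC (s * t)) (eix x)))
                        (Cmult (RtoC t) (eix x))) (emx m x))).
  assert (Pin : forall u x, pderiv (fun x => Cmult (RtoC (u * t)) (eix x)) x
                 (Cmult (RtoC (u * t)) (Cmult Ci (eix x)))).
  { intros u x; apply pderiv_scal, pderiv_eix. }
  assert (C2 : forall x, cont2 (fun u v => Cmult (RtoC (u * t)) (eix v)) s x).
  { intros x; apply (cont2_mult (fun u v => RtoC (u * t)) (fun u v => eix v)).
    - apply (cont2_RtoC (fun u v => u * t)); apply (continuity_2d_pt_mult (fun u v =>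
      u) (fun u v => t));
        [apply continuity_2d_pt_id1|apply continuity_2d_pt_const].
    - apply cont2_snd, pcont_eix. }
  assert (CDf : forall x, cont2 (fun u v => Df (Cmult (RtoC (u * t)) (eix v))) s x).
  { intros x; apply (cont2_comp Df (fun u v => Cmult (RtoC (u * t)) (eix v))); auto. }
  assert (CG : forall x, cont2 G' s x).
  { intros x; unfold G'; apply cont2_mult; [apply cont2_const|].
    apply cont2_mult; [apply cont2_mult; auto|].
    - apply cont2_mult; [apply cont2_const|apply cont2_snd, pcont_eix].
    - apply (cont2_snd (emx m)); eapply pderiv_pcont, pderiv_emx. }
  assert (E : circ (G' s) =
    INR m / s * circ (fun x => Cmult c (Cmult (f (Cmult (RtoC (s * t)) (eix x))) (emx m x)))).
  (* Periodic primitive of [G' s - (m / s) g]: the factor [-i / s] turns the angular derivative of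
     [f] into the radial one, and that of [emx m] into [-m / s]. *)
  { set (P := fun x => Cmult (Cmult c (Cmult (RtoC (/ s)) (Copp Ci)))
                (Cmult (f (Cmult (RtoC (s * t)) (eix x))) (emx m x))).
    set (g := fun x => Cmult c (Cmult (f (Cmult (RtoC (s * t)) (eix x))) (emx m x))).
    assert (cg : forall x, pcont g x).
    { intros x; unfold g; eapply pderiv_pcont, pderiv_scal, pderiv_mult; [|apply pderiv_emx].
      apply (pderiv_comp f (fun x => Cmult (RtoC (s * t)) (eix x))); [now apply Hf,
        Hin|apply Pin]. }
    assert (cG : forall x, pcont (G' s) x).
    { intros x; now apply cont2_pcont. }
    assert (Z : circ (fun x => Cplus (G' s x) (Cmult (RtoC (- (INR m / s))) (g x))) = 0).
    { apply (circ_deriv P).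
      - intros x; unfold P.
        eapply pderiv_eq; [|apply pderiv_scal, pderiv_mult; [|apply pderiv_emx];
          apply (pderiv_comp f (fun x => Cmult (RtoC (s * t)) (eix x)));
          [now apply Hf, Hin|apply Pin]].
        unfold G', g; simpl; rewrite RtoC_mult, RtoC_opp, RtoC_div, RtoC_inv by lra.
        assert (sn : RtoC s <> RtoC 0) by (intros E; apply RtoC_inj in E; lra).
        set (fz := f (Cmult (Cmult (RtoC s) (RtoC t)) (eix x))).
        set (dfz := Df (Cmult (Cmult (RtoC s) (RtoC t)) (eix x))).
        transitivity (Cplus (Cmult c (Cmult (Cmult dfz (Cmult (RtoC t) (eix x))) (emx m x)))
           (Cmult (Copp (Cdiv (RtoC (INR m)) (RtoC s))) (Cmult c (Cmult fz (emx m x))))).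
        2: reflexivity.
        (* [Ci] is an atom for [field], so the products [Ci * Ci] are kept visible and evaluated
           afterwards by [Ci_sq]. *)
        transitivity (Cplus (Cmult (Copp (Cmult Ci Ci))
           (Cmult c (Cmult (Cmult dfz (Cmult (RtoC t) (eix x))) (emx m x))))
           (Cmult (Cmult (Cmult Ci Ci) (Cdiv (RtoC (INR m)) (RtoC s)))
              (Cmult c (Cmult fz (emx m x))))).
        + field; auto.
        + rewrite Ci_sq; field; auto.
      - intros x; apply pcont_plus; auto; now apply pcont_scal.
      - unfold P; now rewrite eix_period, emx_period. }
    rewrite circ_plus in Z; auto.
    2: intros x; now apply pcont_scal.
    assert (S1 : circ (fun x => Cmult (RtoC (- (INR m / s))) (g x)) = - (INR m / s) * circ g).
    { unfold circ; rewrite <- (RInt_scal (V := R_CompleteNormedModule)) by now apply ex_circ.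
      apply RInt_ext; intros x _; unfold scal; simpl; unfold mult, Re; simpl; ring. }
    lra. }
  rewrite <- E.
  apply (circ_param (fun s x =>
    Cmult c (Cmult (f (Cmult (RtoC (s * t)) (eix x))) (emx m x))) G' s 1);
    auto; [lra| |].
  - intros u x Hu; unfold G'; apply pderiv_scal.
    eapply pderiv_eq; [|apply (pderiv_mult (fun u => f (Cmult (RtoC (u * t)) (eix x)))
       (fun _ => emx m x)); [|apply pderiv_const]].
    2:{ apply (pderiv_comp f (fun u => Cmult (RtoC (u * t)) (eix x))); [now apply Hf, Hin|].
        eapply (pderiv_eq _ _ (Cplus (Cmult (RtoC t) (eix x)) (Cmult (RtoC (u * t)) (RtoC 0)))).
        2: apply (pderiv_mult (fun u => RtoC (u * t)) (fun _ => eix x)); [|apply pderiv_const].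
        - reflexivity.
        - split; apply is_derive_Reals; simpl; auto_derive; auto; ring. }
    ring.
  - intros u x Hu; eapply pderiv_pcont, pderiv_scal, pderiv_mult; [|apply pderiv_emx].
    apply (pderiv_comp f (fun x => Cmult (RtoC (u * t)) (eix x))); [now apply Hf, Hin|apply Pin].
Qed.

Lemma zero_derive_const (g : R -> R) a b : a < b ->
  (forall x, a <= x <= b -> is_derive g x 0) -> g a = g b.
Proof.
  intros Hab H.
  destruct (MVT_gen g a b (fun _ => 0)) as (c & _ & E).
  - intros x Hx; rewrite Rmin_left, Rmax_right in Hx by lra; apply H; lra.
  - intros x Hx; rewrite Rmin_left, Rmax_right in Hx by lra.
    apply derivable_continuous_pt; exists 0; apply is_derive_Reals, H; lra.
  - lra.
Qed.

Lemma holo_circle_pcont f Df rho a b x : holo f Df rho ->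
  Cmod a + Rabs b < rho -> pcont (fun x => f (Cplus a (Cmult (RtoC b) (eix x)))) x.
Proof.
  intros Hf Hab; eapply pderiv_pcont.
  apply (pderiv_comp f (fun x => Cplus a (Cmult (RtoC b) (eix x)))).
  - apply Hf; eapply Rle_lt_trans; [apply Cmod_triangle|].
    rewrite Cmod_mult, Cmod_eix, Cmod_R; lra.
  - apply pderiv_plus; [apply pderiv_const|apply pderiv_scal, pderiv_eix].
Qed.

Lemma pcont_ext p q x : (forall y, p y = q y) -> pcont p x -> pcont q x.
Proof. intros H; replace q with p; auto; now apply functional_extensionality. Qed.

Lemma pcont_emx m x : pcont (emx m) x.
Proof. eapply pderiv_pcont, pderiv_emx. Qed.

Lemma pcont_circle f Df t b x : 0 < t -> holo f Df (4 * t) -> 0 <= b <= 1 ->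
  pcont (fun x => f (Cmult (RtoC (b * t)) (eix x))) x.
Proof.
  intros Ht Hf Hb.
  eapply pcont_ext; [|apply (holo_circle_pcont f Df (4 * t) (RtoC 0) (b * t)); auto].
  - intros y; simpl; f_equal; ring.
  - rewrite Cmod_0, Rabs_right; nra.
Qed.

(** By [moment_derive] the quotient [F s / s ^ m] is constant on (0, 1], whereas vanishing of [f] to
    order [n + 1 > m] makes it O(s) as [s] tends to 0. *)
Lemma moment_zero f Df t K n m c : 0 < t -> holo f Df (4 * t) -> 0 <= K -> (m <= n)%nat ->
  (forall w, Cmod w <= t / 2 -> Cmod (f w) <= K * Cmod w ^ S n) ->
  circ (fun x => Cmult c (Cmult (f (Cmult (RtoC t) (eix x))) (emx m x))) = 0.
Proof.
  intros Ht Hf HK Hmn HO.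
  set (F := fun s => circ (fun x => Cmult c (Cmult (f (Cmult (RtoC (s * t)) (eix x))) (emx m x)))).
  assert (E1 : circ (fun x => Cmult c (Cmult (f (Cmult (RtoC t) (eix x))) (emx m x))) = F 1).
  { unfold F; now rewrite Rmult_1_l. }
  rewrite E1.
  assert (HG : forall s, 0 < s < 1 -> F s / s ^ m = F 1 / 1 ^ m).
  { intros s Hs; apply (zero_derive_const (fun s => F s / s ^ m)); [lra|].
    intros u Hu.
    assert (Hup : u ^ m <> 0) by (apply pow_nonzero; lra).
    assert (D1 := moment_derive f Df t c m u Ht Hf (conj (Rlt_le_trans _ _ _ (proj1 Hs)
      (proj1 Hu)) (proj2 Hu))).
    fold F in D1.
    assert (D2 : is_derive (fun s => s ^ m) u (INR m * u ^ pred m)).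
    { apply is_derive_Reals, derivable_pt_lim_pow. }
    assert (D := is_derive_div F (fun s => s ^ m) u _ _ D1 D2 Hup).
    replace 0 with ((INR m / u * F u * u ^ m - F u * (INR m * u ^ pred m)) / (u ^ m) ^ 2).
    - exact D.
    - destruct m as [|m']; [simpl; field; lra|].
      simpl pred; rewrite <- (tech_pow_Rmult u m'); field.
      split; [lra|apply pow_nonzero; lra]. }
  assert (HB : forall s, 0 < s <= 1 / 2 -> Rabs (F s) <= 2 * PI * (Cmod c * (K * (s * t) ^ S n))).
  { intros s Hs; apply circ_bound.
    - intros x; apply pcont_scal.
      apply pcont_mult; [apply (pcont_circle f Df); auto; lra|apply pcont_emx].
    - intros x; rewrite !Cmod_mult, Cmod_emx, Rmult_1_r.
      apply Rmult_le_compat_l; [apply Cmod_ge_0|].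
      assert (E : Cmod (Cmult (RtoC (s * t)) (eix x)) = s * t).
      { rewrite Cmod_mult, Cmod_eix, Cmod_R, Rabs_right; nra. }
      eapply Rle_trans; [apply HO; rewrite E; nra|rewrite E; apply Rle_refl]. }
  assert (HPI := PI_RGT_0).
  set (L := 2 * PI * (Cmod c * (K * t ^ S n))).
  assert (HL : 0 <= L).
  { unfold L; apply Rmult_le_pos; [lra|]; apply Rmult_le_pos; [apply Cmod_ge_0|].
    apply Rmult_le_pos; auto; apply pow_le; lra. }
  assert (Hs : forall s, 0 < s <= 1 / 2 -> Rabs (F 1) <= L * s).
  { intros s Hs; specialize (HG s); specialize (HB s Hs).
    rewrite pow1, Rdiv_1_r in HG; rewrite <- HG by lra.
    unfold Rdiv; rewrite Rabs_mult, (Rabs_right (/ s ^ m)).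
    2:{ apply Rle_ge, Rlt_le, Rinv_0_lt_compat, pow_lt; lra. }
    assert (Hsm : 0 < s ^ m) by (apply pow_lt; lra).
    apply Rmult_le_reg_r with (s ^ m); auto.
    rewrite Rmult_assoc, Rinv_l, Rmult_1_r by lra.
    eapply Rle_trans; [exact HB|].
    rewrite Rpow_mult_distr; replace (S n) with (S (n - m) + m)%nat at 1 by lia.
    rewrite pow_add.
    replace (2 * PI * (Cmod c * (K * (s ^ S (n - m) * s ^ m * t ^ S n)))) with
      (L * s ^ S (n - m) * s ^ m) by (unfold L; ring).
    apply Rmult_le_compat_r; [lra|]; apply Rmult_le_compat_l; auto.
    assert (s ^ (n - m) <= 1) by (rewrite <- (pow1 (n - m)); apply pow_incr; lra).
    simpl; nra. }
  destruct (Req_dec (F 1) 0) as [E|E]; auto; exfalso.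
  assert (HF : 0 < Rabs (F 1)) by now apply Rabs_pos_lt.
  (* Chosen so that [L * s <= |F 1| / 2], which contradicts [Hs] unless [F 1 = 0]. *)
  set (s := Rmin (1 / 2) (Rabs (F 1) / (2 * (L + 1)))).
  assert (Hd : 0 < Rabs (F 1) / (2 * (L + 1))) by (apply Rdiv_lt_0_compat; lra).
  assert (Hs1 : 0 < s) by (apply Rmin_glb_lt; lra).
  assert (Hs2 : s <= 1 / 2) by apply Rmin_l.
  assert (Hs3 : s <= Rabs (F 1) / (2 * (L + 1))) by apply Rmin_r.
  specialize (Hs s (conj Hs1 Hs2)).
  assert (L * s <= L * (Rabs (F 1) / (2 * (L + 1)))) by now apply Rmult_le_compat_l.
  assert (L * (Rabs (F 1) / (2 * (L + 1))) <= Rabs (F 1) / 2); [|lra].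
  apply Rmult_le_reg_r with (2 * (L + 1)); [lra|].
  replace (L * (Rabs (F 1) / (2 * (L + 1))) * (2 * (L + 1))) with (L * Rabs (F 1)) by (field; lra).
  nra.
Qed.

(** The hypothesis on [kappa] says that it is the Cauchy kernel [w / (w - z)] on the circle
    [w = t e^(ix)]. Contracting the circle linearly to [z], the derivative in the contraction
    parameter has the factor [w - z], which cancels the kernel and leaves an exact angular
    derivative; hence the integral does not change. *)
Lemma circle_homotopy f Df t z (kappa : R -> C) c : 0 < t -> holo f Df (4 * t) -> Cmod z <= t / 2 ->
  (forall x, pcont kappa x) ->
  (forall x, Cmult (Cminus (Cmult (RtoC t) (eix x)) z) (kappa x) = Cmult (RtoC t) (eix x)) ->
  circ (fun x => Cmult c (Cmult (f (Cmult (RtoC t) (eix x))) (kappa x))) =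
  circ (fun x => Cmult c (Cmult (f z) (kappa x))).
Proof.
  intros Ht Hf Hz Hk Ek.
  set (gam := fun s x => Cplus z (Cmult (RtoC s) (Cminus (Cmult (RtoC t) (eix x)) z))).
  set (G := fun s x => Cmult c (Cmult (f (gam s x)) (kappa x))).
  set (G' := fun s x => Cmult c (Cmult (Df (gam s x)) (Cmult (RtoC t) (eix x)))).
  assert (E1 : circ (fun x => Cmult c (Cmult (f (Cmult (RtoC t) (eix x))) (kappa x))) = circ (G 1)).
  { apply circ_ext; intros x; unfold G, gam; do 3 f_equal; ring. }
  assert (E0 : circ (fun x => Cmult c (Cmult (f z) (kappa x))) = circ (G 0)).
  { apply circ_ext; intros x; unfold G, gam; do 3 f_equal; ring. }
  rewrite E1, E0; symmetry.
  (* Here [s] lies in (-1, 2), an open neighbourhood of the parameters, so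
     [|gam s x| <= 2 * (t / 2) + 2 * t = 3 * t]. This is what the radius [4 * t] accommodates. *)
  assert (Hin : forall s0 s x, 0 <= s0 <= 1 -> Rabs (s - s0) < 1 -> Cmod (gam s x) < 4 * t).
  { intros s0 s x H0 Hs; apply Rabs_lt_between in Hs.
    unfold gam.
    replace (Cplus z _) with (Cplus (Cmult (RtoC (1 - s)) z) (Cmult (RtoC (s * t)) (eix x)))
      by (rewrite RtoC_minus, RtoC_mult; ring).
    eapply Rle_lt_trans; [apply Cmod_triangle|].
    rewrite !Cmod_mult, Cmod_eix, !Cmod_R, Rabs_mult, (Rabs_right t) by lra.
    assert (Rabs (1 - s) <= 2) by (apply Rabs_le_between; lra).
    assert (Rabs s <= 2) by (apply Rabs_le_between; lra).
    assert (A := Cmod_ge_0 z); assert (B := Rabs_pos s); nra. }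
  assert (Pg : forall s x, pderiv (gam s) x (Cmult (RtoC s) (Cmult (RtoC t) (Cmult Ci (eix x))))).
  { intros s x; unfold gam.
    eapply pderiv_eq; [|apply pderiv_plus; [apply pderiv_const|]; apply pderiv_scal;
      apply (pderiv_plus (fun x => Cmult (RtoC t) (eix x)) (fun _ => Copp z));
      [apply pderiv_scal, pderiv_eix|apply pderiv_const]].
    simpl; ring. }
  assert (Pc : forall s x, 0 <= s <= 1 -> cont2 gam s x).
  { intros s x Hs; unfold gam; apply cont2_plus; [apply cont2_const|].
    apply cont2_mult; [apply (cont2_RtoC (fun u v => u)), continuity_2d_pt_id1|].
    apply (cont2_plus (fun u v => Cmult (RtoC t) (eix v)) (fun u v => Copp z));
      [|apply cont2_const].
    apply cont2_mult; [apply cont2_const|apply cont2_snd, pcont_eix]. }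
  assert (H0 : forall s, Rabs (s - s) < 1) by (intros; rewrite Rminus_diag, Rabs_R0; lra).
  assert (CG : forall s x, 0 <= s <= 1 -> cont2 G' s x).
  { intros s x Hs; unfold G'; apply cont2_mult; [apply cont2_const|].
    apply cont2_mult.
    - apply cont2_comp; [|now apply Pc]; apply Hf; now apply (Hin s).
    - apply cont2_mult; [apply cont2_const|apply cont2_snd, pcont_eix]. }
  assert (Z : forall s, 0 <= s <= 1 -> circ (G' s) = 0).
  { intros s Hs.
    (* The general primitive contains [1 / s]; at [s = 0] the path is constant and [e^(ix)] itself
       supplies a primitive. *)
    destruct (Req_dec s 0) as [->|Hs0].
    - apply (circ_deriv (fun x =>
      Cmult (Cmult c (Cmult (Df z) (Cmult (RtoC t) (Copp Ci)))) (eix x))).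
      + intros x; eapply pderiv_eq; [|apply pderiv_scal, pderiv_eix].
        unfold G', gam; replace (Cplus z _) with z by ring.
        transitivity (Cmult (Copp (Cmult Ci Ci)) (Cmult c (Cmult (Df z) (Cmult (RtoC t) (eix x)))));
          [ring|rewrite Ci_sq; ring].
      + intros x; apply cont2_pcont, CG; lra.
      + now rewrite eix_period.
    - apply (circ_deriv (fun x => Cmult (Cmult c (Cmult (RtoC (/ s)) (Copp Ci))) (f (gam s x)))).
      + intros x; eapply pderiv_eq; [|apply pderiv_scal, pderiv_comp; [apply Hf, (Hin s);
        auto|apply Pg]].
        unfold G'; set (y := Df (gam s x)); rewrite RtoC_inv by auto.
        assert (sn : RtoC s <> RtoC 0) by (intros E; apply RtoC_inj in E; lra).
        transitivity (Cmult (Copp (Cmult Ci Ci)) (Cmult c (Cmult y (Cmult (RtoC t) (eix x)))));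
          [field; auto|rewrite Ci_sq; ring].
      + intros x; apply cont2_pcont, CG; lra.
      + unfold gam; now rewrite eix_period. }
  apply (zero_derive_const (fun s => circ (G s))); [lra|].
  intros s Hs; rewrite <- (Z s Hs).
  apply (circ_param G G' s 1); [lra| | |auto].
  - intros u x Hu; unfold G, G'.
    eapply pderiv_eq; [|apply pderiv_scal, (pderiv_mult (fun u => f (gam u x)) (fun _ => kappa x));
      [|apply pderiv_const]; apply pderiv_comp; [apply Hf, (Hin s); auto|]].
    2:{ unfold gam; apply pderiv_plus; [apply pderiv_const|].
        apply (pderiv_mult (fun u => RtoC u) (fun _ => Cminus (Cmult (RtoC t) (eix x)) z));
          [apply pderiv_RtoC|apply pderiv_const]. }
    set (y := Df (gam u x)).
    transitivity (Cmult c (Cmult y (Cmult (Cminus (Cmult (RtoC t) (eix x)) z) (kappa x))));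
      [simpl; ring|now rewrite Ek].
  - intros u x Hu; unfold G; apply pcont_scal.
    apply pcont_mult; auto; eapply pderiv_pcont, pderiv_comp; [apply Hf, (Hin s); auto|apply Pg].
Qed.

Lemma Rabs_le_0_eq x : Rabs x <= 0 -> x = 0.
Proof. intros H; apply Rabs_eq_0; assert (H' := Rabs_pos x); lra. Qed.

Lemma circ_emx c m : (0 < m)%nat -> circ (fun x => Cmult c (emx m x)) = 0.
Proof.
  intros Hm; assert (Hm' : RtoC (INR m) <> RtoC 0).
  { intros E; apply RtoC_inj in E; apply (not_0_INR m); [lia|auto]. }
  apply (circ_deriv (fun x => Cmult (Cmult c (Cdiv Ci (RtoC (INR m)))) (emx m x))).
  - intros x; eapply pderiv_eq; [|apply pderiv_scal, pderiv_emx].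
    transitivity (Cmult (Copp (Cmult Ci Ci)) (Cmult c (emx m x))); [field; auto|rewrite Ci_sq;
      ring].
  - intros x; apply pcont_scal, pcont_emx.
  - now rewrite emx_period.
Qed.

Lemma pow_half_small (b eps : R) : 0 < eps -> exists N, b * (1 / 2) ^ N <= eps.
Proof.
  intros He; assert (Hb := Rabs_pos b).
  destruct (pow_lt_1_zero (1 / 2)) with (y := eps / (Rabs b + 1)) as [N HN].
  - rewrite Rabs_right; lra.
  - apply Rdiv_lt_0_compat; lra.
  - exists N; specialize (HN N (le_n N)).
    rewrite Rabs_right in HN by (apply Rle_ge, pow_le; lra).
    assert (P : 0 <= (1 / 2) ^ N) by (apply pow_le; lra).
    apply Rle_trans with (Rabs b * (1 / 2) ^ N).
    + apply Rmult_le_compat_r; auto; apply Rle_abs.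
    + apply Rle_trans with ((Rabs b + 1) * (eps / (Rabs b + 1))).
      * apply Rmult_le_compat; lra.
      * apply Req_le; field; lra.
Qed.

(** Expanding the Cauchy kernel to order [n], the moments of order at most [n] vanish, so only the
    remainder of the geometric series contributes. *)
Lemma schwarz f Df t K M n z : 0 < t -> holo f Df (4 * t) -> 0 <= K ->
  (forall w, Cmod w <= t / 2 -> Cmod (f w) <= K * Cmod w ^ S n) ->
  (forall w, Cmod w <= t -> Cmod (f w) <= M) ->
  Cmod z <= t / 2 -> Cmod (f z) <= 2 * M * (Cmod z / t) ^ S n.
Proof.
  intros Ht Hf HK HO HM Hz.
  assert (tn : RtoC t <> RtoC 0) by (intros E; apply RtoC_inj in E; lra).
  set (q := Cdiv z (RtoC t)).
  assert (Hq : Cmod q = Cmod z / t).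
  { unfold q; rewrite Cmod_div, Cmod_R, Rabs_right by (auto; lra); easy. }
  assert (Hq0 := Cmod_ge_0 q).
  assert (Hq2 : Cmod q <= 1 / 2).
  { rewrite Hq; apply Rmult_le_reg_r with t; auto; unfold Rdiv.
    rewrite Rmult_assoc, Rinv_l; lra. }
  set (D := fun x => Cminus (RtoC 1) (Cmult q (emx 1 x))).
  assert (HD : forall x, 1 / 2 <= Cmod (D x)).
  { intros x; assert (T := Cmod_triangle (D x) (Cmult q (emx 1 x))).
    replace (Cplus (D x) (Cmult q (emx 1 x))) with (RtoC 1) in T by (unfold D; ring).
    rewrite Cmod_1, Cmod_mult, Cmod_emx in T; lra. }
  assert (HDn : forall x, D x <> RtoC 0).
  { intros x E; specialize (HD x); rewrite E, Cmod_0 in HD; lra. }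
  set (ka := fun x => Cinv (D x)).
  assert (ckb : forall x, pcont D x).
  { intros x; unfold D; eapply pderiv_pcont.
    apply (pderiv_plus (fun _ => RtoC 1) (fun x => Copp (Cmult q (emx 1 x))));
      [apply pderiv_const|].
    eapply (pderiv_eq (fun x => Copp (Cmult q (emx 1 x)))); [reflexivity|].
    replace (fun x => Copp (Cmult q (emx 1 x))) with (fun x => Cmult (Copp q) (emx 1 x)).
    - apply pderiv_scal, pderiv_emx.
    - apply functional_extensionality; intros y; ring. }
  assert (ck : forall x, pcont ka x) by (intros x; apply pcont_inv; auto).
  assert (Hka : forall x, Cmod (ka x) <= 2).
  { intros x; unfold ka; rewrite Cmod_inv by auto.
    specialize (HD x); apply Rmult_le_reg_r with (Cmod (D x)); [lra|].
    rewrite Rinv_l; lra. }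
  (* One step of the geometric series for [ka = 1 / (1 - q e^(-ix))]. *)
  assert (Eka : forall N x, Cmult (Cpow q N) (Cmult (emx N x) (ka x)) =
     Cplus (Cmult (Cpow q N) (emx N x)) (Cmult (Cpow q (S N)) (Cmult (emx (S N) x) (ka x)))).
  { intros N x; rewrite emx_S; simpl Cpow.
    assert (E : Cmult (D x) (ka x) = RtoC 1) by (unfold ka; field; auto).
    replace (Cmult (Cpow q N) (emx N x)) with (Cmult (Cmult (Cpow q N) (emx N x)) (Cmult (D x)
      (ka x)))
      by (rewrite E; ring).
    unfold D; ring. }
  assert (Cpq : forall N, Cmod (Cpow q N) = Cmod q ^ N).
  { induction N as [|N IH]; simpl; [apply Cmod_1|now rewrite Cmod_mult, IH]. }
  assert (cf : forall x, pcont (fun x => f (Cmult (RtoC t) (eix x))) x).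
  { intros x; eapply pcont_ext; [|apply (pcont_circle f Df t 1); auto; lra].
    intros y; simpl; now rewrite Rmult_1_l. }
  assert (HPI := PI_RGT_0).
  (* The kernel has mean 1: only the constant term of its expansion survives integration, and since
     [|q| <= 1 / 2] the remainder is smaller than every [eps]. *)
  assert (one : forall c, circ (fun x => Cmult c (ka x)) = 2 * PI * Re c).
  { intros c.
    assert (S0 : forall N, circ (fun x =>
      Cmult c (Cmult (Cpow q (S N)) (Cmult (emx (S N) x) (ka x)))) =
       circ (fun x => Cmult c (Cmult q (Cmult (emx 1 x) (ka x))))).
    { induction N as [|N IH].
      - apply circ_ext; intros x; simpl Cpow; ring.
      - rewrite <- IH; symmetry.
        rewrite (circ_ext _ (fun x => Cplus (Cmult (Cmult c (Cpow q (S N))) (emx (S N) x))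
          (Cmult c (Cmult (Cpow q (S (S N))) (Cmult (emx (S (S N)) x) (ka x)))))).
        + rewrite circ_plus, circ_emx by
            (try lia; intros x; repeat apply pcont_mult; auto using pcont_const, pcont_emx).
          ring.
        + intros x; rewrite Eka; ring. }
    assert (E : circ (fun x => Cmult c (ka x)) =
      circ (fun _ => c) + circ (fun x => Cmult c (Cmult q (Cmult (emx 1 x) (ka x))))).
    { rewrite <- circ_plus by
        (intros x; repeat apply pcont_mult; auto using pcont_const, pcont_emx).
      apply circ_ext; intros x; assert (E := Eka O x); rewrite emx_0 in E; simpl Cpow in E.
      replace (Cmult c (ka x)) with (Cmult c (Cmult (RtoC 1) (Cmult (RtoC 1) (ka x)))) by ring.
      rewrite E; ring. }
    assert (E2 : circ (fun _ => c) = 2 * PI * Re c).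
    { unfold circ; rewrite RInt_const; unfold scal; simpl; unfold mult; simpl; ring. }
    assert (Z : circ (fun x => Cmult c (Cmult q (Cmult (emx 1 x) (ka x)))) = 0).
    { apply Rabs_le_0_eq.
      apply le_epsilon; intros eps He; rewrite Rplus_0_l.
      destruct (pow_half_small (2 * PI * (Cmod c * 2)) eps He) as [N HN].
      rewrite <- (S0 N); eapply Rle_trans; [apply circ_bound with (M := Cmod c * 2 * (1 / 2) ^ N)|].
      - intros x; repeat apply pcont_mult; auto using pcont_const, pcont_emx.
      - intros x; rewrite !Cmod_mult, Cmod_emx, Cpq, Rmult_1_l.
        assert (P1 : Cmod q ^ S N <= (1 / 2) ^ N).
        { apply Rle_trans with ((1 / 2) ^ S N); [apply pow_incr; lra|].
          assert (0 <= (1 / 2) ^ N) by (apply pow_le; lra); simpl; lra. }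
        rewrite Rmult_assoc; apply Rmult_le_compat_l; [apply Cmod_ge_0|].
        rewrite Rmult_comm; apply Rmult_le_compat; auto using Cmod_ge_0.
        apply pow_le; auto.
      - lra. }
    lra. }
  assert (main : forall c, 2 * PI * Re (Cmult c (f z)) <=
    2 * PI * (Cmod c * (M * (Cmod q ^ S n * 2)))).
  { intros c.
    rewrite <- one.
    rewrite (circ_ext _ (fun x => Cmult c (Cmult (f z) (ka x)))) by (intros; ring).
    rewrite <- (circle_homotopy f Df t z ka c); auto.
    2:{ intros x; unfold ka.
        replace (Cminus (Cmult (RtoC t) (eix x)) z) with (Cmult (Cmult (RtoC t) (eix x)) (D x)).
        - field; auto.
        - unfold D, q.
          transitivity (Cminus (Cmult (RtoC t) (eix x)) (Cmult z (Cmult (eix x) (emx 1 x))));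
            [field; auto|rewrite eix_emx; ring]. }
    assert (S0 : forall N, (N <= S n)%nat ->
      circ (fun x => Cmult c (Cmult (f (Cmult (RtoC t) (eix x))) (ka x))) =
      circ (fun x => Cmult c (Cmult (f (Cmult (RtoC t) (eix x)))
         (Cmult (Cpow q N) (Cmult (emx N x) (ka x)))))).
    { induction N as [|N IH]; intros HN.
      - apply circ_ext; intros x; rewrite emx_0; simpl Cpow; do 2 f_equal; ring.
      - rewrite IH by lia.
        rewrite (circ_ext _ (fun x => Cplus
          (Cmult (Cmult c (Cpow q N)) (Cmult (f (Cmult (RtoC t) (eix x))) (emx N x)))
          (Cmult c (Cmult (f (Cmult (RtoC t) (eix x)))
             (Cmult (Cpow q (S N)) (Cmult (emx (S N) x) (ka x))))))).
        + rewrite circ_plus, (moment_zero f Df t K n N) by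
            (auto; try lia; intros x; repeat apply pcont_mult; auto using pcont_const, pcont_emx).
          ring.
        + intros x; rewrite Eka; ring. }
    rewrite (S0 (S n)) by lia.
    eapply Rle_trans; [apply Rle_abs|apply circ_bound].
    - intros x; repeat apply pcont_mult; auto using pcont_const, pcont_emx.
    - intros x; rewrite !Cmod_mult, Cmod_emx, Cpq, Rmult_1_l.
      apply Rmult_le_compat_l; [apply Cmod_ge_0|].
      apply Rmult_le_compat; auto using Cmod_ge_0.
      + apply Rmult_le_pos; [apply pow_le; auto|apply Cmod_ge_0].
      + apply HM; rewrite Cmod_mult, Cmod_eix, Cmod_R, Rabs_right; lra.
      + apply Rmult_le_compat_l; auto; apply pow_le; auto. }
  rewrite <- Hq.
  (* The estimate controls only real parts; with this factor the real part is [|f z|^2], and one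
     power of [|f z|] is then cancelled. The factor 2 of the conclusion is the bound on [ka]. *)
  assert (A := main (Cconj (f z))).
  assert (E : Re (Cmult (Cconj (f z)) (f z)) = Cmod (f z) ^ 2).
  { rewrite Cmod_sq; unfold Re, Im; destruct (f z); simpl; ring. }
  rewrite E, Cmod_conj in A.
  assert (B := Cmod_ge_0 (f z)).
  apply Rmult_le_reg_l in A; [|lra].
  destruct (Req_dec (Cmod (f z)) 0) as [F|F].
  - rewrite F; apply Rmult_le_pos; [|apply pow_le; auto].
    assert (0 <= M); [|lra].
    apply Rle_trans with (Cmod (f (RtoC 0))); [apply Cmod_ge_0|apply HM; rewrite Cmod_0; lra].
  - apply Rmult_le_reg_l with (Cmod (f z)); [lra|]; lra.
Qed.

(** * The system for the pair (velocity, scalar) *)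

(** Components [c < d] are the velocity, component [d] is the scalar. *)
Definition st (d : nat) (u : VField) (eta : SField) : VField :=
  fun k c => if validb d k then
               if Nat.ltb c d then u k c else if Nat.eqb c d then eta k else RtoC 0
             else RtoC 0.

Definition divfree (d : nat) (X : VField) : Prop :=
  forall k, sumC_lt d (fun i => Cmult (RtoC (IZR (k i))) (X k i)) = RtoC 0.

Definition is_state (d : nat) (X : VField) : Prop :=
  (forall k c, ~ (validk d k /\ (c <= d)%nat) -> X k c = RtoC 0) /\
  (forall c, X zerok c = RtoC 0) /\ divfree d X.

(** Advection in divergence form: the derivative falls on the output wavevector, so that the
    nonlinearity is bounded on square-summable fields, mode by mode. *)
Definition advt (d : nat) (X Y : VField) (k : Vec) (c : nat) : Vec -> C :=
  fun j => Cmult Ci (Cmult (sumC_lt d (fun m => Cmult (RtoC (IZR (k m))) (X j m)))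
                           (Y (vsub k j) c)).

(** The part of the system acting on one wavevector, with [b] the advection coefficients and [e] the
    scalar there. It is linear in [(b, e)], which gives both the difference estimate and the
    termwise summation of the Taylor series. *)
Definition rhs (d : nat) (g : R) (k : Vec) (b : nat -> C) (e : C) (c : nat) : C :=
  if Nat.ltb c d then
    Cplus (Copp (leray d k b c))
          (Cmult (RtoC g) (leray d k (fun m => Cmult e (RtoC (upvec d m))) c))
  else Copp (b d).

Lemma sumC_lt_ext d f g : (forall i, (i < d)%nat -> f i = g i) -> sumC_lt d f = sumC_lt d g.
Proof. intros H; apply sumC_ext; intros i Hi; apply in_seq in Hi; apply H; lia. Qed.

Lemma st_vel d u eta k c : validk d k -> (c < d)%nat -> st d u eta k c = u k c.
Proof.
  intros Hk Hc; unfold st; apply validb_spec in Hk; rewrite Hk.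
  destruct (Nat.ltb_spec c d); [easy|lia].
Qed.

Lemma st_scal d u eta k : validk d k -> st d u eta k d = eta k.
Proof.
  intros Hk; unfold st; apply validb_spec in Hk; rewrite Hk, Nat.eqb_refl.
  destruct (Nat.ltb_spec d d); [lia|easy].
Qed.

Lemma st_out d u eta k c : ~ (validk d k /\ (c <= d)%nat) -> st d u eta k c = RtoC 0.
Proof.
  intros H; unfold st; destruct (validb d k) eqn:E; auto; apply validb_spec in E.
  destruct (Nat.ltb_spec c d); [exfalso; apply H; split; auto; lia|].
  destruct (Nat.eqb_spec c d); [exfalso; apply H; split; auto; lia|easy].
Qed.

Lemma inH_vel d u eta k i : inH d u -> (i < d)%nat -> st d u eta k i = u k i.
Proof.
  intros (H & _) Hi; destruct (classic (validk d k)) as [Hk|Hk]; [now apply st_vel|].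
  rewrite st_out by tauto; symmetry; apply H; tauto.
Qed.

Lemma inS_scal d u eta k : inS d eta -> st d u eta k d = eta k.
Proof.
  intros (H & _); destruct (classic (validk d k)) as [Hk|Hk]; [now apply st_scal|].
  rewrite st_out by tauto; symmetry; now apply H.
Qed.

Lemma st_is_state d u eta : inH d u -> inS d eta -> is_state d (st d u eta).
Proof.
  intros Hu He; split; [intros; now apply st_out|split].
  - intros c; destruct (classic (validk d zerok /\ (c <= d)%nat)) as [[H1 H2]|H];
    [|now apply st_out].
    destruct (Nat.eq_dec c d) as [->|].
    + rewrite st_scal; auto; apply He.
    + rewrite st_vel by (auto; lia); apply Hu.
  - intros k; rewrite <- (proj1 (proj2 (proj2 Hu)) k).
    apply sumC_lt_ext; intros i Hi; now rewrite inH_vel.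
Qed.

(** Since [j . X_j = 0], the symbol [k - j] may be replaced by [k]. *)
Lemma advection_conservative d (X : VField) k j (y : C) : divfree d X ->
  sumC_lt d (fun m => Cmult (X j m) (Cmult (Cmult Ci (RtoC (IZR (k m - j m)))) y)) =
  Cmult Ci (Cmult (sumC_lt d (fun m => Cmult (RtoC (IZR (k m))) (X j m))) y).
Proof.
  intros H; specialize (H j).
  replace (sumC_lt d (fun m => Cmult (RtoC (IZR (k m))) (X j m)))
    with (sumC_lt d (fun m => Cmult (RtoC (IZR (k m - j m))) (X j m))).
  - unfold sumC_lt; rewrite Cmult_assoc, (Cmult_comm (Cmult Ci _) y), <- !sumC_scal.
    apply sumC_ext; intros; ring.
  - rewrite <- (Cplus_0_r (sumC_lt d (fun m => Cmult (RtoC (IZR (k m - j m))) (X j m)))).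
    rewrite <- H; unfold sumC_lt; rewrite <- sumC_plus; apply sumC_ext; intros m _.
    rewrite minus_IZR, RtoC_minus; ring.
Qed.

Lemma adv_term_v_st d u eta k i j : inH d u -> inS d eta -> (i < d)%nat ->
  adv_term_v d u u k i j = advt d (st d u eta) (st d u eta) k i j.
Proof.
  intros Hu He Hi; unfold adv_term_v, advt; rewrite (inH_vel d u eta (vsub k j) i) by auto.
  rewrite <- advection_conservative by exact (proj2 (proj2 (st_is_state d u eta Hu He))).
  apply sumC_lt_ext; intros m Hm; now rewrite inH_vel.
Qed.

Lemma adv_term_s_st d u eta k j : inH d u -> inS d eta ->
  adv_term_s d u eta k j = advt d (st d u eta) (st d u eta) k d j.
Proof.
  intros Hu He; unfold adv_term_s, advt; rewrite (inS_scal d u eta (vsub k j)) by auto.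
  rewrite <- advection_conservative by exact (proj2 (proj2 (st_is_state d u eta Hu He))).
  apply sumC_lt_ext; intros m Hm; now rewrite inH_vel.
Qed.

Lemma advt_invalid d X Y k c j : is_state d X -> is_state d Y -> ~ (validk d j /\ validk d k) ->
  advt d X Y k c j = RtoC 0.
Proof.
  intros (HX & _) (HY & _) H; unfold advt.
  destruct (classic (validk d j)) as [Hj|Hj].
  - rewrite (HY (vsub k j)); [ring|].
    intros [Hv _]; apply H; split; auto; now apply (validk_vsub d k j).
  - unfold sumC_lt; rewrite sumC_zero; [ring|]; intros m _; rewrite HX; [ring|tauto].
Qed.

Lemma leray_linear d k w w' a i :
  leray d k (fun m => Cplus (w m) (Cmult a (w' m))) i =
  Cplus (leray d k w i) (Cmult a (leray d k w' i)).
Proof.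
  unfold leray; destruct (Rle_dec (knorm d k) 0) as [H|H]; [ring|].
  assert (E : sumC_lt d (fun m => Cmult (RtoC (IZR (k m))) (Cplus (w m) (Cmult a (w' m)))) =
     Cplus (sumC_lt d (fun m => Cmult (RtoC (IZR (k m))) (w m)))
           (Cmult a (sumC_lt d (fun m => Cmult (RtoC (IZR (k m))) (w' m))))).
  { unfold sumC_lt; rewrite <- sumC_scal, <- sumC_plus; apply sumC_ext; intros; ring. }
  rewrite E; field; intros E'; apply RtoC_inj in E'.
  assert (0 < knorm d k ^ 2) by (apply pow_lt; lra); lra.
Qed.

Lemma leray_ext d k w w' i : (forall m, (m < d)%nat -> w m = w' m) -> (i < d)%nat ->
  leray d k w i = leray d k w' i.
Proof.
  intros H Hi; unfold leray; destruct (Rle_dec (knorm d k) 0); auto.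
  rewrite (H i Hi), (sumC_lt_ext d _ (fun m => Cmult (RtoC (IZR (k m))) (w' m))); auto.
  intros m Hm; now rewrite H.
Qed.

(** Both factors [k_i] and [k_m] are at most |k|. The projection thus costs a factor depending on
    [d] in component sums, which the constant of the theorem can absorb. *)
Lemma Cmod_leray d k w i : (i < d)%nat ->
  Cmod (leray d k w i) <= Cmod (w i) + sumR (seq 0 d) (fun m => Cmod (w m)).
Proof.
  intros Hi; unfold leray.
  assert (H0 : 0 <= sumR (seq 0 d) (fun m => Cmod (w m))).
  { apply sumR_nonneg; intros; apply Cmod_ge_0. }
  destruct (Rle_dec (knorm d k) 0) as [H|H].
  - rewrite Cmod_0; assert (H1 := Cmod_ge_0 (w i)); lra.
  - unfold Cminus; eapply Rle_trans; [apply Cmod_triangle|apply Rplus_le_compat_l].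
    assert (P : 0 < knorm d k ^ 2) by (apply pow_lt; lra).
    rewrite Cmod_opp, Cmod_div, Cmod_mult, !Cmod_R, (Rabs_right (knorm d k ^ 2)).
    2: lra.
    2:{ intros E; apply RtoC_inj in E; lra. }
    apply Rmult_le_reg_r with (knorm d k ^ 2); auto.
    unfold Rdiv; rewrite Rmult_assoc, Rinv_l, Rmult_1_r by lra.
    replace (sumR (seq 0 d) (fun m => Cmod (w m)) * knorm d k ^ 2) with
      (knorm d k * (knorm d k * sumR (seq 0 d) (fun m => Cmod (w m)))) by ring.
    apply Rmult_le_compat; auto using Cmod_ge_0, Rabs_pos, coord_le_knorm.
    unfold sumC_lt; eapply Rle_trans; [apply Cmod_sumC|].
    rewrite <- sumR_scal; apply sumR_le; intros m Hm; apply in_seq in Hm.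
    rewrite Cmod_mult, Cmod_R; apply Rmult_le_compat_r; [apply Cmod_ge_0|].
    apply coord_le_knorm; lia.
Qed.

Lemma leray_diff_bound d k w w' B i : (i < d)%nat ->
  (forall m, (m < d)%nat -> Cmod (Cminus (w m) (w' m)) <= B) ->
  Cmod (Cminus (leray d k w i) (leray d k w' i)) <= INR (S d) * B.
Proof.
  intros Hi HB.
  replace (Cminus (leray d k w i) (leray d k w' i))
    with (leray d k (fun m => Cplus (w m) (Cmult (Copp (RtoC 1)) (w' m))) i)
    by (rewrite leray_linear; ring).
  eapply Rle_trans; [now apply Cmod_leray|].
  assert (HB' : forall m, (m < d)%nat -> Cmod (Cplus (w m) (Cmult (Copp (RtoC 1)) (w' m))) <= B).
  { intros m Hm; replace (Cplus _ _) with (Cminus (w m) (w' m)) by ring; auto. }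
  assert (S1 : sumR (seq 0 d) (fun m =>
    Cmod (Cplus (w m) (Cmult (Copp (RtoC 1)) (w' m)))) <= INR d * B).
  { eapply Rle_trans; [apply sumR_le with (g := fun _ => B)|].
    - intros m Hm; apply in_seq in Hm; apply HB'; lia.
    - rewrite sumR_const, length_seq; lra. }
  specialize (HB' i Hi); rewrite S_INR; lra.
Qed.

Lemma rhs_diff_bound d g k b b' e e' B eps c : 0 <= g -> (c <= d)%nat ->
  (forall m, (m <= d)%nat -> Cmod (Cminus (b m) (b' m)) <= B) -> Cmod (Cminus e e') <= eps ->
  Cmod (Cminus (rhs d g k b e c) (rhs d g k b' e' c)) <= INR (S d) * (B + g * eps).
Proof.
  intros Hg Hc HB He; unfold rhs.
  assert (B0 : 0 <= B) by (eapply Rle_trans; [apply Cmod_ge_0|apply (HB O); lia]).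
  assert (E0 : 0 <= eps) by (eapply Rle_trans; [apply Cmod_ge_0|exact He]).
  assert (D0 : 0 <= INR d) by apply pos_INR.
  destruct (Nat.ltb_spec c d) as [Hcd|Hcd].
  - assert (L1 := leray_diff_bound d k b b' B c Hcd (fun m Hm => HB m (Nat.lt_le_incl _ _ Hm))).
    assert (L2 : Cmod (Cminus (leray d k (fun m => Cmult e (RtoC (upvec d m))) c)
                        (leray d k (fun m => Cmult e' (RtoC (upvec d m))) c)) <= INR (S d) * eps).
    { apply leray_diff_bound; auto; intros m _.
      replace (Cminus _ _) with (Cmult (Cminus e e') (RtoC (upvec d m))) by ring.
      rewrite Cmod_mult, Cmod_R; unfold upvec; destruct (Nat.eqb m (d - 1)).
      - rewrite Rabs_R1; lra.
      - rewrite Rabs_R0; lra. }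
    set (y := leray d k b c) in *; set (y' := leray d k b' c) in *.
    set (x := leray d k (fun m => Cmult e (RtoC (upvec d m))) c) in *.
    set (x' := leray d k (fun m => Cmult e' (RtoC (upvec d m))) c) in *.
    replace (Cminus _ _) with (Cplus (Copp (Cminus y y')) (Cmult (RtoC g) (Cminus x x'))) by ring.
    eapply Rle_trans; [apply Cmod_triangle|].
    rewrite Cmod_opp, Cmod_mult, Cmod_R, Rabs_right by lra.
    assert (g * Cmod (Cminus x x') <= g * (INR (S d) * eps)) by now apply Rmult_le_compat_l.
    lra.
  - replace (Cminus _ _) with (Copp (Cminus (b d) (b' d))) by ring.
    rewrite Cmod_opp, S_INR; specialize (HB d (le_n d)).
    assert (0 <= g * eps) by now apply Rmult_le_pos. nra.
Qed.

(** * Square-summable states *)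

(** Lists of pairs (wavevector, component) are used so that an l^2 norm can be tested on a finite
    set of modes at a time, as the duality argument of uniqueness does. *)
Definition l2b (X : VField) (M : R) : Prop :=
  0 <= M /\ forall l : list (Vec * nat), NoDup l ->
    sumR l (fun p => Cmod (X (fst p) (snd p)) ^ 2) <= M ^ 2.

Lemma l2b_dom X Y a M : 0 <= a -> (forall k c, Cmod (Y k c) <= a * Cmod (X k c)) ->
  l2b X M -> l2b Y (a * M).
Proof.
  intros Ha H [HM HX]; split; [now apply Rmult_le_pos|]; intros l Hl.
  apply Rle_trans with (a ^ 2 * sumR l (fun p => Cmod (X (fst p) (snd p)) ^ 2)).
  - rewrite <- sumR_scal; apply sumR_le; intros p _; rewrite <- Rpow_mult_distr.
    apply pow_incr; split; [apply Cmod_ge_0|apply H].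
  - rewrite Rpow_mult_distr; apply Rmult_le_compat_l; auto; apply pow2_ge_0.
Qed.

Lemma l2b_plus X Y Z M N : (forall k c, Cmod (Z k c) <= Cmod (X k c) + Cmod (Y k c)) ->
  l2b X M -> l2b Y N -> l2b Z (M + N).
Proof.
  intros H [HM HX] [HN HY]; split; [lra|]; intros l Hl.
  eapply Rle_trans; [|apply (minkowski l (fun p => Cmod (X (fst p) (snd p)))
    (fun p => Cmod (Y (fst p) (snd p)))); auto].
  apply sumR_le; intros p _; apply pow_incr; split; [apply Cmod_ge_0|apply H].
Qed.

Lemma l2b_mono X M N : M <= N -> l2b X M -> l2b X N.
Proof.
  intros H [HM HX]; split; [lra|]; intros l Hl; eapply Rle_trans; [now apply HX|].
  apply pow_incr; lra.
Qed.

Lemma l2b_point X M k c : l2b X M -> Cmod (X k c) <= M.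
Proof.
  intros [HM HX]; specialize (HX ((k, c) :: nil)); unfold sumR in HX; simpl in HX.
  assert (H : NoDup ((k, c) :: nil)) by (constructor; [easy|constructor]).
  specialize (HX H); apply Rsqr_incr_0_var; auto; unfold Rsqr; lra.
Qed.

Lemma l2b_zero M : 0 <= M -> l2b (fun _ _ => RtoC 0) M.
Proof.
  intros HM; split; auto; intros l _; rewrite sumR_zero; [apply pow2_ge_0|].
  intros; rewrite Cmod_0; ring.
Qed.

Lemma sumR_filter {A} (b : A -> bool) (l : list A) f :
  (forall a, b a = false -> f a = 0) -> sumR l f = sumR (filter b l) f.
Proof.
  intros H; induction l as [|a l IH]; simpl; auto.
  change (sumR (a :: l) f) with (f a + sumR l f); rewrite IH.
  destruct (b a) eqn:E; [easy|rewrite (H a E); lra].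
Qed.

Lemma two_pi_pow_ge_1 d : 1 <= (2 * PI) ^ d.
Proof. apply pow_R1_Rle; assert (H := PI2_1); unfold PI2 in H; lra. Qed.

Lemma wpartial_ge d a N : (forall k, 0 <= a k) ->
  sumR (box d N) a <= wpartial d (fun _ => 1) a N.
Proof.
  intros Ha; unfold wpartial.
  rewrite (sumR_ext _ (fun k => 1 * a k) a) by (intros; ring).
  assert (H := two_pi_pow_ge_1 d).
  assert (0 <= sumR (box d N) a) by (apply sumR_nonneg; auto); nra.
Qed.

Lemma vsq_nonneg d u k : 0 <= vsq d u k.
Proof. apply sumR_nonneg; intros; apply pow2_ge_0. Qed.

Lemma ssq_nonneg eta k : 0 <= ssq eta k.
Proof. apply pow2_ge_0. Qed.

Lemma l2b_st d u eta A B M : 0 <= M -> A + B <= M ^ 2 ->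
  (forall N, wpartial d (fun _ => 1) (vsq d u) N <= A) ->
  (forall N, wpartial d (fun _ => 1) (ssq eta) N <= B) -> l2b (st d u eta) M.
Proof.
  intros HM HAB HA HB; split; auto; intros l Hl; eapply Rle_trans; [|exact HAB].
  set (b := fun p : Vec * nat => andb (validb d (fst p)) (Nat.leb (snd p) d)).
  rewrite (sumR_filter b).
  2:{ intros [k c] Hb; rewrite st_out, Cmod_0; [ring|]; simpl; intros [H1 H2].
      unfold b in Hb; simpl in Hb; apply validb_spec in H1; apply Nat.leb_le in H2.
      now rewrite H1, H2 in Hb. }
  destruct (box_cofinal d (map fst l)) as [N HN].
  apply Rle_trans with (sumR (list_prod (box d N) (seq 0 (S d)))
    (fun p => Cmod (st d u eta (fst p) (snd p)) ^ 2)).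
  - apply sumR_incl_le; [intros; apply pow2_ge_0|now apply NoDup_filter|].
    intros [k c] Hp; apply filter_In in Hp as [Hp Hb]; unfold b in Hb; simpl in Hb.
    apply andb_prop in Hb as [Hb1 Hb2]; apply validb_spec in Hb1; apply Nat.leb_le in Hb2.
    apply in_prod; [|apply in_seq; lia].
    apply (HN N); auto; now apply (in_map fst) in Hp.
  - rewrite sumR_list_prod.
    apply Rle_trans with (sumR (box d N) (fun k => vsq d u k + ssq eta k)).
    + apply Req_le, sumR_ext; intros k Hk; apply in_box in Hk as [_ Hk].
      rewrite seq_S, sumR_app; unfold sumR at 2; simpl; rewrite st_scal by auto.
      unfold ssq; simpl; rewrite Rplus_0_r; f_equal.
      apply sumR_ext; intros i Hi; apply in_seq in Hi; rewrite st_vel; auto; lia.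
    + rewrite sumR_plus; apply Rplus_le_compat.
      * eapply Rle_trans; [apply wpartial_ge, vsq_nonneg|auto].
      * eapply Rle_trans; [apply wpartial_ge, ssq_nonneg|auto].
Qed.

Lemma l2b_conv X Y M N m c k la : l2b X M -> l2b Y N -> NoDup la ->
  sumR la (fun j => Cmod (X j m) * Cmod (Y (vsub k j) c)) <= M * N.
Proof.
  intros [HM HX] [HN HY] Hla; apply cauchy_schwarz_sqrt; auto.
  - assert (H : NoDup (map (fun j => (j, m)) la)) by (apply NoDup_map_injective; auto; congruence).
    apply HX in H; rewrite sumR_map in H; exact H.
  - assert (H : NoDup (map (fun j => (vsub k j, c)) la)).
    { apply NoDup_map_injective; auto.
      intros j j' E; injection E; intros E'; now apply vsub_inj_r in E'. }
    apply HY in H; rewrite sumR_map in H; exact H.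
Qed.

(** Write [XX - YY = (X - Y) X + Y (X - Y)] and apply Cauchy-Schwarz to each convolution; in
    divergence form the only unbounded factor is |k|, which stays outside the sum. *)
Lemma advt_diff_bound d X Y M e k c la : l2b X M -> l2b Y M ->
  l2b (fun k c => Cminus (X k c) (Y k c)) e -> NoDup la ->
  sumR la (fun j => Cmod (Cminus (advt d X X k c j) (advt d Y Y k c j))) <=
  INR d * (knorm d k * (2 * (e * M))).
Proof.
  intros HX HY HD Hla.
  apply Rle_trans with (sumR la (fun j => sumR (seq 0 d) (fun m => knorm d k *
    (Cmod (Cminus (X j m) (Y j m)) * Cmod (X (vsub k j) c) +
     Cmod (Y j m) * Cmod (Cminus (X (vsub k j) c) (Y (vsub k j) c)))))).
  - apply sumR_le; intros j _; unfold advt, sumC_lt.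
    replace (Cminus _ _) with (Cmult Ci (sumC (seq 0 d) (fun m => Cmult (RtoC (IZR (k m)))
      (Cplus (Cmult (Cminus (X j m) (Y j m)) (X (vsub k j) c))
             (Cmult (Y j m) (Cminus (X (vsub k j) c) (Y (vsub k j) c))))))).
    + rewrite Cmod_mult, Cmod_Ci, Rmult_1_l.
      eapply Rle_trans; [apply Cmod_sumC|apply sumR_le]; intros m Hm; apply in_seq in Hm.
      rewrite Cmod_mult, Cmod_R; apply Rmult_le_compat; auto using Cmod_ge_0, Rabs_pos.
      * apply coord_le_knorm; lia.
      * eapply Rle_trans; [apply Cmod_triangle|]; rewrite !Cmod_mult; lra.
    + set (x := X (vsub k j) c); set (y := Y (vsub k j) c).
      transitivity (Cmult Ci (Cminus
        (Cmult x (sumC (seq 0 d) (fun m => Cmult (RtoC (IZR (k m))) (X j m))))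
        (Cmult y (sumC (seq 0 d) (fun m => Cmult (RtoC (IZR (k m))) (Y j m)))))); [|ring].
      f_equal; rewrite <- (sumC_scal _ x), <- (sumC_scal _ y), <- sumC_minus.
      apply sumC_ext; intros; ring.
  - rewrite sumR_exchange.
    replace (INR d) with (INR (length (seq 0 d))) by now rewrite length_seq.
    rewrite <- sumR_const; apply sumR_le; intros m _.
    rewrite sumR_scal; apply Rmult_le_compat_l; [apply knorm_pos|].
    rewrite sumR_plus; replace (2 * (e * M)) with (e * M + M * e) by ring.
    apply Rplus_le_compat.
    + apply (l2b_conv (fun k c => Cminus (X k c) (Y k c)) X); auto.
    + apply (l2b_conv Y (fun k c => Cminus (X k c) (Y k c))); auto.
Qed.

(** The factor 2 comes from passing to the limit in real and imaginary parts separately, as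
    [conv_to] is phrased. *)
Lemma conv_to_diff_bound d f h a b B : conv_to d f a -> conv_to d h b ->
  (forall N, sumR (box d N) (fun j => Cmod (Cminus (f j) (h j))) <= B) ->
  Cmod (Cminus a b) <= 2 * B.
Proof.
  intros [Ha1 Ha2] [Hb1 Hb2] HB.
  assert (HB' : forall N, Cmod (Cminus (sumC (box d N) f) (sumC (box d N) h)) <= B).
  { intros N; rewrite <- sumC_minus; eapply Rle_trans; [apply Cmod_sumC|auto]. }
  assert (L : forall x y (p q : nat -> R), is_lim_seq p (Finite x) -> is_lim_seq q (Finite y) ->
     (forall N, Rabs (p N - q N) <= B) -> Rabs (x - y) <= B).
  { intros x y p q Hp Hq H.
    assert (Hl := is_lim_seq_abs _ _ (is_lim_seq_minus' p q x y Hp Hq)).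
    apply (is_lim_seq_le _ (fun _ => B) _ (Finite B) H Hl); apply is_lim_seq_const. }
  assert (R1 := L _ _ _ _ Ha1 Hb1 (fun N =>
    Rle_trans _ _ _ (re_le_Cmod (Cminus (sumC (box d N) f) (sumC (box d N) h))) (HB' N))).
  assert (R2 := L _ _ _ _ Ha2 Hb2 (fun N =>
    Rle_trans _ _ _ (im_le_Cmod (Cminus (sumC (box d N) f) (sumC (box d N) h))) (HB' N))).
  eapply Rle_trans; [apply Cmod_le_parts|].
  change (Rabs (Re a - Re b) + Rabs (Im a - Im b) <= 2 * B); lra.
Qed.

(** * Uniqueness *)

Definition evolves (d : nat) (g : R) (X DX : VField) : Prop :=
  is_state d X /\ (forall k c, ~ (validk d k /\ (c <= d)%nat) -> DX k c = RtoC 0) /\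
  forall k, validk d k -> exists b,
    (forall c, (c <= d)%nat -> conv_to d (advt d X X k c) (b c)) /\
    (forall c, (c <= d)%nat -> DX k c = rhs d g k b (X k d) c).

Definition sol (d : nat) (g rho : R) (X DX : C -> VField) : Prop :=
  forall z, Cmod z < rho -> evolves d g (X z) (DX z) /\ (exists M, l2b (X z) M) /\
    forall eps, 0 < eps -> exists delta, 0 < delta /\
      forall h, 0 < Cmod h < delta -> Cmod (Cplus z h) < rho ->
        l2b (fun k c => Cminus (Cdiv (Cminus (X (Cplus z h) k c) (X z k c)) h) (DX z k c)) eps.

(** Lipschitz constant, at the single wavevector [k], of the right-hand side on the l^2 ball of
    radius [M]. It grows with |k|, so the estimate it gives is one for each mode and not one in
    l^2. *)
Definition rate (d : nat) (g : R) (k : Vec) (M : R) : R :=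
  INR (S d) * (2 * (INR d * (knorm d k * (2 * M))) + g).

Lemma rate_nonneg d g k M : 0 <= g -> 0 <= M -> 0 <= rate d g k M.
Proof.
  intros Hg HM; unfold rate; assert (H := knorm_pos d k); assert (H1 := pos_INR d).
  assert (H2 := pos_INR (S d)).
  apply Rmult_le_pos; auto; apply Rplus_le_le_0_compat; auto.
  repeat apply Rmult_le_pos; auto; lra.
Qed.

Lemma evolves_diff d g X DX Y DY M e k c : 0 <= g -> evolves d g X DX -> evolves d g Y DY ->
  l2b X M -> l2b Y M -> l2b (fun k c => Cminus (X k c) (Y k c)) e ->
  Cmod (Cminus (DX k c) (DY k c)) <= rate d g k M * e.
Proof.
  intros Hg (SX & OX & EX) (SY & OY & EY) HX HY HD.
  destruct (classic (validk d k /\ (c <= d)%nat)) as [[Hk Hc]|H].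
  - destruct (EX k Hk) as (b & Hb & Eb), (EY k Hk) as (b' & Hb' & Eb').
    rewrite Eb, Eb' by auto.
    eapply Rle_trans; [apply (rhs_diff_bound d g k b b' (X k d) (Y k d)
      (2 * (INR d * (knorm d k * (2 * (e * M))))) e); auto|].
    + intros m Hm; apply (conv_to_diff_bound d _ _ _ _ _ (Hb m Hm) (Hb' m Hm)).
      intros N; apply advt_diff_bound; auto; apply NoDup_box.
    + apply (l2b_point (fun k c => Cminus (X k c) (Y k c)) e k d HD).
    + unfold rate; apply Req_le; ring.
  - rewrite OX, OY by auto; replace (Cminus _ _) with (RtoC 0) by ring; rewrite Cmod_0.
    apply Rmult_le_pos; [apply rate_nonneg; auto; apply HX|apply HD].
Qed.

(** Square-summability of [DX z] is obtained by comparison with a single difference quotient of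
    fixed step [a], whose two values are square-summable; every small increment is then O(|h|) in
    l^2. *)
Lemma sol_derivative_bound d g rho X DX z : sol d g rho X DX -> Cmod z < rho ->
  exists M delta, 0 <= M /\ 0 < delta /\ forall h, Cmod h < delta -> Cmod (Cplus z h) < rho ->
    l2b (fun k c => Cminus (X (Cplus z h) k c) (X z k c)) (Cmod h * M).
Proof.
  intros HS Hz; destruct (HS z Hz) as (_ & [M0 H0] & HD).
  destruct (HD 1 Rlt_0_1) as (delta & Hd & H1).
  set (a := Rmin delta (rho - Cmod z) / 2).
  assert (Ha : 0 < a) by (unfold a; assert (0 < Rmin delta (rho - Cmod z)) by (apply Rmin_glb_lt;
    lra); lra).
  assert (Ha1 : a < delta) by (assert (A := Rmin_l delta (rho - Cmod z)); unfold a in *; lra).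
  assert (Ha2 : a < rho - Cmod z) by (assert (A := Rmin_r delta (rho - Cmod z)); unfold a in *;
    lra).
  assert (Ea : Cmod (RtoC a) = a) by (rewrite Cmod_R, Rabs_right; lra).
  assert (Hza : Cmod (Cplus z (RtoC a)) < rho).
  { eapply Rle_lt_trans; [apply Cmod_triangle|lra]. }
  destruct (HS _ Hza) as (_ & [M1 HM1] & _).
  assert (L1 := H1 (RtoC a)); rewrite Ea in L1; specialize (L1 (conj Ha Ha1) Hza).
  assert (an : RtoC a <> RtoC 0) by (intros E; apply RtoC_inj in E; lra).
  assert (LD : l2b (DX z) (/ a * (M1 + M0) + 1)).
  { refine (l2b_plus (fun k c =>
    Cdiv (Cminus (X (Cplus z (RtoC a)) k c) (X z k c)) (RtoC a)) _ _ _ _ _ _ L1).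
    - intros k c; rewrite (Cmod_minus_sym (Cdiv _ _) (DX z k c)).
      eapply Rle_trans; [|apply Cmod_triangle]; apply Req_le; f_equal; ring.
    - refine (l2b_dom (fun k c => Cminus (X (Cplus z (RtoC a)) k c) (X z k c)) _ (/ a) _ _ _ _).
      + now apply Rlt_le, Rinv_0_lt_compat.
      + intros k c; rewrite Cmod_div, Ea by auto; unfold Rdiv; lra.
      + refine (l2b_plus _ _ _ _ _ _ HM1 H0); intros k c; unfold Cminus.
        rewrite <- (Cmod_opp (X z k c)); apply Cmod_triangle. }
  exists (1 + (/ a * (M1 + M0) + 1)), delta; split; [destruct LD; lra|split; auto].
  intros h Hh Hzh; destruct (Req_dec (Cmod h) 0) as [E|E].
  - apply Cmod_eq_0 in E; subst h; rewrite Cmod_0, Rmult_0_l.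
    replace (fun k c => _) with (fun (k : Vec) (c : nat) => RtoC 0); [apply l2b_zero; lra|].
    apply functional_extensionality; intros k; apply functional_extensionality; intros c.
    rewrite Cplus_0_r; ring.
  - assert (Hh0 : 0 < Cmod h) by (assert (A := Cmod_ge_0 h); lra).
    assert (hn : h <> RtoC 0) by (intros E'; subst h; rewrite Cmod_0 in Hh0; lra).
    specialize (H1 h (conj Hh0 Hh) Hzh).
    refine (l2b_dom (fun k c => Cdiv (Cminus (X (Cplus z h) k c) (X z k c)) h) _ _ _ _ _ _).
    + lra.
    + intros k c; rewrite Cmod_div by auto; apply Req_le; field; lra.
    + refine (l2b_plus _ _ _ _ _ _ H1 LD); intros k c.
      eapply Rle_trans; [|apply Cmod_triangle]; apply Req_le; f_equal; ring.
Qed.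

Lemma sol_continuous d g rho X DX z eps : sol d g rho X DX -> Cmod z < rho -> 0 < eps ->
  exists delta, 0 < delta /\ forall h, Cmod h < delta -> Cmod (Cplus z h) < rho ->
    l2b (fun k c => Cminus (X (Cplus z h) k c) (X z k c)) eps.
Proof.
  intros HS Hz He; destruct (sol_derivative_bound _ _ _ _ _ _ HS Hz) as (M & delta & HM & Hd & H).
  exists (Rmin delta (eps / (M + 1))); split.
  - apply Rmin_glb_lt; auto; apply Rdiv_lt_0_compat; lra.
  - intros h Hh Hzh; assert (H1 := Rmin_l delta (eps / (M + 1))).
    assert (H2 := Rmin_r delta (eps / (M + 1))).
    refine (l2b_mono _ _ _ _ (H h _ Hzh)); [|lra].
    apply Rle_trans with (eps / (M + 1) * M).
    + apply Rmult_le_compat_r; lra.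
    + apply Rmult_le_reg_r with (M + 1); [lra|].
      replace (eps / (M + 1) * M * (M + 1)) with (eps * M) by (field; lra); nra.
Qed.

(** * Holomorphy of the modes and of their finite combinations *)

Lemma cderiv_sumC {A} (l : list A) (a : A -> C) (f : A -> C -> C) z df :
  (forall p, cderiv (f p) z (df p)) ->
  cderiv (fun w => sumC l (fun p => Cmult (a p) (f p w))) z (sumC l (fun p => Cmult (a p) (df p))).
Proof.
  intros H; induction l as [|p l IH].
  - intros eps He; exists 1; split; [lra|]; intros h _; unfold sumC; simpl.
    replace (Cminus _ _) with (RtoC 0) by ring; rewrite Cmod_0.
    apply Rmult_le_pos; [lra|apply Cmod_ge_0].
  - intros eps He; assert (Ha := Cmod_ge_0 (a p)).
    destruct (H p (eps / 2 / (Cmod (a p) + 1))) as (d1 & Hd1 & H1).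
    { repeat apply Rdiv_lt_0_compat; lra. }
    destruct (IH (eps / 2)) as (d2 & Hd2 & H2); [lra|].
    exists (Rmin d1 d2); split; [now apply Rmin_glb_lt|]; intros h Hh.
    assert (A1 := H1 h (Rlt_le_trans _ _ _ Hh (Rmin_l _ _))).
    assert (A2 := H2 h (Rlt_le_trans _ _ _ Hh (Rmin_r _ _))).
    change (sumC (p :: l) ?F) with (Cplus (F p) (sumC l F)).
    change (fun w => sumC (p :: l) (fun p => Cmult (a p) (f p w))) with
      (fun w => Cplus (Cmult (a p) (f p w)) (sumC l (fun p => Cmult (a p) (f p w)))).
    cbv beta.
    set (s0 := sumC l (fun p => Cmult (a p) (f p z))) in *.
    set (s1 := sumC l (fun p => Cmult (a p) (f p (Cplus z h)))) in *.
    set (s2 := sumC l (fun p => Cmult (a p) (df p))) in *.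
    match goal with |- Cmod ?x <= _ => replace x with (Cplus
      (Cmult (a p) (Cminus (Cminus (f p (Cplus z h)) (f p z)) (Cmult (df p) h)))
      (Cminus (Cminus s1 s0) (Cmult s2 h))) by (unfold s0, s1, s2; simpl; ring) end.
    eapply Rle_trans; [apply Cmod_triangle|]; rewrite Cmod_mult.
    assert (Hh0 := Cmod_ge_0 h).
    assert (A3 : Cmod (a p) * Cmod (Cminus (Cminus (f p (Cplus z h)) (f p z)) (Cmult (df p) h)) <=
                 eps / 2 * Cmod h).
    { apply Rle_trans with ((Cmod (a p) + 1) * (eps / 2 / (Cmod (a p) + 1) * Cmod h)).
      - apply Rmult_le_compat; try lra; apply Cmod_ge_0.
      - apply Req_le; field; lra. }
    lra.
Qed.

Lemma ccont_sumC {A} (l : list A) (a : A -> C) (f : A -> C -> C) z :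
  (forall p, ccont (f p) z) -> ccont (fun w => sumC l (fun p => Cmult (a p) (f p w))) z.
Proof.
  intros H; induction l as [|p l IH].
  - intros eps He; exists 1; split; [lra|]; intros h _; unfold sumC; simpl.
    replace (Cminus _ _) with (RtoC 0) by ring; now rewrite Cmod_0.
  - intros eps He; assert (Ha := Cmod_ge_0 (a p)).
    destruct (H p (eps / 2 / (Cmod (a p) + 1))) as (d1 & Hd1 & H1).
    { repeat apply Rdiv_lt_0_compat; lra. }
    destruct (IH (eps / 2)) as (d2 & Hd2 & H2); [lra|].
    exists (Rmin d1 d2); split; [now apply Rmin_glb_lt|]; intros h Hh.
    assert (A1 := H1 h (Rlt_le_trans _ _ _ Hh (Rmin_l _ _))).
    assert (A2 := H2 h (Rlt_le_trans _ _ _ Hh (Rmin_r _ _))).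
    change (fun w => sumC (p :: l) (fun p => Cmult (a p) (f p w))) with
      (fun w => Cplus (Cmult (a p) (f p w)) (sumC l (fun p => Cmult (a p) (f p w)))).
    cbv beta.
    set (s0 := sumC l (fun p => Cmult (a p) (f p z))) in *.
    set (s1 := sumC l (fun p => Cmult (a p) (f p h))) in *.
    match goal with |- Cmod ?x < _ => replace x with
      (Cplus (Cmult (a p) (Cminus (f p h) (f p z))) (Cminus s1 s0)) by (unfold s0, s1; simpl;
        ring) end.
    eapply Rle_lt_trans; [apply Cmod_triangle|]; rewrite Cmod_mult.
    assert (A3 : Cmod (a p) * Cmod (Cminus (f p h) (f p z)) <= eps / 2).
    { apply Rle_trans with ((Cmod (a p) + 1) * (eps / 2 / (Cmod (a p) + 1))).
      - apply Rmult_le_compat; try lra; apply Cmod_ge_0.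
      - apply Req_le; field; lra. }
    lra.
Qed.

(** The real mean value theorem is applied to the real part of [Cconj (f z) * f (s z)], which rises
    from 0 to [|f z|^2]; one factor [|f z|] cancels and no constant is lost. *)
Lemma complex_mean_value f Df rho B z : holo f Df rho -> Cmod z < rho -> f (RtoC 0) = RtoC 0 ->
  (forall s, 0 <= s <= 1 -> Cmod (Df (Cmult (RtoC s) z)) <= B) -> Cmod (f z) <= B * Cmod z.
Proof.
  intros Hf Hz H0 HB.
  set (c := Cconj (f z)).
  set (p := fun s => Cmult c (f (Cmult (RtoC s) z))).
  assert (Hp : forall s, 0 <= s <= 1 -> pderiv p s (Cmult c (Cmult (Df (Cmult (RtoC s) z)) z))).
  { intros s Hs; unfold p; apply pderiv_scal.
    eapply pderiv_eq; [|apply (pderiv_comp f (fun s => Cmult (RtoC s) z) s (Df (Cmult (RtoC s) z)));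
      [|apply (pderiv_mult (fun s => RtoC s) (fun _ => z));
        [apply pderiv_RtoC|apply pderiv_const]]].
    - simpl; ring.
    - apply Hf; rewrite Cmod_mult, Cmod_R, Rabs_right by lra.
      assert (A := Cmod_ge_0 z); nra. }
  destruct (MVT_gen (fun s => Re (p s)) 0 1
     (fun s => Re (Cmult c (Cmult (Df (Cmult (RtoC s) z)) z)))) as (s & Hs & E).
  - intros s Hs; rewrite Rmin_left, Rmax_right in Hs by lra; apply is_derive_Reals, Hp; lra.
  - intros s Hs; rewrite Rmin_left, Rmax_right in Hs by lra.
    eapply (pderiv_pcont p), Hp; lra.
  - rewrite Rmin_left, Rmax_right in Hs by lra.
    assert (E1 : Re (p 1) = Cmod (f z) ^ 2).
    { unfold p, c; rewrite Cmult_1_l, Cmod_sq; unfold Re, Im; destruct (f z); simpl; ring. }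
    assert (E2 : Re (p 0) = 0).
    { unfold p; rewrite Cmult_0_l, H0, Cmult_0_r; easy. }
    rewrite E1, E2 in E.
    assert (A : Cmod (f z) ^ 2 <= Cmod (f z) * (B * Cmod z)).
    { replace (Cmod (f z) ^ 2) with (Cmod (f z) ^ 2 - 0) by ring; rewrite E, Rminus_0_r, Rmult_1_r.
      eapply Rle_trans; [apply Rle_abs|]; eapply Rle_trans; [apply re_le_Cmod|].
      rewrite !Cmod_mult; unfold c; rewrite Cmod_conj.
      apply Rmult_le_compat_l; [apply Cmod_ge_0|]; apply Rmult_le_compat_r;
        [apply Cmod_ge_0|auto]. }
    assert (P := Cmod_ge_0 (f z)).
    destruct (Req_dec (Cmod (f z)) 0) as [F|F].
    + rewrite F; apply Rmult_le_pos; [|apply Cmod_ge_0].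
      eapply Rle_trans; [apply Cmod_ge_0|apply (HB 0); lra].
    + apply Rmult_le_reg_l with (Cmod (f z)); [lra|]; lra.
Qed.

Lemma holo_sumC {A} (l : list A) (a : A -> C) (f df : A -> C -> C) rho :
  (forall p, holo (f p) (df p) rho) ->
  holo (fun w => sumC l (fun p => Cmult (a p) (f p w)))
       (fun w => sumC l (fun p => Cmult (a p) (df p w))) rho.
Proof.
  intros H z Hz; split.
  - apply (cderiv_sumC l a f z (fun p => df p z)); intros; now apply H.
  - apply ccont_sumC; intros; now apply H.
Qed.

(** Differentiability is the l^2 one read on one coefficient. Continuity of the derivative comes
    from the equation: by [evolves_diff] it is Lipschitz in the state, and the state is continuous
    in l^2. *)
Lemma sol_mode_holo d g rho X DX z1 R0 M k c : 0 <= g -> sol d g rho X DX ->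
  (forall w, Cmod w < R0 -> Cmod (Cplus z1 w) < rho /\ l2b (X (Cplus z1 w)) M) ->
  holo (fun w => X (Cplus z1 w) k c) (fun w => DX (Cplus z1 w) k c) R0.
Proof.
  intros Hg HS Hin z Hz; destruct (Hin z Hz) as [Hzr HM].
  assert (Hnear : forall h, Cmod h < R0 - Cmod z -> Cmod (Cplus z h) < R0).
  { intros h Hh; eapply Rle_lt_trans; [apply Cmod_triangle|lra]. }
  split.
  - intros eps He; destruct (HS _ Hzr) as (_ & _ & HD); destruct (HD eps He) as (delta & Hd & H).
    exists (Rmin delta (R0 - Cmod z)); split; [apply Rmin_glb_lt; lra|].
    intros h Hh.
    assert (Hh1 := Rlt_le_trans _ _ _ Hh (Rmin_l _ _)).
    assert (Hh2 := Rlt_le_trans _ _ _ Hh (Rmin_r _ _)).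
    destruct (Req_dec (Cmod h) 0) as [E|E].
    + apply Cmod_eq_0 in E; subst h; rewrite Cplus_0_r.
      match goal with |- Cmod ?x <= _ => replace x with (RtoC 0) by ring end.
      rewrite Cmod_0; lra.
    + assert (Hh0 : 0 < Cmod h) by (assert (A := Cmod_ge_0 h); lra).
      assert (hn : h <> RtoC 0) by (intros E'; subst h; rewrite Cmod_0 in Hh0; lra).
      assert (Hzh : Cmod (Cplus (Cplus z1 z) h) < rho).
      { rewrite <- Cplus_assoc; apply Hin, Hnear, Hh2. }
      assert (A := l2b_point _ _ k c (H h (conj Hh0 Hh1) Hzh)); cbv beta in A.
      rewrite <- Cplus_assoc in A.
      match goal with |- Cmod ?x <= _ => replace x with
        (Cmult (Cminus (Cdiv (Cminus (X (Cplus z1 (Cplus z h)) k c) (X (Cplus z1 z) k c)) h)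
                  (DX (Cplus z1 z) k c)) h) by (field; auto) end.
      rewrite Cmod_mult; apply Rmult_le_compat_r; lra.
  - intros eps He.
    assert (HK : 0 <= rate d g k M) by (apply rate_nonneg; auto; apply HM).
    destruct (sol_continuous d g rho X DX (Cplus z1 z) (eps / (rate d g k M + 1)) HS Hzr)
      as (delta & Hd & H); [apply Rdiv_lt_0_compat; lra|].
    exists (Rmin delta (R0 - Cmod z)); split; [apply Rmin_glb_lt; lra|].
    intros w Hw.
    assert (Hh1 := Rlt_le_trans _ _ _ Hw (Rmin_l _ _)).
    assert (Hh2 := Rlt_le_trans _ _ _ Hw (Rmin_r _ _)).
    assert (Ew : Cplus z1 w = Cplus (Cplus z1 z) (Cminus w z)) by ring.
    assert (Hw' : Cmod w < R0) by (replace w with (Cplus z (Cminus w z)) by ring; auto).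
    destruct (Hin w Hw') as [Hwr HMw].
    assert (Hl := H (Cminus w z) Hh1); rewrite <- Ew in Hl; specialize (Hl Hwr).
    eapply Rle_lt_trans; [apply (evolves_diff d g _ _ _ _ M _ k c Hg
       (proj1 (HS _ Hwr)) (proj1 (HS _ Hzr)) HMw HM Hl)|].
    apply Rmult_lt_reg_r with (rate d g k M + 1); [lra|].
    replace (rate d g k M * (eps / (rate d g k M + 1)) * (rate d g k M + 1))
      with (rate d g k M * eps) by (field; lra); nra.
Qed.

Lemma cderiv_minus f h z a b : cderiv f z a -> cderiv h z b ->
  cderiv (fun w => Cminus (f w) (h w)) z (Cminus a b).
Proof.
  intros Hf Hh eps He.
  destruct (Hf (eps / 2)) as (d1 & Hd1 & H1); [lra|].
  destruct (Hh (eps / 2)) as (d2 & Hd2 & H2); [lra|].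
  exists (Rmin d1 d2); split; [now apply Rmin_glb_lt|]; intros x Hx.
  assert (A1 := H1 x (Rlt_le_trans _ _ _ Hx (Rmin_l _ _))).
  assert (A2 := H2 x (Rlt_le_trans _ _ _ Hx (Rmin_r _ _))).
  match goal with |- Cmod ?y <= _ => replace y with
    (Cplus (Cminus (Cminus (f (Cplus z x)) (f z)) (Cmult a x))
     (Copp (Cminus (Cminus (h (Cplus z x)) (h z)) (Cmult b x)))) by ring end.
  eapply Rle_trans; [apply Cmod_triangle|]; rewrite Cmod_opp; lra.
Qed.

Lemma ccont_minus f h z : ccont f z -> ccont h z -> ccont (fun w => Cminus (f w) (h w)) z.
Proof.
  intros Hf Hh eps He.
  destruct (Hf (eps / 2)) as (d1 & Hd1 & H1); [lra|].
  destruct (Hh (eps / 2)) as (d2 & Hd2 & H2); [lra|].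
  exists (Rmin d1 d2); split; [now apply Rmin_glb_lt|]; intros x Hx.
  assert (A1 := H1 x (Rlt_le_trans _ _ _ Hx (Rmin_l _ _))).
  assert (A2 := H2 x (Rlt_le_trans _ _ _ Hx (Rmin_r _ _))).
  match goal with |- Cmod ?y < _ => replace y with
    (Cplus (Cminus (f x) (f z)) (Copp (Cminus (h x) (h z)))) by ring end.
  eapply Rle_lt_trans; [apply Cmod_triangle|]; rewrite Cmod_opp; lra.
Qed.

Lemma sol_local_bound d g rho X DX z : sol d g rho X DX -> Cmod z < rho ->
  exists M delta, 0 < delta /\ forall w, Cmod w < delta ->
    Cmod (Cplus z w) < rho /\ l2b (X (Cplus z w)) M.
Proof.
  intros HS Hz; destruct (HS z Hz) as (_ & [M HM] & _).
  destruct (sol_continuous d g rho X DX z 1 HS Hz Rlt_0_1) as (delta & Hd & H).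
  exists (1 + M), (Rmin delta (rho - Cmod z)); split; [apply Rmin_glb_lt; lra|].
  intros w Hw.
  assert (Hw1 := Rlt_le_trans _ _ _ Hw (Rmin_l _ _)).
  assert (Hw2 := Rlt_le_trans _ _ _ Hw (Rmin_r _ _)).
  assert (Hzw : Cmod (Cplus z w) < rho) by (eapply Rle_lt_trans; [apply Cmod_triangle|lra]).
  split; auto.
  refine (l2b_plus _ _ _ _ _ _ (H w Hw1 Hzw) HM); intros k c.
  eapply Rle_trans; [|apply Cmod_triangle]; apply Req_le; f_equal; ring.
Qed.

(** The difference of two solutions agreeing at [z1] vanishes to infinite order there: order [n]
    in mean square gives order [n + 1] mode by mode through the equation, and the Schwarz lemma
    turns this back into order [n + 1] in mean square, with the same constant. *)
Lemma sol_locally_unique d g rho X DX Y DY z1 : 0 <= g -> sol d g rho X DX -> sol d g rho Y DY ->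
  Cmod z1 < rho -> (forall k c, X z1 k c = Y z1 k c) ->
  exists delta, 0 < delta /\ forall w, Cmod w <= delta -> forall k c,
    X (Cplus z1 w) k c = Y (Cplus z1 w) k c.
Proof.
  intros Hg HX HY Hz1 HE.
  destruct (sol_local_bound _ _ _ _ _ _ HX Hz1) as (M1 & d1 & Hd1 & B1).
  destruct (sol_local_bound _ _ _ _ _ _ HY Hz1) as (M2 & d2 & Hd2 & B2).
  set (t := Rmin d1 d2 / 4).
  assert (Ht : 0 < t) by (assert (0 < Rmin d1 d2) by (apply Rmin_glb_lt; auto); unfold t; lra).
  set (M := M1 + M2).
  assert (HM12 : 0 <= M1 /\ 0 <= M2).
  { assert (Z : Cmod (RtoC 0) < d1 /\ Cmod (RtoC 0) < d2) by (rewrite Cmod_0; auto).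
    split; [apply (B1 _ (proj1 Z))|apply (B2 _ (proj2 Z))]. }
  assert (BX : forall w, Cmod w < 4 * t -> Cmod (Cplus z1 w) < rho /\ l2b (X (Cplus z1 w)) M).
  { intros w Hw; destruct (B1 w) as [A1 A2]; [assert (A := Rmin_l d1 d2); unfold t in Hw; lra|].
    split; auto; apply (l2b_mono _ M1); auto; unfold M; lra. }
  assert (BY : forall w, Cmod w < 4 * t -> Cmod (Cplus z1 w) < rho /\ l2b (Y (Cplus z1 w)) M).
  { intros w Hw; destruct (B2 w) as [A1 A2]; [assert (A := Rmin_r d1 d2); unfold t in Hw; lra|].
    split; auto; apply (l2b_mono _ M2); auto; unfold M; lra. }
  assert (HM : 0 <= M) by (unfold M; lra).
  set (W := fun (p : Vec * nat) w =>
    Cminus (X (Cplus z1 w) (fst p) (snd p)) (Y (Cplus z1 w) (fst p) (snd p))).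
  set (DW := fun (p : Vec * nat) w =>
    Cminus (DX (Cplus z1 w) (fst p) (snd p)) (DY (Cplus z1 w) (fst p) (snd p))).
  assert (HW : forall p, holo (W p) (DW p) (4 * t)).
  { intros p z Hz; split.
    - apply cderiv_minus.
      + now apply (sol_mode_holo d g rho X DX z1 (4 * t) M).
      + now apply (sol_mode_holo d g rho Y DY z1 (4 * t) M).
    - apply ccont_minus.
      + now apply (sol_mode_holo d g rho X DX z1 (4 * t) M).
      + now apply (sol_mode_holo d g rho Y DY z1 (4 * t) M). }
  assert (W0 : forall p, W p (RtoC 0) = RtoC 0).
  { intros p; unfold W; rewrite Cplus_0_r, HE; ring. }
  set (WF := fun w k c => Cminus (X (Cplus z1 w) k c) (Y (Cplus z1 w) k c)).
  assert (W2 : forall w, Cmod w < 4 * t -> l2b (WF w) (2 * M)).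
  { intros w Hw; replace (2 * M) with (M + M) by ring.
    refine (l2b_plus _ _ _ _ _ _ (proj2 (BX w Hw)) (proj2 (BY w Hw))); intros k c; unfold WF,
      Cminus.
    rewrite <- (Cmod_opp (Y _ k c)); apply Cmod_triangle. }
  (* [4 * M] is what the Schwarz lemma returns from the a priori bound [2 * M], whatever [n]. The
     constants [K p], which depend on the mode and on [n], serve only to establish the order of
     vanishing. *)
  assert (V : forall n w, Cmod w <= t / 2 -> l2b (WF w) (4 * M * (Cmod w / t) ^ n)).
  { induction n as [|n IH]; intros z0 Hz0.
    - simpl; rewrite Rmult_1_r; apply (l2b_mono _ (2 * M)); [lra|apply W2; lra].
    - set (q := Cmod z0 / t).
      assert (Hq : 0 <= q).
      { unfold q; apply Rmult_le_pos; [apply Cmod_ge_0|now apply Rlt_le, Rinv_0_lt_compat]. }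
      set (K := fun p : Vec * nat => rate d g (fst p) M * (4 * M * (/ t) ^ n)).
      assert (HK : forall p, 0 <= K p).
      { intros p; unfold K; apply Rmult_le_pos; [now apply rate_nonneg|].
        apply Rmult_le_pos; [lra|]; apply pow_le, Rlt_le, Rinv_0_lt_compat, Ht. }
      assert (HO : forall p w, Cmod w <= t / 2 -> Cmod (W p w) <= K p * Cmod w ^ S n).
      { intros p w Hw.
        replace (K p * Cmod w ^ S n) with (K p * Cmod w ^ n * Cmod w) by (simpl; ring).
        apply (complex_mean_value (W p) (DW p) (4 * t)); auto; [lra|].
        intros s Hs.
        assert (Hsw : Cmod (Cmult (RtoC s) w) <= Cmod w).
        { rewrite Cmod_mult, Cmod_R, Rabs_right by lra; assert (A := Cmod_ge_0 w); nra. }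
        assert (Hsw4 : Cmod (Cmult (RtoC s) w) < 4 * t) by lra.
        eapply Rle_trans; [apply (evolves_diff d g _ _ _ _ M _ (fst p) (snd p) Hg
          (proj1 (HX _ (proj1 (BX _ Hsw4)))) (proj1 (HY _ (proj1 (BY _ Hsw4))))
          (proj2 (BX _ Hsw4)) (proj2 (BY _ Hsw4)) (IH (Cmult (RtoC s) w)
            (Rle_trans _ _ _ Hsw Hw)))|].
        replace (K p * Cmod w ^ n) with (rate d g (fst p) M * (4 * M * ((/ t) ^ n * Cmod w ^ n)))
          by (unfold K; ring).
        apply Rmult_le_compat_l; [now apply rate_nonneg|]; apply Rmult_le_compat_l; [lra|].
        rewrite <- Rpow_mult_distr; apply pow_incr; split.
        - apply Rmult_le_pos; [apply Cmod_ge_0|now apply Rlt_le, Rinv_0_lt_compat].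
        - unfold Rdiv; rewrite (Rmult_comm (/ t)); apply Rmult_le_compat_r; auto.
          now apply Rlt_le, Rinv_0_lt_compat. }
      split; [apply Rmult_le_pos; [lra|now apply pow_le]|]; intros l Hl.
      change (sumR l (fun p => Cmod (WF z0 (fst p) (snd p)) ^ 2)) with
        (sumR l (fun p => Cmod (W p z0) ^ 2)).
      set (S2 := sumR l (fun p => Cmod (W p z0) ^ 2)).
      assert (HS2 : 0 <= S2) by (apply sumR_nonneg; intros; apply pow2_ge_0).
      (* Duality: [F z0 = S2], while Cauchy-Schwarz gives [|F| <= sqrt S2 * 2 * M] on the larger
         disk. Dividing the resulting estimate by [sqrt S2] leaves the l^2 bound on the modes in
         [l]. *)
      set (F := fun w => sumC l (fun p => Cmult (Cconj (W p z0)) (W p w))).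
      assert (HF : holo F (fun w => sumC l (fun p => Cmult (Cconj (W p z0)) (DW p w))) (4 * t)).
      { now apply holo_sumC. }
      assert (EF : Cmod (F z0) = S2).
      { unfold F; rewrite (sumC_ext l _ (fun p => RtoC (Cmod (W p z0) ^ 2))).
        - rewrite sumC_parts; simpl.
          rewrite (sumR_zero l (fun _ => 0)) by easy; fold S2.
          change (Cmod (RtoC S2) = S2); rewrite Cmod_R; apply Rabs_right; lra.
        - intros p _; rewrite Cmod_sq; unfold Re, Im, RtoC; destruct (W p z0) as [x y].
          unfold Cmult; simpl; f_equal; ring. }
      assert (SQ : sqrt S2 ^ 2 = S2) by now apply pow2_sqrt.
      assert (FO : forall w, Cmod w <= t / 2 ->
        Cmod (F w) <= sumR l (fun p => Cmod (W p z0) * K p) * Cmod w ^ S n).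
      { intros w Hw; unfold F; eapply Rle_trans; [apply Cmod_sumC|].
        rewrite Rmult_comm, <- sumR_scal; apply sumR_le; intros p _.
        rewrite Cmod_mult, Cmod_conj; specialize (HO p w Hw).
        assert (A := Cmod_ge_0 (W p z0)).
        replace (Cmod w ^ S n * (Cmod (W p z0) * K p)) with (Cmod (W p z0) *
          (K p * Cmod w ^ S n)) by ring.
        now apply Rmult_le_compat_l. }
      assert (FM : forall w, Cmod w <= t -> Cmod (F w) <= sqrt S2 * (2 * M)).
      { intros w Hw; unfold F; eapply Rle_trans; [apply Cmod_sumC|].
        rewrite (sumR_ext l _ (fun p => Cmod (W p z0) * Cmod (W p w)))
          by (intros; now rewrite Cmod_mult, Cmod_conj).
        apply cauchy_schwarz_sqrt; [apply sqrt_pos|lra| |].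
        - rewrite SQ; apply Rle_refl.
        - apply (W2 w); auto; lra. }
      assert (A := schwarz F _ t _ _ n z0 Ht HF
        (sumR_nonneg l _ (fun p _ => Rmult_le_pos _ _ (Cmod_ge_0 _) (HK p))) FO FM Hz0).
      rewrite EF in A; fold q in A.
      assert (SP := sqrt_pos S2).
      assert (Q : 0 <= 4 * M * q ^ S n) by (apply Rmult_le_pos; [lra|now apply pow_le]).
      destruct (Req_dec (sqrt S2) 0) as [Z|Z].
      + rewrite <- SQ, Z; replace (0 ^ 2) with 0 by ring; apply pow2_ge_0.
      + rewrite <- SQ; apply pow_incr; split; auto.
        apply Rmult_le_reg_l with (sqrt S2); [lra|].
        replace (sqrt S2 * sqrt S2) with (sqrt S2 ^ 2) by ring; rewrite SQ; lra. }
  exists (t / 2); split; [lra|]; intros w Hw k c.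
  apply Cmod_small_eq; intros eps He.
  destruct (pow_half_small (4 * M) eps He) as [N HN].
  eapply Rle_trans; [apply (l2b_point _ _ k c (V N w Hw))|].
  eapply Rle_trans; [|exact HN]; apply Rmult_le_compat_l; [lra|].
  apply pow_incr; split.
  - apply Rmult_le_pos; [apply Cmod_ge_0|now apply Rlt_le, Rinv_0_lt_compat].
  - apply Rmult_le_reg_r with t; auto; unfold Rdiv; rewrite Rmult_assoc, Rinv_l; lra.
Qed.

Lemma sol_unique d g rho X DX Y DY : 0 <= g -> sol d g rho X DX -> sol d g rho Y DY ->
  (forall k c, X (RtoC 0) k c = Y (RtoC 0) k c) ->
  forall z, Cmod z < rho -> forall k c, X z k c = Y z k c.
Proof.
  intros Hg HX HY H0 z Hz.
  set (P := fun s => 0 <= s <= 1 /\ forall u, 0 <= u <= s -> forall k c,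
    X (Cmult (RtoC u) z) k c = Y (Cmult (RtoC u) z) k c).
  assert (P0 : P 0).
  { split; [lra|]; intros u Hu k c; replace u with 0 by lra; now rewrite Cmult_0_l. }
  destruct (completeness P) as [S [HS1 HS2]].
  { exists 1; intros s [Hs _]; lra. }
  { now exists 0. }
  assert (S0 : 0 <= S) by now apply HS1.
  assert (S1 : S <= 1) by (apply HS2; intros s [Hs _]; lra).
  assert (Hin : forall u, 0 <= u <= 1 -> Cmod (Cmult (RtoC u) z) < rho).
  { intros u Hu; rewrite Cmod_mult, Cmod_R, Rabs_right by lra.
    assert (A := Cmod_ge_0 z); nra. }
  assert (Hlt : forall u, 0 <= u < S -> forall k c,
    X (Cmult (RtoC u) z) k c = Y (Cmult (RtoC u) z) k c).
  { intros u Hu; apply NNPP; intros Hn.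
    assert (S <= u); [|lra].
    apply HS2; intros s [Hs Hs']; apply Rnot_lt_le; intros Hus; apply Hn, Hs'; lra. }
  assert (HSe : forall k c, X (Cmult (RtoC S) z) k c = Y (Cmult (RtoC S) z) k c).
  { destruct (Req_dec S 0) as [E|E].
    - intros k c; rewrite E, Cmult_0_l; apply H0.
    - intros k c; apply Cmod_small_eq; intros eps He.
      destruct (sol_continuous d g rho X DX (Cmult (RtoC S) z) (eps / 2) HX) as (d1 & Hd1 & C1);
        [now apply Hin|lra|].
      destruct (sol_continuous d g rho Y DY (Cmult (RtoC S) z) (eps / 2) HY) as (d2 & Hd2 & C2);
        [now apply Hin|lra|].
      set (dl := Rmin (Rmin d1 d2) S).
      assert (Hdl : 0 < dl) by (repeat apply Rmin_glb_lt; lra).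
      assert (D1 := Rmin_l (Rmin d1 d2) S); assert (D2 := Rmin_r (Rmin d1 d2) S).
      assert (D3 := Rmin_l d1 d2); assert (D4 := Rmin_r d1 d2).
      assert (A := Cmod_ge_0 z).
      (* Small enough both to keep [S - e] nonnegative, because [dl <= S], and to stay within the
         radius of continuity. *)
      set (e := dl / (2 * (Cmod z + 1))).
      assert (He0 : 0 < e) by (apply Rdiv_lt_0_compat; lra).
      assert (He1 : e * (Cmod z + 1) = dl / 2) by (unfold e; field; lra).
      set (u := S - e).
      assert (Hu : 0 <= u < S) by (unfold u; fold dl in D2; nra).
      set (h := Cmult (RtoC (- e)) z).
      assert (Eh : Cplus (Cmult (RtoC S) z) h = Cmult (RtoC u) z).
      { unfold h, u; rewrite RtoC_minus, RtoC_opp; ring. }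
      assert (Hh : Cmod h < dl).
      { unfold h; rewrite Cmod_mult, Cmod_R, Rabs_Ropp, Rabs_right by lra; nra. }
      assert (Hu1 : Cmod (Cmult (RtoC u) z) < rho) by (apply Hin; lra).
      specialize (C1 h); specialize (C2 h); rewrite Eh in C1, C2.
      fold dl in D1, D2.
      assert (A1 := l2b_point _ _ k c (C1 ltac:(lra) Hu1)).
      assert (A2 := l2b_point _ _ k c (C2 ltac:(lra) Hu1)); cbv beta in A1, A2.
      rewrite (Hlt u Hu k c) in A1.
      assert (T := Cmod_triangle3 (X (Cmult (RtoC S) z) k c) (Y (Cmult (RtoC u) z) k c)
         (Y (Cmult (RtoC S) z) k c)).
      rewrite (Cmod_minus_sym (X (Cmult (RtoC S) z) k c) (Y (Cmult (RtoC u) z) k c)) in T.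
      lra. }
  destruct (Rlt_le_dec S 1) as [HSlt|HSge].
  - exfalso.
    destruct (sol_locally_unique d g rho X DX Y DY (Cmult (RtoC S) z) Hg HX HY (Hin S
      (conj S0 S1)) HSe)
      as (delta & Hd & HU).
    assert (A := Cmod_ge_0 z).
    set (e := Rmin (delta / (Cmod z + 1)) (1 - S)).
    assert (He : 0 < e) by (apply Rmin_glb_lt; [apply Rdiv_lt_0_compat|]; lra).
    assert (E1 : e <= delta / (Cmod z + 1)) by apply Rmin_l.
    assert (E2 : e <= 1 - S) by apply Rmin_r.
    assert (E3 : e * (Cmod z + 1) <= delta).
    { apply Rmult_le_compat_r with (r := Cmod z + 1) in E1; [|lra].
      replace (delta / (Cmod z + 1) * (Cmod z + 1)) with delta in E1 by (field; lra); lra. }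
    assert (PS : P (S + e)).
    { split; [lra|]; intros u Hu k c.
      destruct (Rlt_le_dec u S) as [HuS|HuS]; [apply Hlt; lra|].
      replace (Cmult (RtoC u) z) with (Cplus (Cmult (RtoC S) z) (Cmult (RtoC (u - S)) z))
        by (rewrite RtoC_minus; ring).
      apply HU; rewrite Cmod_mult, Cmod_R, Rabs_right by lra; nra. }
    assert (S + e <= S) by now apply HS1. lra.
  - assert (E : S = 1) by lra; intros k c.
    specialize (HSe k c); rewrite E, Cmult_1_l in HSe; exact HSe.
Qed.

(** * From the stated system to the formulation by states *)

Lemma wpartial_one_bound d u : wfinite d (fun _ => 1) u -> exists M, 0 <= M /\
  forall N, wpartial d (fun _ => 1) u N <= M.
Proof.
  intros [M' H]; exists (Rabs M'); split; [apply Rabs_pos|]; intros N.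
  eapply Rle_trans; [apply H|apply Rle_abs].
Qed.

Lemma bouss_sol_sol d r g rho u0 eta0 U E : bouss_sol d r g rho u0 eta0 U E ->
  exists DX, sol d g rho (fun z => st d (U z) (E z)) DX.
Proof.
  intros (_ & _ & H).
  (* The derivative is known to exist separately at each point; isolating its properties in [Q]
     allows it to be chosen as a function of [z]. *)
  set (Q := fun z DX => evolves d g (st d (U z) (E z)) DX /\
    forall eps, 0 < eps -> exists delta, 0 < delta /\
      forall h, 0 < Cmod h < delta -> Cmod (Cplus z h) < rho ->
        l2b (fun k c => Cminus (Cdiv (Cminus (st d (U (Cplus z h)) (E (Cplus z h)) k c)
          (st d (U z) (E z) k c)) h) (DX k c)) eps).
  assert (HQ : forall z, Cmod z < rho -> exists DX, Q z DX).
  { intros z Hz; destruct (H z Hz) as (HU & HE & _ & DU & DE & HD & Heq).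
    exists (st d DU DE); split; [split; [now apply st_is_state|split]|].
    - intros; now apply st_out.
    - intros k Hk; destruct (Heq k Hk) as (b & c & Hb & Hc & E1 & E2).
      exists (fun i => if Nat.eqb i d then c else b i); split.
      + intros i Hi; destruct (Nat.eqb_spec i d) as [->|Hid].
        * replace (advt d _ _ k d) with (adv_term_s d (U z) (E z) k); auto.
          apply functional_extensionality; intros j; now apply adv_term_s_st.
        * replace (advt d _ _ k i) with (adv_term_v d (U z) (U z) k i); [apply Hb; lia|].
          apply functional_extensionality; intros j; apply adv_term_v_st; auto; lia.
      + intros i Hi; unfold rhs; destruct (Nat.ltb_spec i d) as [Hid|Hid].
        * rewrite st_vel, E1, st_scal by auto; do 2 f_equal.
          apply leray_ext; auto; intros m Hm; destruct (Nat.eqb_spec m d); [lia|easy].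
        * replace i with d by lia; rewrite st_scal, Nat.eqb_refl by auto; apply E2.
    (* The hypothesis bounds squared norms of velocity and scalar separately, so half of [eps ^ 2]
       goes to each. *)
    - intros eps He; destruct (HD (eps ^ 2 / 2)) as (delta & Hd & Hh).
      { assert (0 < eps ^ 2) by (now apply pow_lt); lra. }
      exists delta; split; auto; intros h Hh1 Hzh; specialize (Hh h Hh1 Hzh).
      assert (L : l2b (st d (dq_v U z h DU) (dq_s E z h DE)) eps).
      { apply (l2b_st d _ _ (eps ^ 2 / 2) (eps ^ 2 / 2)); try lra; intros N; apply Hh. }
      replace eps with (1 * eps) by ring; refine (l2b_dom _ _ 1 _ _ _ L); [lra|].
      intros k c; rewrite Rmult_1_l; apply Req_le; f_equal; unfold st, dq_v, dq_s.
      destruct (validb d k); [|unfold Cdiv; ring].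
      destruct (Nat.ltb c d); auto; destruct (Nat.eqb c d); auto; unfold Cdiv; ring. }
  exists (fun z => epsilon (inhabits (fun _ _ => RtoC 0)) (Q z)); intros z Hz.
  destruct (epsilon_spec (inhabits (fun (_ : Vec) (_ : nat) => RtoC 0)) (Q z) (HQ z Hz)) as [Q1 Q2].
  split; [exact Q1|split; [|exact Q2]].
  destruct (H z Hz) as (HU & HE & _).
  destruct (wpartial_one_bound d (vsq d (U z))) as (A & HA0 & HA); [apply HU|].
  destruct (wpartial_one_bound d (ssq (E z))) as (B & HB0 & HB); [apply HE|].
  exists (A + B + 1); apply (l2b_st d _ _ A B); auto; [lra|nra].
Qed.

Lemma bouss_sol_unique d r g rho u0 eta0 U E U' E' : 0 <= g ->
  bouss_sol d r g rho u0 eta0 U E -> bouss_sol d r g rho u0 eta0 U' E' ->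
  forall z, Cmod z < rho -> (forall k i, U' z k i = U z k i) /\ (forall k, E' z k = E z k).
Proof.
  intros Hg H H' z Hz.
  destruct (bouss_sol_sol _ _ _ _ _ _ _ _ H) as [DX HX].
  destruct (bouss_sol_sol _ _ _ _ _ _ _ _ H') as [DX' HX'].
  assert (Hu := sol_unique d g rho _ _ _ _ Hg HX' HX).
  destruct H as (H1 & H2 & H), H' as (H1' & H2' & H').
  assert (Hst : forall k c, st d (U' z) (E' z) k c = st d (U z) (E z) k c).
  { apply Hu; auto; intros k c; unfold st; rewrite H1, H1', H2, H2'; easy. }
  destruct (H z Hz) as (HU & HE & _); destruct (H' z Hz) as (HU' & HE' & _).
  split.
  - intros k i; destruct (Nat.lt_ge_cases i d) as [Hi|Hi].
    + specialize (Hst k i); now rewrite !inH_vel in Hst.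
    + destruct HU as [HU _], HU' as [HU' _]; rewrite HU, HU'; auto; intros [_ ?]; lia.
  - intros k; specialize (Hst k d); now rewrite !inS_scal in Hst.
Qed.

(** * Taylor coefficients in the complex time *)

Fixpoint hist {T} (x0 : T) (F : nat -> (nat -> T) -> T) (n : nat) : nat -> T :=
  match n with
  | O => fun _ => x0
  | S n' => fun i => if Nat.leb i n' then hist x0 F n' i else F n' (hist x0 F n')
  end.

Definition cov {T} (x0 : T) (F : nat -> (nat -> T) -> T) (n : nat) : T := hist x0 F n n.

Lemma hist_cov {T} (x0 : T) F n i : (i <= n)%nat -> hist x0 F n i = cov x0 F i.
Proof.
  intros H; induction n as [|n IH].
  - replace i with O by lia; easy.
  - destruct (Nat.eq_dec i (S n)) as [->|Hi]; [easy|].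
    simpl; destruct (Nat.leb_spec i n); [apply IH; lia|lia].
Qed.

Lemma cov_S {T} (x0 : T) F n :
  (forall H H', (forall i, (i <= n)%nat -> H i = H' i) -> F n H = F n H') ->
  cov x0 F (S n) = F n (cov x0 F).
Proof.
  intros HF; unfold cov at 1; cbn [hist]; destruct (Nat.leb_spec (S n) n); [lia|].
  apply HF; intros; now apply hist_cov.
Qed.

(** The sum over [j] of the terms [advt], with [k_m] taken out of the series. *)
Definition bil (d : nat) (X Y : VField) (k : Vec) (c : nat) : C :=
  Cmult Ci (sumC_lt d (fun m => Cmult (RtoC (IZR (k m)))
    (tsum (fun j => Cmult (X j m) (Y (vsub k j) c))))).

Definition bil_sum (d : nat) (W : nat -> VField) (n : nat) (k : Vec) (c : nat) : C :=
  sumC (seq 0 (S n)) (fun i => bil d (W i) (W (n - i)%nat) k c).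

(** Comparison of the coefficients of [zeta^n] in the equation; that of the derivative is
    [(n + 1) W_(n+1)], hence the division. *)
Definition step (d : nat) (g : R) (n : nat) (W : nat -> VField) : VField :=
  fun k c => if andb (validb d k) (Nat.leb c d) then
    Cmult (RtoC (/ INR (S n))) (rhs d g k (bil_sum d W n k) (W n k d) c)
  else RtoC 0.

Definition taylor (d : nat) (g : R) (X0 : VField) : nat -> VField := cov X0 (step d g).

Lemma taylor_S d g X0 n : taylor d g X0 (S n) = step d g n (taylor d g X0).
Proof.
  apply cov_S; intros H H' HH.
  apply functional_extensionality; intros k; apply functional_extensionality; intros c.
  unfold step; rewrite (HH n) by lia.
  replace (bil_sum d H n k) with (bil_sum d H' n k); auto.
  apply functional_extensionality; intros c'; apply sumC_ext; intros i Hi; apply in_seq in Hi.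
  rewrite !HH by lia; auto.
Qed.

Lemma leray_divfree d k w :
  sumC_lt d (fun i => Cmult (RtoC (IZR (k i))) (leray d k w i)) = RtoC 0.
Proof.
  unfold leray; destruct (Rle_dec (knorm d k) 0) as [H|H].
  - unfold sumC_lt; apply sumC_zero; intros; ring.
  - assert (P : 0 < knorm d k ^ 2) by (apply pow_lt; lra).
    assert (Pn : RtoC (knorm d k ^ 2) <> RtoC 0) by (intros E; apply RtoC_inj in E; lra).
    set (s := sumC_lt d (fun m => Cmult (RtoC (IZR (k m))) (w m))).
    transitivity (sumC_lt d (fun i => Cminus (Cmult (RtoC (IZR (k i))) (w i))
       (Cmult (Cdiv s (RtoC (knorm d k ^ 2))) (RtoC (IZR (k i) ^ 2))))).
    + apply sumC_lt_ext; intros i _;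
      replace (RtoC (IZR (k i) ^ 2)) with (Cmult (RtoC (IZR (k i))) (RtoC (IZR (k i))))
        by (rewrite <- RtoC_mult; f_equal; ring).
      fold s; field; auto.
    + unfold sumC_lt; rewrite sumC_minus, sumC_scal; fold (sumC_lt d (fun m =>
      Cmult (RtoC (IZR (k m))) (w m))).
      fold s.
      assert (E : sumC (seq 0 d) (fun a => RtoC (IZR (k a) ^ 2)) = RtoC (knorm d k ^ 2)).
      { rewrite sumC_parts, knorm_sq; unfold sum_lt, RtoC; simpl; f_equal; now apply sumR_zero. }
      rewrite E; field; auto.
Qed.

Lemma leray_zerok d w i : leray d zerok w i = RtoC 0.
Proof. unfold leray; rewrite knorm_zero; destruct (Rle_dec 0 0); [easy|lra]. Qed.

Lemma taylor_is_state d g X0 n : is_state d X0 -> is_state d (taylor d g X0 n).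
Proof.
  intros HX; destruct n as [|n]; [exact HX|]; rewrite taylor_S.
  set (W := taylor d g X0); split; [|split].
  - intros k c H; unfold step; destruct (validb d k) eqn:E1; auto.
    apply validb_spec in E1; destruct (Nat.leb_spec c d); [|easy]; tauto.
  - intros c; unfold step; destruct (andb _ _); auto; unfold rhs.
    destruct (Nat.ltb_spec c d).
    + rewrite !leray_zerok; ring.
    (* In divergence form every advection term carries a factor [k], so the mean of the scalar stays
       zero. *)
    + unfold bil_sum; rewrite sumC_zero; [ring|]; intros i _; unfold bil, sumC_lt.
      rewrite sumC_zero; [ring|]; intros m _; unfold zerok at 1; ring.
  - intros k; unfold step; destruct (validb d k) eqn:E1.
    + rewrite (sumC_lt_ext d _ (fun i => Cmult (RtoC (/ INR (S n)))
        (Cplus (Cmult (Copp (RtoC 1)) (Cmult (RtoC (IZR (k i))) (leray d k (bil_sum d W n k) i)))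
          (Cmult (RtoC g) (Cmult (RtoC (IZR (k i)))
             (leray d k (fun m => Cmult (W n k d) (RtoC (upvec d m))) i)))))).
      * assert (A := leray_divfree d k (bil_sum d W n k)).
        assert (B := leray_divfree d k (fun m => Cmult (W n k d) (RtoC (upvec d m)))).
        unfold sumC_lt in *; rewrite !sumC_scal, sumC_plus, !sumC_scal, A, B; ring.
      * intros i Hi; unfold rhs; destruct (Nat.ltb_spec i d); [|lia].
        destruct (Nat.leb_spec i d); [|lia]; simpl andb; cbv iota; ring.
    + unfold sumC_lt; apply sumC_zero; intros; simpl; ring.
Qed.

(** * Size of the coefficients *)

(** The scalar is weighted by 64 so that buoyancy, which feeds the scalar into the velocity
    without loss of derivative, is a small perturbation as long as [g * |zeta| <= 2]. *)
Definition wt (d c : nat) : R := if Nat.ltb c d then 1 else 64.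

Definition sz (d : nat) (X : VField) (k : Vec) : R :=
  sumR (seq 0 (S d)) (fun c => wt d c * Cmod (X k c)).

Lemma wt_ge_1 d c : 1 <= wt d c.
Proof. unfold wt; destruct (Nat.ltb c d); lra. Qed.

Lemma wt_Cmod_nonneg d c x : 0 <= wt d c * Cmod x.
Proof. apply Rmult_le_pos; [assert (H := wt_ge_1 d c); lra|apply Cmod_ge_0]. Qed.

Lemma sz_nonneg d X k : 0 <= sz d X k.
Proof. apply sumR_nonneg; intros; apply wt_Cmod_nonneg. Qed.

Lemma wt_Cmod_le_sz d X k c : (c <= d)%nat -> wt d c * Cmod (X k c) <= sz d X k.
Proof.
  intros H; apply (sumR_in_le (seq 0 (S d)) (fun c => wt d c * Cmod (X k c))).
  - intros; apply wt_Cmod_nonneg.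
  - apply in_seq; lia.
Qed.

Lemma Cmod_le_sz d X k c : (c <= d)%nat -> Cmod (X k c) <= sz d X k.
Proof.
  intros H; eapply Rle_trans; [|now apply (wt_Cmod_le_sz d X k c)].
  rewrite <- (Rmult_1_l (Cmod (X k c))) at 1.
  apply Rmult_le_compat_r; [apply Cmod_ge_0|apply wt_ge_1].
Qed.

Lemma sumR_seq_split d f : sumR (seq 0 (S d)) f = sumR (seq 0 d) f + f d.
Proof. rewrite seq_S, sumR_app; unfold sumR at 2; simpl; lra. Qed.

Lemma sumR_vel_le_sz d X k : sumR (seq 0 d) (fun m => Cmod (X k m)) <= sz d X k.
Proof.
  unfold sz; rewrite sumR_seq_split.
  assert (H := wt_Cmod_nonneg d d (X k d)).
  assert (sumR (seq 0 d) (fun m => Cmod (X k m)) <= sumR (seq 0 d) (fun c =>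
    wt d c * Cmod (X k c))).
  { apply sumR_le; intros c _; assert (A := Cmod_ge_0 (X k c)); assert (B := wt_ge_1 d c); nra. }
  lra.
Qed.

Lemma RS_scal {A} (f : A -> R) a M : 0 < a -> bsum f M -> a * RS f <= RS (fun x => a * f x).
Proof.
  intros Ha HM.
  assert (B := bsum_scal f a M (Rlt_le _ _ Ha) HM).
  apply Rmult_le_reg_l with (/ a); [now apply Rinv_0_lt_compat|].
  rewrite <- Rmult_assoc, Rinv_l, Rmult_1_l by lra.
  apply RS_le; intros l Hl; apply Rmult_le_reg_l with a; auto.
  rewrite <- Rmult_assoc, Rinv_r, Rmult_1_l by lra.
  rewrite <- sumR_scal; now apply (RS_ub _ _ B).
Qed.

(** The advecting component [m] and the transported component [c] vary independently, so for each
    [j] the sum over pairs factors into sizes. The weight follows the transported component, and is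
    thus compatible with advection. *)
Lemma sz_bil d X Y M N k : bsum (sz d X) M -> bsum (sz d Y) N ->
  sumR (seq 0 (S d)) (fun c => wt d c * Cmod (bil d X Y k c)) <=
  knorm d k * RS (fun j => sz d X j * sz d Y (vsub k j)).
Proof.
  intros HM HN.
  set (F := fun (p : nat * nat) j =>
    Cmod (X j (fst p)) * (wt d (snd p) * Cmod (Y (vsub k j) (snd p)))).
  assert (HF : forall p j, 0 <= F p j).
  { intros; apply Rmult_le_pos; [apply Cmod_ge_0|apply wt_Cmod_nonneg]. }
  set (L := list_prod (seq 0 d) (seq 0 (S d))).
  assert (BC : bsum (fun j => sz d X j * sz d Y (vsub k j)) (M * N)).
  { apply bsum_conv; auto using sz_nonneg. }
  assert (HFs : forall j, sumR L (fun p => F p j) <= sz d X j * sz d Y (vsub k j)).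
  { intros j; unfold L; rewrite sumR_list_prod; unfold F; simpl fst; simpl snd.
    rewrite <- sumR_mult; apply Rmult_le_compat.
    - apply sumR_nonneg; intros; apply Cmod_ge_0.
    - apply sumR_nonneg; intros; apply wt_Cmod_nonneg.
    - apply sumR_vel_le_sz.
    - apply Rle_refl. }
  assert (BF : forall p, In p L -> bsum (F p) (M * N)).
  { intros p Hp; apply (bsum_le _ (fun j => sz d X j * sz d Y (vsub k j))); auto.
    intros j; eapply Rle_trans; [|apply HFs].
    apply (sumR_in_le L (fun p => F p j)); auto. }
  apply Rle_trans with (knorm d k * sumR L (fun p => RS (F p))).
  - rewrite <- sumR_scal; unfold L; rewrite sumR_list_prod, sumR_exchange.
    apply sumR_le; intros c Hc.
    assert (Hw := wt_ge_1 d c).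
    unfold bil; rewrite Cmod_mult, Cmod_Ci, Rmult_1_l.
    apply Rle_trans with (wt d c * sumR (seq 0 d) (fun m => Cmod (Cmult (RtoC (IZR (k m)))
       (tsum (fun j => Cmult (X j m) (Y (vsub k j) c)))))).
    { apply Rmult_le_compat_l; [lra|apply Cmod_sumC]. }
    rewrite <- sumR_scal; apply sumR_le; intros m Hm.
    assert (Hp : In (m, c) L) by now apply in_prod.
    apply in_seq in Hm.
    assert (Bm : bsum (fun j => Cmod (Cmult (X j m) (Y (vsub k j) c))) (M * N)).
    { apply (bsum_le _ (F (m, c))); auto; intros j; unfold F; simpl; rewrite Cmod_mult.
      apply Rmult_le_compat_l; [apply Cmod_ge_0|].
      assert (A := Cmod_ge_0 (Y (vsub k j) c)); nra. }
    rewrite Cmod_mult, Cmod_R.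
    apply Rle_trans with (knorm d k * (wt d c * RS (fun j =>
      Cmod (Cmult (X j m) (Y (vsub k j) c))))).
    + replace (wt d c * (Rabs (IZR (k m)) * _)) with (Rabs (IZR (k m)) *
        (wt d c * Cmod (tsum (fun j => Cmult (X j m) (Y (vsub k j) c))))) by ring.
      apply Rmult_le_compat.
      * apply Rabs_pos.
      * apply wt_Cmod_nonneg.
      * apply coord_le_knorm; lia.
      * apply Rmult_le_compat_l; [lra|now apply (Cmod_tsum _ (M * N))].
    + apply Rmult_le_compat_l; [apply knorm_pos|].
      eapply Rle_trans; [apply (RS_scal _ _ (M * N)); [lra|exact Bm]|].
      apply Req_le; f_equal; apply functional_extensionality; intros j; unfold F; simpl.
      rewrite Cmod_mult; ring.
  - apply Rmult_le_compat_l; [apply knorm_pos|].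
    eapply Rle_trans; [apply (sumR_RS_sum L F (fun _ => M * N)); auto|].
    now apply (RS_mono _ _ (M * N)).
Qed.

(** The projection costs [d + 1] in component sums. The vertical direction has a single nonzero
    entry, so the buoyancy term has total size [g * |e|] before projection, and the weighted scalar
    part passes with factor 1. *)
Lemma sz_rhs d g k b e : 0 <= g ->
  sumR (seq 0 (S d)) (fun c => wt d c * Cmod (rhs d g k b e c)) <=
  INR (S d) * (sumR (seq 0 (S d)) (fun c => wt d c * Cmod (b c)) + g * Cmod e).
Proof.
  intros Hg; rewrite !sumR_seq_split.
  assert (E1 : wt d d = 64) by (unfold wt; destruct (Nat.ltb_spec d d); [lia|easy]).
  assert (E2 : rhs d g k b e d = Copp (b d)).
  { unfold rhs; destruct (Nat.ltb_spec d d); [lia|easy]. }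
  rewrite E1, E2, Cmod_opp.
  set (sb := sumR (seq 0 d) (fun m => Cmod (b m))).
  assert (Hsb : sumR (seq 0 d) (fun c => wt d c * Cmod (b c)) = sb).
  { apply sumR_ext; intros c Hc; apply in_seq in Hc; unfold wt.
    destruct (Nat.ltb_spec c d); [lra|lia]. }
  rewrite Hsb.
  assert (He0 := Cmod_ge_0 e).
  assert (Hup : sumR (seq 0 d) (fun m => Cmod (Cmult e (RtoC (upvec d m)))) <= Cmod e).
  { rewrite (sumR_ext _ _ (fun m => Cmod e * (if Nat.eqb m (d - 1) then 1 else 0))).
    - rewrite sumR_scal; rewrite <- (Rmult_1_r (Cmod e)) at 2; apply Rmult_le_compat_l; auto.
      assert (H : forall s n, sumR (seq s n) (fun m => if Nat.eqb m (d - 1) then 1 else 0) <= 1 /\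
        ((d - 1 < s)%nat -> sumR (seq s n) (fun m => if Nat.eqb m (d - 1) then 1 else 0) = 0)).
      { intros s n; revert s; induction n as [|n IH]; intros s; [unfold sumR; simpl; lra|].
        change (sumR (seq s (S n)) (fun m => if Nat.eqb m (d - 1) then 1 else 0))
          with ((if Nat.eqb s (d - 1) then 1 else 0) +
                sumR (seq (S s) n) (fun m => if Nat.eqb m (d - 1) then 1 else 0)).
        destruct (IH (S s)) as [I1 I2]; destruct (Nat.eqb_spec s (d - 1)).
        - rewrite I2 by lia; split; [lra|lia].
        - split; [lra|intros Hs; rewrite I2 by lia; lra]. }
      apply H.
    - intros m _; rewrite Cmod_mult, Cmod_R; unfold upvec; destruct (Nat.eqb m (d - 1));
        [rewrite Rabs_R1|rewrite Rabs_R0]; lra. }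
  assert (Hv : sumR (seq 0 d) (fun c => wt d c * Cmod (rhs d g k b e c)) <=
    sumR (seq 0 d) (fun c => (Cmod (b c) + sb) +
      (g * Cmod (Cmult e (RtoC (upvec d c))) + g * Cmod e))).
  { apply sumR_le; intros c Hc; apply in_seq in Hc; unfold wt, rhs.
    destruct (Nat.ltb_spec c d); [|lia]; rewrite Rmult_1_l.
    eapply Rle_trans; [apply Cmod_triangle|]; apply Rplus_le_compat.
    - rewrite Cmod_opp; apply Cmod_leray; lia.
    - rewrite Cmod_mult, Cmod_R, Rabs_right, <- Rmult_plus_distr_l by lra.
      apply Rmult_le_compat_l; auto; eapply Rle_trans; [apply Cmod_leray; lia|lra]. }
  rewrite !sumR_plus, !sumR_const, sumR_scal, length_seq in Hv; fold sb in Hv.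
  assert (Hb := Cmod_ge_0 (b d)); assert (Hd := pos_INR d).
  rewrite S_INR.
  assert (g * sumR (seq 0 d) (fun m => Cmod (Cmult e (RtoC (upvec d m)))) <= g * Cmod e)
    by now apply Rmult_le_compat_l.
  assert (0 <= INR d * (64 * Cmod (b d))) by (apply Rmult_le_pos; lra).
  lra.
Qed.

Lemma sz_step d g n (W : nat -> VField) M k : 0 <= g -> (forall i, (i <= n)%nat ->
  bsum (sz d (W i)) (M i)) ->
  INR (S n) * sz d (step d g n W) k <=
  INR (S d) * (knorm d k * sumR (seq 0 (S n)) (fun i =>
     RS (fun j => sz d (W i) j * sz d (W (n - i)%nat) (vsub k j))) + g / 64 * sz d (W n) k).
Proof.
  intros Hg HM.
  assert (Hn : 0 < INR (S n)) by (apply lt_0_INR; lia).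
  apply Rle_trans with (sumR (seq 0 (S d)) (fun c => wt d c *
     Cmod (rhs d g k (bil_sum d W n k) (W n k d) c))).
  - unfold sz; rewrite <- sumR_scal; apply sumR_le; intros c _.
    replace (INR (S n) * (wt d c * _)) with (wt d c * (INR (S n) * Cmod (step d g n W k c))) by
      ring.
    apply Rmult_le_compat_l; [assert (A := wt_ge_1 d c); lra|].
    unfold step; destruct (andb _ _).
    + rewrite Cmod_mult, Cmod_R, Rabs_right by (apply Rle_ge, Rlt_le, Rinv_0_lt_compat; auto).
      rewrite <- Rmult_assoc, Rinv_r, Rmult_1_l by lra; apply Rle_refl.
    + rewrite Cmod_0, Rmult_0_r; apply Cmod_ge_0.
  - eapply Rle_trans; [now apply sz_rhs|].
    apply Rmult_le_compat_l; [apply pos_INR|]; apply Rplus_le_compat.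
    + rewrite <- sumR_scal.
      apply Rle_trans with (sumR (seq 0 (S n)) (fun i => sumR (seq 0 (S d)) (fun c =>
         wt d c * Cmod (bil d (W i) (W (n - i)%nat) k c)))).
      * rewrite sumR_exchange; apply sumR_le; intros c _.
        rewrite sumR_scal; apply Rmult_le_compat_l; [assert (A := wt_ge_1 d c); lra|].
        apply Cmod_sumC.
      * apply sumR_le; intros i Hi; apply in_seq in Hi.
        apply (sz_bil d _ _ (M i) (M (n - i)%nat)); apply HM; lia.
    (* Here the weight of the scalar pays off: its modulus is at most 1/64 of the size. *)
    + assert (A := wt_Cmod_le_sz d (W n) k d (le_n d)).
      assert (E1 : wt d d = 64) by (unfold wt; destruct (Nat.ltb_spec d d); [lia|easy]).
      rewrite E1 in A; replace (g / 64 * sz d (W n) k) with (g * (sz d (W n) k / 64)) by field.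
      apply Rmult_le_compat_l; lra.
Qed.

(** Origin of the constants: [d + 1 <= 4] from the projection; [4 * (n + 2) / (n + 1) <= 8] for the
    quadratic term, the factor [n + 2] coming from the strip width; [4 * g / 64 = g / 16] for
    buoyancy, where [beta0] compensates the missing power of [beta0 - beta]. *)
Definition ck_majorant (g beta0 A0 : R) : nat -> R :=
  cov A0 (fun n A => 8 * sumR (seq 0 (S n)) (fun i => A i * A (n - i)%nat) + g / 16 * beta0 * A n).

Lemma ck_majorant_S g beta0 A0 n : ck_majorant g beta0 A0 (S n) =
  8 * sumR (seq 0 (S n)) (fun i => ck_majorant g beta0 A0 i * ck_majorant g beta0 A0 (n - i)%nat) +
  g / 16 * beta0 * ck_majorant g beta0 A0 n.
Proof.
  apply (cov_S A0 (fun n A => 8 * sumR (seq 0 (S n)) (fun i =>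
    A i * A (n - i)%nat) + g / 16 * beta0 * A n)).
  intros H H' HH; rewrite (HH n) by lia; do 2 f_equal.
  apply sumR_ext; intros i Hi; apply in_seq in Hi; rewrite !HH by lia; auto.
Qed.

Lemma ck_majorant_nonneg g beta0 A0 n : 0 <= g -> 0 <= beta0 -> 0 <= A0 ->
  0 <= ck_majorant g beta0 A0 n.
Proof.
  intros Hg Hb HA; induction n as [n IH] using (well_founded_induction lt_wf).
  destruct n as [|n]; [exact HA|]; rewrite ck_majorant_S.
  apply Rplus_le_le_0_compat.
  - apply Rmult_le_pos; [lra|]; apply sumR_nonneg; intros i Hi; apply in_seq in Hi.
    apply Rmult_le_pos; apply IH; lia.
  - apply Rmult_le_pos; [apply Rmult_le_pos; lra|apply IH; lia].
Qed.

Lemma exp_pow_nat x n : exp x ^ n = exp (INR n * x).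
Proof.
  induction n as [|n IH]; [simpl; now rewrite Rmult_0_l, exp_0|].
  rewrite S_INR, <- tech_pow_Rmult, IH, <- exp_plus; f_equal; ring.
Qed.

(** The price of replacing [beta0 - beta'] by [beta0 - beta] in the [n]-th power; this factor [e]
    cancels the [1 / e] gained in bounding [x e^(-delta x)]. *)
Lemma one_plus_inv_pow_le n : (INR (n + 2) / INR (n + 1)) ^ n <= exp 1.
Proof.
  assert (H1 : 0 < INR (n + 1)) by (apply lt_0_INR; lia).
  assert (E : INR (n + 2) / INR (n + 1) = 1 + / INR (n + 1)).
  { rewrite !plus_INR in *; simpl in *; field; lra. }
  rewrite E.
  apply Rle_trans with (exp (/ INR (n + 1)) ^ n).
  - apply pow_incr; split; [assert (A := Rinv_0_lt_compat _ H1); lra|apply exp_ineq1_le].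
  - rewrite exp_pow_nat; apply exp_mono.
    apply Rmult_le_reg_r with (INR (n + 1)); auto.
    rewrite Rmult_assoc, Rinv_l, Rmult_1_r, Rmult_1_l by lra; apply le_INR; lia.
Qed.

(** Cauchy--Kovalevskaya: one derivative costs [1 / delta] on the strip of width [beta + delta];
    with [delta = (beta0 - beta) / (n + 2)] this is absorbed by the factor [1 / (n + 1)] of the
    Taylor recursion. *)
Lemma taylor_bound d g X0 beta0 A0 : (d <= 3)%nat -> 0 <= g -> 0 < beta0 -> 0 <= A0 ->
  nb d beta0 (sz d X0) A0 ->
  forall n beta, 0 <= beta < beta0 ->
    nb d beta (sz d (taylor d g X0 n)) (ck_majorant g beta0 A0 n / (beta0 - beta) ^ n).
Proof.
  intros Hd Hg Hb0 HA0 H0.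
  set (W := taylor d g X0); set (A := ck_majorant g beta0 A0).
  assert (HA : forall n, 0 <= A n) by (intros; apply ck_majorant_nonneg; lra).
  assert (Hd4 : INR (S d) <= 4) by (rewrite S_INR; apply le_INR in Hd; simpl in Hd; lra).
  assert (Hd0 := pos_INR (S d)).
  induction n as [n IH] using (well_founded_induction lt_wf); intros beta Hb.
  destruct n as [|n].
  - simpl pow; unfold Rdiv; rewrite Rinv_1, Rmult_1_r.
    apply (nb_mono_beta d beta beta0); auto using sz_nonneg; lra.
  - set (delta := (beta0 - beta) / INR (n + 2)); set (beta' := beta + delta).
    assert (N1 : 0 < INR (n + 1)) by (apply lt_0_INR; lia).
    assert (N2 : 0 < INR (n + 2)) by (apply lt_0_INR; lia).
    assert (N12 : INR (n + 2) = INR (n + 1) + 1) by (rewrite !plus_INR; simpl; lra).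
    assert (Hde : 0 < delta) by (apply Rdiv_lt_0_compat; lra).
    assert (Eb' : beta0 - beta' = (beta0 - beta) * (INR (n + 1) / INR (n + 2))).
    { unfold beta', delta; rewrite N12 in *; field; lra. }
    assert (Hb'0 : 0 < beta0 - beta').
    { rewrite Eb'; apply Rmult_lt_0_compat; [lra|now apply Rdiv_lt_0_compat]. }
    assert (Hb' : 0 <= beta' < beta0) by (unfold beta' in *; lra).
    assert (HB : forall i, (i <= n)%nat -> nb d beta' (sz d (W i)) (A i / (beta0 - beta') ^ i))
      by (intros; apply IH; auto; lia).
    set (Mb := fun i => A i / (beta0 - beta') ^ i) in *.
    assert (HM : forall i, (i <= n)%nat -> bsum (sz d (W i)) (Mb i)).
    { intros i Hi; apply (nb_bsum d beta'); auto using sz_nonneg; lra. }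
    set (Cv := fun i k => RS (fun j => sz d (W i) j * sz d (W (n - i)%nat) (vsub k j))).
    assert (HCv : forall i k, In i (seq 0 (S n)) -> 0 <= Cv i k).
    { intros i k Hi; apply in_seq in Hi; apply (RS_nonneg _ (Mb i * Mb (n - i)%nat)), bsum_conv;
        auto using sz_nonneg; apply HM; lia. }
    assert (HC : forall i, (i <= n)%nat -> nb d beta' (Cv i) (Mb i * Mb (n - i)%nat)).
    { intros i Hi; apply nb_conv; auto using sz_nonneg; [lra|apply HB; lia]. }
    (* The maximum of [x e^(-delta x)] is [1 / (e delta)], from [y <= exp (y - 1)] at
       [y = delta * x]. *)
    assert (Hx : forall k, knorm d k * exp (beta * knorm d k) <=
       / (exp 1 * delta) * exp (beta' * knorm d k)).
    { intros k; set (x := knorm d k).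
      assert (E1 : exp (beta' * x) = exp (beta * x) * (exp 1 * exp (delta * x - 1))).
      { rewrite <- !exp_plus; f_equal; unfold beta'; ring. }
      assert (E2 : delta * x <= exp (delta * x - 1)).
      { assert (T := exp_ineq1_le (delta * x - 1)); lra. }
      assert (P1 := exp_pos (beta * x)); assert (P2 := exp_pos 1).
      rewrite E1; apply Rmult_le_reg_l with (exp 1 * delta).
      - now apply Rmult_lt_0_compat.
      - rewrite <- Rmult_assoc with (r2 := / (exp 1 * delta)), Rinv_r, Rmult_1_l.
        2: apply Rgt_not_eq, Rmult_lt_0_compat; auto.
        replace (exp 1 * delta * (x * exp (beta * x))) with
          (exp (beta * x) * (exp 1 * (delta * x))) by ring.
        apply Rmult_le_compat_l; [lra|]; apply Rmult_le_compat_l; lra. }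
    assert (P1 := exp_pos 1).
    assert (HS : W (S n) = step d g n W) by apply taylor_S.
    intros l Hl; rewrite HS.
    assert (Hn : 0 < INR (S n)) by (apply lt_0_INR; lia).
    apply Rmult_le_reg_l with (INR (S n)); auto.
    rewrite <- sumR_scal.
    apply Rle_trans with (sumR l (fun k =>
       4 * (/ (exp 1 * delta) * sumR (seq 0 (S n)) (fun i => Cv i k * exp (beta' * knorm d k))) +
       4 * (g / 64 * (sz d (W n) k * exp (beta * knorm d k))))).
    { apply sumR_le; intros k _.
      rewrite <- Rmult_assoc.
      assert (St := sz_step d g n W Mb k Hg HM).
      assert (Pk := exp_pos (beta * knorm d k)).
      set (T := sumR (seq 0 (S n)) (fun i => Cv i k)).
      change (sumR (seq 0 (S n)) _) with T in St.
      assert (HT : 0 <= T) by (apply sumR_nonneg; auto).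
      assert (Hs := sz_nonneg d (W n) k); assert (Hk := knorm_pos d k).
      assert (HR : 0 <= knorm d k * T + g / 64 * sz d (W n) k).
      { apply Rplus_le_le_0_compat; apply Rmult_le_pos; auto; lra. }
      apply Rle_trans with (4 * (knorm d k * T + g / 64 * sz d (W n) k) * exp (beta * knorm d k)).
      - apply Rmult_le_compat_r; [lra|]; eapply Rle_trans; [exact St|].
        apply Rmult_le_compat_r; auto.
      - assert (E : sumR (seq 0 (S n)) (fun i => Cv i k * exp (beta' * knorm d k)) =
                    exp (beta' * knorm d k) * T).
        { unfold T; rewrite <- sumR_scal; apply sumR_ext; intros; ring. }
        rewrite E; specialize (Hx k).
        apply Rmult_le_compat_r with (r := T) in Hx; auto. lra. }
    rewrite sumR_plus, !sumR_scal, sumR_exchange.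
    assert (S1 : sumR (seq 0 (S n)) (fun i => sumR l (fun k => Cv i k * exp (beta' * knorm d k))) <=
       sumR (seq 0 (S n)) (fun i => A i * A (n - i)%nat) * / (beta0 - beta') ^ n).
    { rewrite Rmult_comm, <- sumR_scal; apply sumR_le; intros i Hi; apply in_seq in Hi.
      eapply Rle_trans; [apply (HC i ltac:(lia) l Hl)|]; unfold Mb.
      apply Req_le; replace n with (i + (n - i))%nat at 3 by lia; rewrite pow_add.
      field; split; apply pow_nonzero; lra. }
    (* Buoyancy loses no derivative, so it is estimated at [beta] itself. *)
    assert (S2 := IH n ltac:(lia) beta Hb l Hl); fold W A in S2.
    assert (EA : A (S n) = 8 * sumR (seq 0 (S n)) (fun i => A i * A (n - i)%nat) +
      g / 16 * beta0 * A n) by apply ck_majorant_S.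
    rewrite EA; clear EA.
    set (SA := sumR (seq 0 (S n)) (fun i => A i * A (n - i)%nat)) in *.
    assert (HSA : 0 <= SA) by (apply sumR_nonneg; intros; apply Rmult_le_pos; auto).
    assert (Pb : 0 < (beta0 - beta) ^ n) by (apply pow_lt; lra).
    assert (K1 : / (beta0 - beta') ^ n <= exp 1 * / (beta0 - beta) ^ n).
    { rewrite Eb', Rpow_mult_distr, Rinv_mult, Rmult_comm.
      apply Rmult_le_compat_r; [now apply Rlt_le, Rinv_0_lt_compat|].
      rewrite <- pow_inv; replace (/ (INR (n + 1) / INR (n + 2))) with (INR (n + 2) / INR (n + 1))
        by (field; lra).
      apply one_plus_inv_pow_le. }
    assert (K2 : / (exp 1 * delta) * (exp 1 * / (beta0 - beta) ^ n) =
       INR (n + 2) / (beta0 - beta) ^ S n).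
    { unfold delta; simpl pow; field; repeat split; lra. }
    assert (K3 : 4 * (/ (exp 1 * delta) * (SA * / (beta0 - beta') ^ n)) <=
       4 * (SA * (INR (n + 2) / (beta0 - beta) ^ S n))).
    { rewrite <- K2; apply Rmult_le_compat_l; [lra|].
      replace (SA * (/ (exp 1 * delta) * (exp 1 * / (beta0 - beta) ^ n))) with
        (/ (exp 1 * delta) * (SA * (exp 1 * / (beta0 - beta) ^ n))) by ring.
      apply Rmult_le_compat_l; [apply Rlt_le, Rinv_0_lt_compat, Rmult_lt_0_compat; auto|].
      apply Rmult_le_compat_l; auto. }
    assert (Pb1 : 0 < (beta0 - beta) ^ S n) by (apply pow_lt; lra).
    assert (Pi : 0 < / (beta0 - beta) ^ S n) by now apply Rinv_0_lt_compat.
    assert (K4 : A n / (beta0 - beta) ^ n <= beta0 * A n * / (beta0 - beta) ^ S n).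
    { replace (A n / (beta0 - beta) ^ n) with ((beta0 - beta) * A n * / (beta0 - beta) ^ S n)
        by (simpl pow; field; lra).
      apply Rmult_le_compat_r; [lra|]; apply Rmult_le_compat_r; auto; lra. }
    assert (HSn : INR (S n) = INR (n + 1)) by (f_equal; lia).
    assert (K5 : 4 * (SA * (INR (n + 2) / (beta0 - beta) ^ S n)) <=
       INR (S n) * (8 * SA * / (beta0 - beta) ^ S n)).
    { replace (4 * (SA * (INR (n + 2) / (beta0 - beta) ^ S n))) with
        (4 * INR (n + 2) * (SA * / (beta0 - beta) ^ S n)) by (unfold Rdiv; ring).
      replace (INR (S n) * (8 * SA * / (beta0 - beta) ^ S n)) with
        (INR (S n) * 8 * (SA * / (beta0 - beta) ^ S n)) by ring.
      apply Rmult_le_compat_r; [apply Rmult_le_pos; lra|].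
      rewrite HSn, N12; assert (1 <= INR (n + 1)) by (apply (le_INR 1); lia); lra. }
    assert (K6 : 4 * (g / 64 * sumR l (fun k => sz d (W n) k * exp (beta * knorm d k))) <=
       INR (S n) * (g / 16 * beta0 * A n * / (beta0 - beta) ^ S n)).
    { assert (Q0 : 0 <= beta0 * A n * / (beta0 - beta) ^ S n).
      { apply Rmult_le_pos; [apply Rmult_le_pos; auto; lra|lra]. }
      assert (Q1 : 1 <= INR (S n)) by (apply (le_INR 1); lia).
      apply Rle_trans with (g / 16 * (beta0 * A n * / (beta0 - beta) ^ S n)).
      - replace (4 * (g / 64 * sumR l (fun k => sz d (W n) k * exp (beta * knorm d k)))) with
          (g / 16 * sumR l (fun k => sz d (W n) k * exp (beta * knorm d k))) by field.
        apply Rmult_le_compat_l; [lra|]; lra.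
      - assert (Q2 : 0 <= g / 16 * (beta0 * A n * / (beta0 - beta) ^ S n)) by (apply Rmult_le_pos;
        lra).
        replace (g / 16 * beta0 * A n * / (beta0 - beta) ^ S n) with
          (g / 16 * (beta0 * A n * / (beta0 - beta) ^ S n)) by ring.
        nra. }
    assert (S1' : 4 * (/ (exp 1 * delta) * sumR (seq 0 (S n))
       (fun i => sumR l (fun k => Cv i k * exp (beta' * knorm d k)))) <=
       4 * (/ (exp 1 * delta) * (SA * / (beta0 - beta') ^ n))).
    { apply Rmult_le_compat_l; [lra|]; apply Rmult_le_compat_l; auto.
      apply Rlt_le, Rinv_0_lt_compat, Rmult_lt_0_compat; auto. }
    apply Rle_trans with (INR (S n) * (8 * SA * / (beta0 - beta) ^ S n) +
      INR (S n) * (g / 16 * beta0 * A n * / (beta0 - beta) ^ S n)); [lra|].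
    apply Req_le; unfold Rdiv; ring.
Qed.

(** The triangle of pairs with index sum below [N] lies in the square, and all terms are
    nonnegative. *)
Lemma cauchy_product_le (x y : nat -> R) N : (forall i, 0 <= x i) -> (forall i, 0 <= y i) ->
  sumR (seq 0 N) (fun n => sumR (seq 0 (S n)) (fun i => x i * y (n - i)%nat)) <=
  sumR (seq 0 N) x * sumR (seq 0 N) y.
Proof.
  intros Hx Hy.
  apply Rle_trans with (sumR (seq 0 N) (fun n => sumR (seq 0 N) (fun i =>
     x i * (if Nat.leb i n then y (n - i)%nat else 0)))).
  - apply sumR_le; intros n Hn; apply in_seq in Hn.
    apply Rle_trans with (sumR (seq 0 (S n)) (fun i =>
      x i * (if Nat.leb i n then y (n - i)%nat else 0))).
    + apply sumR_le; intros i Hi; apply in_seq in Hi; destruct (Nat.leb_spec i n); [lra|lia].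
    + apply sumR_incl_le; [|apply seq_NoDup|].
      * intros i; apply Rmult_le_pos; auto; destruct (Nat.leb i n); auto; lra.
      * intros i Hi; apply in_seq in Hi; apply in_seq; lia.
  - rewrite sumR_exchange, Rmult_comm, <- sumR_scal; apply sumR_le; intros i _.
    rewrite sumR_scal, Rmult_comm; apply Rmult_le_compat_r; auto.
    assert (E : sumR (seq 0 N) (fun n => if Nat.leb i n then y (n - i)%nat else 0) =
                sumR (seq 0 (N - i)) y).
    { induction N as [|N IH]; [easy|].
      rewrite sumR_seq_split, IH; destruct (Nat.leb_spec i N).
      - replace (S N - i)%nat with (S (N - i)) by lia; now rewrite sumR_seq_split.
      - replace (S N - i)%nat with O by lia; replace (N - i)%nat with O by lia; lra. }
    rewrite E; apply sumR_incl_le; auto using seq_NoDup.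
    intros m Hm; apply in_seq in Hm; apply in_seq; lia.
Qed.

(** Induction on partial sums: if the previous one is at most [2 * A0], the next is at most [A0 + /
    4 * (2 * A0) + / 4 * (2 * A0) = 2 * A0]. The quadratic quarter is [32 * rho * A0 / beta0] with
    [rho * A0 <= beta0 / 128], the buoyancy quarter is [g * rho / 8] with [g * rho <= 2]. *)
Lemma ck_majorant_sum g beta0 A0 rho N : 0 <= g -> 0 < beta0 -> 0 <= A0 -> 0 <= rho ->
  g * rho <= 2 -> rho * A0 <= beta0 / 128 ->
  sumR (seq 0 N) (fun n => ck_majorant g beta0 A0 n * (2 * rho / beta0) ^ n) <= 2 * A0.
Proof.
  intros Hg Hb HA Hr Hgr HrA.
  set (y := 2 * rho / beta0); set (B := fun n => ck_majorant g beta0 A0 n * y ^ n).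
  assert (Hy : 0 <= y) by (apply Rmult_le_pos; [lra|apply Rlt_le, Rinv_0_lt_compat; lra]).
  assert (HB : forall n, 0 <= B n).
  { intros n; apply Rmult_le_pos; [apply ck_majorant_nonneg; lra|now apply pow_le]. }
  change (sumR (seq 0 N) B <= 2 * A0).
  induction N as [|N IH]; [unfold sumR; simpl; lra|].
  change (seq 0 (S N)) with (O :: seq 1 N); rewrite <- seq_shift.
  change (sumR (O :: ?l) B) with (B O + sumR l B); rewrite sumR_map.
  assert (B0 : B O = A0) by (unfold B; simpl; unfold ck_majorant, cov; simpl; ring).
  rewrite (sumR_ext (seq 0 N) _ (fun n => 8 * y * sumR (seq 0 (S n)) (fun i =>
    B i * B (n - i)%nat) +
     g * rho / 8 * B n)).
  - rewrite sumR_plus, !sumR_scal.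
    assert (CP := cauchy_product_le B B N HB HB).
    set (S := sumR (seq 0 N) B) in *.
    assert (HS : 0 <= S) by (apply sumR_nonneg; auto).
    assert (H1 : S * S <= 2 * A0 * (2 * A0)) by (apply Rmult_le_compat; auto).
    assert (Hy8 : 8 * y * (2 * A0) <= / 4).
    { replace (8 * y * (2 * A0)) with (32 * (rho * A0) * / beta0) by (unfold y; field; lra).
      apply Rmult_le_reg_r with beta0; auto; rewrite Rmult_assoc, Rinv_l; lra. }
    assert (H2 : 8 * y * sumR (seq 0 N) (fun n => sumR (seq 0 (Datatypes.S n)) (fun i =>
      B i * B (n - i)%nat)) <=
       8 * y * (2 * A0 * (2 * A0))).
    { apply Rmult_le_compat_l; [lra|]; lra. }
    assert (H3 : 8 * y * (2 * A0) * (2 * A0) <= / 4 * (2 * A0)) by (apply Rmult_le_compat_r; lra).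
    assert (H4 : g * rho / 8 * S <= / 4 * S) by (apply Rmult_le_compat_r; lra).
    rewrite B0; lra.
  - intros n _; unfold B at 1; rewrite ck_majorant_S, Rmult_plus_distr_r; f_equal.
    + rewrite (sumR_ext _ (fun i => B i * B (n - i)%nat)
        (fun i => y ^ n * (ck_majorant g beta0 A0 i * ck_majorant g beta0 A0 (n - i)%nat))).
      * rewrite sumR_scal; simpl pow; ring.
      * intros i Hi; apply in_seq in Hi; unfold B.
        replace n with (i + (n - i))%nat at 3 by lia; rewrite pow_add; ring.
    + unfold B, y; simpl pow; field; lra.
Qed.

(** * The sum of the Taylor series *)

(** Absolute summability jointly in [n] and [k], tested on finite rectangles: the form in which sums
    over modes and over powers are exchanged. *)
Definition coef_bound (d : nat) (beta rho M : R) (W : nat -> VField) : Prop :=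
  forall ln lk, NoDup ln -> NoDup lk ->
    sumR ln (fun n => sumR lk (fun k => sz d (W n) k * exp (beta * knorm d k) * rho ^ n)) <= M.

(** Arbitrary scalar factors [a] cover the series, its derivative and the error of the difference
    quotient by the same estimates. *)
Definition lin (W : nat -> VField) (a : nat -> C) : VField :=
  fun k c => tsum (fun n => Cmult (W n k c) (a n)).

Definition ser (W : nat -> VField) (z : C) : VField := lin W (fun n => Cpow z n).

(** At [n = 0] the value [pred 0 = 0] is harmless, since the factor [INR 0] vanishes. *)
Definition dser (W : nat -> VField) (z : C) : VField :=
  lin W (fun n => Cmult (RtoC (INR n)) (Cpow z (pred n))).

Lemma Cmod_Cpow z n : Cmod (Cpow z n) = Cmod z ^ n.
Proof. induction n as [|n IH]; simpl; [apply Cmod_1|now rewrite Cmod_mult, IH]. Qed.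

Lemma state_Cmod_le_sz d X k c : is_state d X -> Cmod (X k c) <= sz d X k.
Proof.
  intros (H & _); destruct (Nat.le_gt_cases c d) as [Hc|Hc]; [now apply Cmod_le_sz|].
  rewrite H by lia; rewrite Cmod_0; apply sz_nonneg.
Qed.

Lemma coef_swap_bound d beta rho M W c lk ln : 0 <= rho -> coef_bound d beta rho M W ->
  (forall n, is_state d (W n)) -> NoDup lk -> NoDup ln ->
  sumR lk (fun k => sumR ln (fun n => exp (beta * knorm d k) * (Cmod (W n k c) * rho ^ n))) <= M.
Proof.
  intros Hr HB HW Hlk Hln; rewrite sumR_exchange.
  eapply Rle_trans; [|apply (HB ln lk Hln Hlk)].
  apply sumR_le; intros n _; apply sumR_le; intros k _.
  replace (sz d (W n) k * exp (beta * knorm d k) * rho ^ n) with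
    (exp (beta * knorm d k) * (sz d (W n) k * rho ^ n)) by ring.
  apply Rmult_le_compat_l; [apply Rlt_le, exp_pos|].
  apply Rmult_le_compat_r; [now apply pow_le|]; apply state_Cmod_le_sz, HW.
Qed.

Lemma coef_bsum d beta rho M W k c : 0 <= rho -> 0 <= beta -> coef_bound d beta rho M W ->
  (forall n, is_state d (W n)) ->
  bsum (fun n => exp (beta * knorm d k) * (Cmod (W n k c) * rho ^ n)) M.
Proof.
  intros Hr Hb HB HW ln Hln.
  assert (H := coef_swap_bound d beta rho M W c (k :: nil) ln Hr HB HW).
  unfold sumR at 1 in H; simpl in H; rewrite Rplus_0_r in H; apply H; auto.
  constructor; [easy|constructor].
Qed.

Lemma coef_bsum0 d beta rho M W k c : 0 <= rho -> 0 <= beta -> coef_bound d beta rho M W ->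
  (forall n, is_state d (W n)) -> bsum (fun n => Cmod (W n k c) * rho ^ n) M.
Proof.
  intros Hr Hb HB HW; eapply bsum_le; [|apply (coef_bsum d beta rho M W k c); auto].
  intros n; rewrite <- (Rmult_1_l (Cmod _ * _)) at 1; apply Rmult_le_compat_r.
  - apply Rmult_le_pos; [apply Cmod_ge_0|now apply pow_le].
  - apply exp_ge_1, Rmult_le_pos; auto; apply knorm_pos.
Qed.

Lemma lin_has_sum d beta rho M W a kap k c : 0 <= rho -> 0 <= beta -> coef_bound d beta rho M W ->
  (forall n, is_state d (W n)) -> 0 <= kap -> (forall n, Cmod (a n) <= kap * rho ^ n) ->
  has_sum (fun n => Cmult (W n k c) (a n)) (lin W a k c).
Proof.
  intros Hr Hb HB HW Hk Ha; apply (tsum_spec _ (kap * M)).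
  eapply bsum_le; [|apply bsum_scal; [exact Hk|apply (coef_bsum0 d beta rho M W k c); auto]].
  intros n; cbv beta; rewrite Cmod_mult, <- Rmult_assoc, (Rmult_comm kap), Rmult_assoc.
  apply Rmult_le_compat_l; [apply Cmod_ge_0|apply Ha].
Qed.

Lemma lin_l1 d beta rho M W a kap c l : 0 <= rho -> 0 <= beta -> coef_bound d beta rho M W ->
  (forall n, is_state d (W n)) -> 0 <= kap -> (forall n, Cmod (a n) <= kap * rho ^ n) -> NoDup l ->
  sumR l (fun k => Cmod (lin W a k c) * exp (beta * knorm d k)) <= kap * M.
Proof.
  intros Hr Hb HB HW Hk Ha Hl.
  set (F := fun k n => kap * (exp (beta * knorm d k) * (Cmod (W n k c) * rho ^ n))).
  assert (HF : forall k n, 0 <= F k n).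
  { intros; unfold F; apply Rmult_le_pos; auto; apply Rmult_le_pos; [apply Rlt_le, exp_pos|].
    apply Rmult_le_pos; [apply Cmod_ge_0|now apply pow_le]. }
  assert (BF : forall k, bsum (F k) (kap * M)).
  { intros k; apply bsum_scal; auto; now apply coef_bsum. }
  apply Rle_trans with (sumR l (fun k => RS (F k))).
  - apply sumR_le; intros k _.
    assert (HS := lin_has_sum d beta rho M W a kap k c Hr Hb HB HW Hk Ha).
    apply (has_sum_scal _ (RtoC (exp (beta * knorm d k)))) in HS.
    assert (E : Cmod (lin W a k c) * exp (beta * knorm d k) =
       Cmod (Cmult (RtoC (exp (beta * knorm d k))) (lin W a k c))).
    { rewrite Cmod_mult, Cmod_R, Rabs_right by (apply Rle_ge, Rlt_le, exp_pos); ring. }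
    rewrite E; apply (has_sum_bound _ _ _ HS).
    eapply bsum_le; [|apply (RS_ub _ _ (BF k))].
    intros n; cbv beta; unfold F.
    rewrite !Cmod_mult, Cmod_R, Rabs_right by (apply Rle_ge, Rlt_le, exp_pos).
    replace (kap * (exp (beta * knorm d k) * (Cmod (W n k c) * rho ^ n))) with
      (exp (beta * knorm d k) * (Cmod (W n k c) * (kap * rho ^ n))) by ring.
    apply Rmult_le_compat_l; [apply Rlt_le, exp_pos|].
    apply Rmult_le_compat_l; [apply Cmod_ge_0|apply Ha].
  - apply (sumR_RS_le l F (fun _ => kap * M)); auto; intros ln Hln.
    unfold F; rewrite (sumR_ext l _ (fun k => kap * sumR ln (fun n =>
      exp (beta * knorm d k) * (Cmod (W n k c) * rho ^ n)))) by (intros; apply sumR_scal).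
    rewrite sumR_scal; apply Rmult_le_compat_l; auto; now apply (coef_swap_bound d).
Qed.

Lemma lin_l1_0 d beta rho M W a kap c : 0 <= rho -> 0 <= beta -> coef_bound d beta rho M W ->
  (forall n, is_state d (W n)) -> 0 <= kap -> (forall n, Cmod (a n) <= kap * rho ^ n) ->
  bsum (fun k => Cmod (lin W a k c)) (kap * M).
Proof.
  intros Hr Hb HB HW Hk Ha l Hl.
  eapply Rle_trans; [|apply (lin_l1 d beta rho M W a kap c l); auto].
  apply sumR_le; intros k _; rewrite <- (Rmult_1_r (Cmod _)) at 1.
  apply Rmult_le_compat_l; [apply Cmod_ge_0|].
  apply exp_ge_1, Rmult_le_pos; auto; apply knorm_pos.
Qed.

Lemma Cpow_bound z rho n : Cmod z <= rho -> Cmod (Cpow z n) <= 1 * rho ^ n.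
Proof.
  intros H; rewrite Cmod_Cpow, Rmult_1_l; apply pow_incr; split; [apply Cmod_ge_0|auto].
Qed.

(** With [s = sqrt (R0 / rho)], Bernoulli's inequality for [/ s = 1 + a] gives [n s^n <= / a];
    squaring it takes care of both factors [n]. *)
Lemma square_geometric_bound R0 rho : 0 < R0 < rho ->
  exists K, 0 <= K /\ forall n, INR n ^ 2 * R0 ^ n <= K * rho ^ n.
Proof.
  intros HR; set (s := sqrt (R0 / rho)).
  assert (Hq : 0 < R0 / rho) by (apply Rdiv_lt_0_compat; lra).
  assert (Hs : 0 < s) by now apply sqrt_lt_R0.
  assert (Ess : s * s = R0 / rho) by (apply sqrt_sqrt; lra).
  assert (Hs1 : s < 1).
  { assert (R0 / rho < 1) by (apply Rmult_lt_reg_r with rho; [lra|]; unfold Rdiv;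
      rewrite Rmult_assoc, Rinv_l; lra).
    apply Rnot_le_lt; intros H1; nra. }
  set (a := / s - 1).
  assert (Ha : 0 < a).
  { unfold a; assert (1 < / s); [|lra]; rewrite <- Rinv_1; apply Rinv_lt_contravar; lra. }
  assert (Hns : forall n, INR n * s ^ n <= / a).
  { intros n; assert (H := poly n a Ha).
    replace (1 + a) with (/ s) in H by (unfold a; ring).
    rewrite pow_inv in H.
    assert (Ps : 0 < s ^ n) by now apply pow_lt.
    apply Rmult_le_reg_r with a; auto; rewrite Rinv_l by lra.
    apply Rmult_le_compat_r with (r := s ^ n) in H; [|lra].
    rewrite Rinv_l in H by lra. lra. }
  assert (Ia : 0 < / a) by now apply Rinv_0_lt_compat.
  exists (/ a * / a); split; [apply Rmult_le_pos; lra|]; intros n.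
  assert (ER : R0 = s * s * rho) by (rewrite Ess; field; lra).
  rewrite ER, !Rpow_mult_distr.
  replace (INR n ^ 2 * (s ^ n * s ^ n * rho ^ n)) with ((INR n * s ^ n) *
    (INR n * s ^ n) * rho ^ n) by ring.
  apply Rmult_le_compat_r; [apply pow_le; lra|].
  assert (0 <= INR n * s ^ n) by (apply Rmult_le_pos; [apply pos_INR|apply pow_le; lra]).
  apply Rmult_le_compat; auto.
Qed.

(** The remainder satisfies [P_(n+1) = (z + h) P_n + n z^(n-1) h^2], so it grows like [n^2].
    Multiplying by [R0 ^ 2] avoids the exponent [n - 2]. *)
Lemma Cpow_second_order z h R0 n : 0 < R0 -> Cmod z <= R0 -> Cmod (Cplus z h) <= R0 ->
  Cmod (Cminus (Cminus (Cpow (Cplus z h) n) (Cpow z n))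
    (Cmult (Cmult (RtoC (INR n)) (Cpow z (pred n))) h)) * R0 ^ 2 <=
  Cmod h ^ 2 * (INR n ^ 2 * R0 ^ n).
Proof.
  intros HR Hz Hzh; assert (Hh := Cmod_ge_0 h).
  induction n as [|n IH].
  - simpl; replace (Cminus _ _) with (RtoC 0) by ring; rewrite Cmod_0; lra.
  - set (P := Cminus (Cminus (Cpow (Cplus z h) n) (Cpow z n))
      (Cmult (Cmult (RtoC (INR n)) (Cpow z (pred n))) h)) in *.
    set (Q := Cmult (Cmult (RtoC (INR n)) (Cpow z (pred n))) (Cmult h h)).
    assert (E : Cminus (Cminus (Cpow (Cplus z h) (S n)) (Cpow z (S n)))
      (Cmult (Cmult (RtoC (INR (S n))) (Cpow z (pred (S n)))) h) = Cplus (Cmult (Cplus z h) P) Q).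
    { unfold P, Q; rewrite S_INR, RtoC_plus; simpl pred; simpl Cpow.
      destruct n as [|n]; [simpl; ring|simpl pred; simpl Cpow; ring]. }
    rewrite E.
    assert (HQ : Cmod Q * R0 ^ 2 <= Cmod h ^ 2 * (INR n * R0 ^ S n)).
    { unfold Q; rewrite !Cmod_mult, Cmod_R, Cmod_Cpow, Rabs_right by (apply Rle_ge, pos_INR).
      destruct n as [|n]; [simpl; lra|]; simpl pred.
      replace (INR (S n) * Cmod z ^ n * (Cmod h * Cmod h) * R0 ^ 2) with
        (Cmod h ^ 2 * (INR (S n) * (Cmod z ^ n * R0 ^ 2))) by ring.
      apply Rmult_le_compat_l; [apply pow2_ge_0|]; apply Rmult_le_compat_l; [apply pos_INR|].
      replace (R0 ^ S (S n)) with (R0 ^ n * R0 ^ 2) by (simpl; ring).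
      apply Rmult_le_compat_r; [apply pow2_ge_0|]; apply pow_incr; split; [apply Cmod_ge_0|auto]. }
    assert (HP : Cmod (Cmult (Cplus z h) P) * R0 ^ 2 <= R0 * (Cmod h ^ 2 * (INR n ^ 2 * R0 ^ n))).
    { rewrite Cmod_mult, Rmult_assoc; apply Rmult_le_compat; auto using Cmod_ge_0.
      apply Rmult_le_pos; [apply Cmod_ge_0|apply pow2_ge_0]. }
    apply Rle_trans with ((Cmod (Cmult (Cplus z h) P) + Cmod Q) * R0 ^ 2).
    { apply Rmult_le_compat_r; [apply pow2_ge_0|apply Cmod_triangle]. }
    rewrite S_INR.
    assert (0 <= Cmod h ^ 2 * (R0 ^ n * R0)).
    { apply Rmult_le_pos; [apply pow2_ge_0|]; apply Rmult_le_pos; [apply pow_le|]; lra. }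
    assert (Hn := pos_INR n).
    apply Rle_trans with (Cmod h ^ 2 * (R0 ^ n * R0) * (INR n ^ 2 + INR n)).
    + rewrite Rmult_plus_distr_r; simpl pow in *; lra.
    + replace (Cmod h ^ 2 * ((INR n + 1) ^ 2 * R0 ^ S n)) with
        (Cmod h ^ 2 * (R0 ^ n * R0) * (INR n + 1) ^ 2) by (simpl; ring).
      apply Rmult_le_compat_l; auto; nra.
Qed.

Lemma dpow_bound z R0 rho K n : 0 < R0 -> Cmod z <= R0 ->
  (forall n, INR n ^ 2 * R0 ^ n <= K * rho ^ n) ->
  Cmod (Cmult (RtoC (INR n)) (Cpow z (pred n))) <= K / R0 * rho ^ n.
Proof.
  intros HR Hz HK; rewrite Cmod_mult, Cmod_R, Cmod_Cpow, Rabs_right by (apply Rle_ge, pos_INR).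
  apply Rmult_le_reg_r with R0; auto.
  replace (K / R0 * rho ^ n * R0) with (K * rho ^ n) by (field; lra).
  eapply Rle_trans; [|apply HK].
  destruct n as [|n]; [simpl; lra|]; simpl pred.
  assert (1 <= INR (S n)) by (apply (le_INR 1); lia).
  assert (Hz0 : Cmod z ^ n <= R0 ^ n) by (apply pow_incr; split; [apply Cmod_ge_0|auto]).
  assert (P1 : 0 <= Cmod z ^ n) by (apply pow_le, Cmod_ge_0).
  rewrite Rmult_assoc; apply Rmult_le_compat.
  - lra.
  - apply Rmult_le_pos; lra.
  - nra.
  - simpl; rewrite Rmult_comm; apply Rmult_le_compat_l; lra.
Qed.

(** The error is again of the form [lin W a], where [a n] is the second-order remainder of [z^n]
    divided by [h]; the l^1 estimate for [lin] is therefore uniform over modes. The radius [R0],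
    halfway between [|z|] and [rho], leaves room for [z + h] and for the factor [n^2]. *)
Lemma ser_difference_quotient d beta rho M W z : 0 < rho -> 0 <= beta ->
  coef_bound d beta rho M W ->
  (forall n, is_state d (W n)) -> Cmod z < rho ->
  exists L delta, 0 <= L /\ 0 < delta /\ forall h, 0 < Cmod h < delta -> forall c,
    bsum (fun k => Cmod (Cminus (Cdiv (Cminus (ser W (Cplus z h) k c) (ser W z k c)) h)
       (dser W z k c))) (Cmod h * L).
Proof.
  intros Hr Hb HB HW Hz; assert (Hz0 := Cmod_ge_0 z).
  set (R0 := (Cmod z + rho) / 2).
  assert (HR : 0 < R0 < rho) by (unfold R0; lra).
  destruct (square_geometric_bound R0 rho HR) as (K & HK0 & HK).
  assert (HM : 0 <= M) by (apply (HB nil nil); constructor).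
  assert (PR : 0 < R0 ^ 2) by (apply pow_lt; lra).
  exists (K / R0 ^ 2 * M), (R0 - Cmod z); split; [|split].
  - apply Rmult_le_pos; auto; apply Rmult_le_pos; auto; now apply Rlt_le, Rinv_0_lt_compat.
  - unfold R0; lra.
  - intros h Hh c.
    assert (hn : h <> RtoC 0) by (intros E; subst h; rewrite Cmod_0 in Hh; lra).
    assert (Hzh : Cmod (Cplus z h) <= R0).
    { eapply Rle_trans; [apply Cmod_triangle|]; unfold R0 in *; lra. }
    set (a := fun n => Cminus (Cdiv (Cminus (Cpow (Cplus z h) n) (Cpow z n)) h)
      (Cmult (RtoC (INR n)) (Cpow z (pred n)))).
    assert (Ha : forall n, Cmod (a n) <= Cmod h * (K / R0 ^ 2) * rho ^ n).
    { intros n; unfold a.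
      assert (A := Cpow_second_order z h R0 n (proj1 HR) ltac:(unfold R0; lra) Hzh).
      match goal with |- Cmod ?x <= _ => replace x with (Cdiv (Cminus
        (Cminus (Cpow (Cplus z h) n) (Cpow z n))
        (Cmult (Cmult (RtoC (INR n)) (Cpow z (pred n))) h)) h) by (field; auto) end.
      rewrite Cmod_div by auto.
      apply Rmult_le_reg_r with (Cmod h * R0 ^ 2); [apply Rmult_lt_0_compat; lra|].
      match goal with |- ?x / _ * _ <= _ =>
        replace (x / Cmod h * (Cmod h * R0 ^ 2)) with (x * R0 ^ 2)
        by (field; lra) end.
      replace (Cmod h * (K / R0 ^ 2) * rho ^ n * (Cmod h * R0 ^ 2)) with
        (Cmod h ^ 2 * (K * rho ^ n)) by (field; lra).
      eapply Rle_trans; [exact A|]; apply Rmult_le_compat_l; [apply pow2_ge_0|apply HK]. }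
    assert (Hk1 : 0 <= Cmod h * (K / R0 ^ 2)).
    { apply Rmult_le_pos; [lra|]; apply Rmult_le_pos; auto; now apply Rlt_le, Rinv_0_lt_compat. }
    replace (Cmod h * (K / R0 ^ 2 * M)) with (Cmod h * (K / R0 ^ 2) * M) by ring.
    eapply bsum_le; [|apply (lin_l1_0 d beta rho M W a (Cmod h * (K / R0 ^ 2)) c); auto; lra].
    intros k; apply Req_le; f_equal.
    apply (has_sum_unique (fun n => Cmult (W n k c) (a n))).
    2: apply (lin_has_sum d beta rho M W a (Cmod h * (K / R0 ^ 2))); auto; lra.
    assert (S1 := lin_has_sum d beta rho M W (fun n => Cpow (Cplus z h) n) 1 k c ltac:(lra) Hb HB HW
      ltac:(lra) (fun n => Cpow_bound (Cplus z h) rho n ltac:(lra))).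
    assert (S2 := lin_has_sum d beta rho M W (fun n => Cpow z n) 1 k c ltac:(lra) Hb HB HW
      ltac:(lra) (fun n => Cpow_bound z rho n ltac:(lra))).
    assert (S3 := lin_has_sum d beta rho M W (fun n =>
      Cmult (RtoC (INR n)) (Cpow z (pred n))) (K / R0)
      k c ltac:(lra) Hb HB HW ltac:(apply Rmult_le_pos; [|apply Rlt_le, Rinv_0_lt_compat]; lra)
      (fun n => dpow_bound z R0 rho K n (proj1 HR) ltac:(unfold R0; lra) HK)).
    assert (S4 := has_sum_minus _ _ _ _ (has_sum_scal _ (Cinv h) _
      (has_sum_minus _ _ _ _ S1 S2)) S3).
    unfold ser, dser.
    eapply has_sum_ext; [|replace (Cdiv _ h) with (Cmult (Cinv h)
      (Cminus (lin W (fun n => Cpow (Cplus z h) n) k c) (lin W (fun n => Cpow z n) k c)))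
      by (unfold Cdiv; ring); exact S4].
    intros n; unfold a, Cdiv; ring.
Qed.

Lemma coef_state_bsum d beta rho M W n c : 0 < rho -> 0 <= beta -> coef_bound d beta rho M W ->
  (forall n, is_state d (W n)) -> bsum (fun k => Cmod (W n k c)) (M / rho ^ n).
Proof.
  intros Hr Hb HB HW l Hl.
  assert (P : 0 < rho ^ n) by now apply pow_lt.
  apply Rmult_le_reg_r with (rho ^ n); auto.
  replace (M / rho ^ n * rho ^ n) with M by (field; lra).
  assert (Hn : NoDup (n :: nil)) by (constructor; [easy|constructor]).
  assert (H := coef_swap_bound d beta rho M W c l (n :: nil) ltac:(lra) HB HW Hl Hn).
  eapply Rle_trans; [|exact H].
  rewrite Rmult_comm, <- sumR_scal; apply sumR_le; intros k _; unfold sumR; simpl;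
    rewrite Rplus_0_r.
  rewrite Rmult_comm.
  rewrite <- (Rmult_1_l (Cmod _ * _)) at 1; apply Rmult_le_compat_r.
  - apply Rmult_le_pos; [apply Cmod_ge_0|lra].
  - apply exp_ge_1, Rmult_le_pos; auto; apply knorm_pos.
Qed.

(** For each [j] the product of two power series is a Cauchy product in [n]; Fubini exchanges the
    sums over [j] and [n]. Absolute convergence uses a bound uniform in [j] for one factor and the
    joint bound for the other. *)
Lemma ser_product d beta rho M W z k m c : 0 < rho -> 0 <= beta -> coef_bound d beta rho M W ->
  (forall n, is_state d (W n)) -> Cmod z <= rho ->
  has_sum (fun j => Cmult (ser W z j m) (ser W z (vsub k j) c))
    (tsum (fun j => Cmult (ser W z j m) (ser W z (vsub k j) c))) /\
  has_sum (fun n => Cmult (Cpow z n) (sumC (seq 0 (S n)) (fun i =>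
      tsum (fun j => Cmult (W i j m) (W (n - i)%nat (vsub k j) c)))))
    (tsum (fun j => Cmult (ser W z j m) (ser W z (vsub k j) c))).
Proof.
  intros Hr Hb HB HW Hz.
  assert (HM : 0 <= M) by (apply (HB nil nil); constructor).
  assert (Hz0 := Cmod_ge_0 z).
  assert (B1 : forall c, bsum (fun k => Cmod (ser W z k c)) (1 * M)).
  { intros c'; apply (lin_l1_0 d beta rho M W); auto; try lra; intros; now apply Cpow_bound. }
  assert (H1 : has_sum (fun j => Cmult (ser W z j m) (ser W z (vsub k j) c))
    (tsum (fun j => Cmult (ser W z j m) (ser W z (vsub k j) c)))).
  { apply (tsum_spec _ (1 * M * (1 * M))).
    eapply bsum_le; [|apply (bsum_conv (fun j => Cmod (ser W z j m)) (fun j => Cmod (ser W z j c))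
      (1 * M) (1 * M) k); auto using Cmod_ge_0].
    intros j; cbv beta; rewrite Cmod_mult; lra. }
  split; auto.
  set (x := fun i j => Cmult (W i j m) (Cpow z i)).
  set (y := fun i j => Cmult (W i (vsub k j) c) (Cpow z i)).
  assert (Bterm : forall k c, bsum (fun n => Cmod (Cmult (W n k c) (Cpow z n))) M).
  { intros k' c'; eapply bsum_le; [|apply (coef_bsum0 d beta rho M W k' c'); auto; lra].
    intros n; cbv beta; rewrite Cmod_mult; apply Rmult_le_compat_l; [apply Cmod_ge_0|].
    rewrite <- (Rmult_1_l (rho ^ n)); now apply Cpow_bound. }
  refine (has_sum_fubini (fun j n => sumC (seq 0 (S n)) (fun i => Cmult (x i j) (y (n - i)%nat j)))
    (M * M) _ _ _ _ _ _ H1).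
  - intros la lb Hla Hlb.
    destruct (incl_seq lb) as [N HN].
    apply Rle_trans with (sumR la (fun j => M * sumR (seq 0 N) (fun i => Cmod (x i j)))).
    + apply sumR_le; intros j _.
      apply Rle_trans with (sumR (seq 0 N) (fun n => sumR (seq 0 (S n)) (fun i =>
        Cmod (x i j) * Cmod (y (n - i)%nat j)))).
      * eapply Rle_trans; [apply sumR_incl_le with (l' := seq 0 N); auto; intros; apply Cmod_ge_0|].
        apply sumR_le; intros n _; eapply Rle_trans; [apply Cmod_sumC|].
        apply sumR_le; intros i _; rewrite Cmod_mult; apply Rle_refl.
      * eapply Rle_trans; [apply (cauchy_product_le (fun i => Cmod (x i j)) (fun i =>
        Cmod (y i j)));
          intros; apply Cmod_ge_0|].
        rewrite Rmult_comm; apply Rmult_le_compat_r; [apply sumR_nonneg; intros; apply Cmod_ge_0|].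
        apply Bterm, seq_NoDup.
    + rewrite sumR_scal; apply Rmult_le_compat_l; auto.
      eapply Rle_trans; [|apply (coef_swap_bound d beta rho M W m la (seq 0 N));
        auto using seq_NoDup; lra].
      apply sumR_le; intros j _; apply sumR_le; intros i _; unfold x; rewrite Cmod_mult.
      rewrite <- (Rmult_1_l (Cmod _ * _)); apply Rmult_le_compat.
      * lra.
      * apply Rmult_le_pos; apply Cmod_ge_0.
      * apply exp_ge_1, Rmult_le_pos; auto; apply knorm_pos.
      * apply Rmult_le_compat_l; [apply Cmod_ge_0|].
        rewrite <- (Rmult_1_l (rho ^ i)); now apply Cpow_bound.
  - intros j; apply (has_sum_cauchy_product (fun i => x i j) (fun i => y i j) _ _ M).
    + apply Bterm.
    + apply Bterm.
    + apply (lin_has_sum d beta rho M W _ 1); auto; try lra; intros; now apply Cpow_bound.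
    + apply (lin_has_sum d beta rho M W _ 1); auto; try lra; intros; now apply Cpow_bound.
  - intros n; rewrite <- sumC_scal.
    apply (has_sum_sumC (seq 0 (S n)) (fun i j => Cmult (x i j) (y (n - i)%nat j))).
    intros i Hi; apply in_seq in Hi.
    eapply has_sum_ext; [|apply has_sum_scal, (tsum_spec _ (M / rho ^ i * (M / rho ^ (n - i))))].
    + intros j; cbv beta; unfold x, y; replace n with (i + (n - i))%nat at 1 by lia.
      rewrite Cpow_add_r; ring.
    + eapply bsum_le; [|apply (bsum_conv (fun j => Cmod (W i j m)) (fun j =>
      Cmod (W (n - i)%nat j c))
        _ _ k); auto using Cmod_ge_0; now apply (coef_state_bsum d beta)].
      intros j; cbv beta; rewrite Cmod_mult; lra.
Qed.

Lemma has_sum_leray {A} d k (a : A -> C) (b : A -> nat -> C) s c : (c < d)%nat ->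
  (forall m, (m < d)%nat -> has_sum (fun n => Cmult (a n) (b n m)) (s m)) ->
  has_sum (fun n => Cmult (a n) (leray d k (b n) c)) (leray d k s c).
Proof.
  intros Hc H; unfold leray; destruct (Rle_dec (knorm d k) 0) as [Hk|Hk].
  - apply has_sum_zero; intros; ring.
  - assert (H2 : has_sum (fun n => sumC (seq 0 d) (fun m =>
    Cmult (RtoC (IZR (k m))) (Cmult (a n) (b n m))))
      (sumC (seq 0 d) (fun m => Cmult (RtoC (IZR (k m))) (s m)))).
    { apply (has_sum_sumC (seq 0 d) (fun m n => Cmult (RtoC (IZR (k m))) (Cmult (a n) (b n m)))).
      intros m Hm; apply in_seq in Hm; apply has_sum_scal, H; lia. }
    assert (H3 := has_sum_minus _ _ _ _ (H c Hc) (has_sum_scal _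
      (Cdiv (RtoC (IZR (k c))) (RtoC (knorm d k ^ 2))) _ H2)).
    eapply has_sum_ext; [|replace (Cdiv (Cmult (RtoC (IZR (k c))) (sumC_lt d (fun m =>
      Cmult (RtoC (IZR (k m))) (s m))))
      (RtoC (knorm d k ^ 2))) with (Cmult (Cdiv (RtoC (IZR (k c))) (RtoC (knorm d k ^ 2)))
        (sumC (seq 0 d) (fun m => Cmult (RtoC (IZR (k m))) (s m)))) by (unfold sumC_lt, Cdiv;
          ring); exact H3].
    intros n; cbv beta; unfold sumC_lt.
    replace (sumC (seq 0 d) (fun m => Cmult (RtoC (IZR (k m))) (Cmult (a n) (b n m)))) with
      (Cmult (a n) (sumC (seq 0 d) (fun m => Cmult (RtoC (IZR (k m))) (b n m)))).
    + unfold Cdiv; ring.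
    + rewrite <- sumC_scal; apply sumC_ext; intros; ring.
Qed.

Lemma has_sum_rhs {A} d g k (a : A -> C) (b : A -> nat -> C) (e : A -> C) s t c : (c <= d)%nat ->
  (forall m, (m <= d)%nat -> has_sum (fun n => Cmult (a n) (b n m)) (s m)) ->
  has_sum (fun n => Cmult (a n) (e n)) t ->
  has_sum (fun n => Cmult (a n) (rhs d g k (b n) (e n) c)) (rhs d g k s t c).
Proof.
  intros Hc Hb He; unfold rhs; destruct (Nat.ltb_spec c d) as [Hcd|Hcd].
  - assert (H1 := has_sum_leray d k a b s c Hcd (fun m Hm => Hb m (Nat.lt_le_incl _ _ Hm))).
    assert (H2 := has_sum_leray d k a (fun n m => Cmult (e n) (RtoC (upvec d m)))
      (fun m => Cmult t (RtoC (upvec d m))) c Hcd).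
    assert (H2' : has_sum (fun n => Cmult (a n) (leray d k (fun m =>
      Cmult (e n) (RtoC (upvec d m))) c))
       (leray d k (fun m => Cmult t (RtoC (upvec d m))) c)).
    { apply H2; intros m _.
      rewrite Cmult_comm; eapply has_sum_ext; [|exact (has_sum_scal _ (RtoC (upvec d m)) _ He)].
      intros n; cbv beta; ring. }
    assert (H3 := has_sum_plus _ _ _ _ (has_sum_scal _ (Copp (RtoC 1)) _ H1)
      (has_sum_scal _ (RtoC g) _ H2')).
    eapply has_sum_ext; [|replace (Copp (leray d k s c)) with (Cmult (Copp (RtoC 1))
      (leray d k s c))
      by ring; exact H3].
    intros n; cbv beta; ring.
  - replace d with c by lia.
    eapply has_sum_ext; [|replace (Copp (s c)) with (Cmult (Copp (RtoC 1)) (s c)) by ring;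
      exact (has_sum_scal _ (Copp (RtoC 1)) _ (Hb c Hc))].
    intros n; cbv beta; ring.
Qed.

Lemma ser_equation d g beta rho M X0 z k : 0 < rho -> 0 <= beta ->
  coef_bound d beta rho M (taylor d g X0) -> is_state d X0 -> Cmod z < rho -> validk d k ->
  let X := ser (taylor d g X0) z in
  (forall c, has_sum (advt d X X k c) (bil d X X k c)) /\
  (forall c, (c <= d)%nat -> dser (taylor d g X0) z k c = rhs d g k (bil d X X k) (X k d) c).
Proof.
  intros Hr Hb HB HX0 Hz Hk X; set (W := taylor d g X0) in *.
  assert (HW : forall n, is_state d (W n)) by (intros; now apply taylor_is_state).
  assert (Hz0 := Cmod_ge_0 z).
  assert (PR : forall m c, _) by
    (intros m c; exact (ser_product d beta rho M W z k m c Hr Hb HB HW (Rlt_le _ _ Hz))).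
  fold X in PR.
  split.
  - intros c; unfold bil, advt.
    eapply has_sum_ext; [|apply has_sum_scal; unfold sumC_lt;
      apply (has_sum_sumC (seq 0 d) (fun m j => Cmult (RtoC (IZR (k m)))
         (Cmult (X j m) (X (vsub k j) c)))); intros m _; apply has_sum_scal, (PR m c)].
    intros j; cbv beta; f_equal; unfold sumC_lt.
    rewrite Cmult_comm, <- sumC_scal; apply sumC_ext; intros; ring.
  - assert (HBil : forall c, has_sum (fun n =>
    Cmult (Cpow z n) (bil_sum d W n k c)) (bil d X X k c)).
    { intros c; unfold bil at 1.
      eapply has_sum_ext; [|apply has_sum_scal; unfold sumC_lt;
        apply (has_sum_sumC (seq 0 d) (fun m n => Cmult (RtoC (IZR (k m))) (Cmult (Cpow z n)
         (sumC (seq 0 (S n)) (fun i => tsum (fun j =>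
           Cmult (W i j m) (W (n - i)%nat (vsub k j) c)))))));
        intros m _; apply has_sum_scal, (PR m c)].
      intros n; cbv beta; unfold bil_sum, bil, sumC_lt.
      rewrite sumC_scal.
      rewrite <- (sumC_exchange (seq 0 d) (seq 0 (S n)) (fun m i => Cmult (RtoC (IZR (k m)))
         (tsum (fun j => Cmult (W i j m) (W (n - i)%nat (vsub k j) c))))).
      rewrite Cmult_assoc, (Cmult_comm (Cpow z n)), <- Cmult_assoc; f_equal.
      rewrite <- sumC_scal; apply sumC_ext; intros m _; rewrite sumC_scal; ring. }
    intros c Hc.
    set (R0 := (Cmod z + rho) / 2).
    assert (HR : 0 < R0 < rho) by (unfold R0; lra).
    destruct (square_geometric_bound R0 rho HR) as (K & HK0 & HK).
    assert (S3 := lin_has_sum d beta rho M W (fun n =>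
      Cmult (RtoC (INR n)) (Cpow z (pred n))) (K / R0)
      k c ltac:(lra) Hb HB HW ltac:(apply Rmult_le_pos; [|apply Rlt_le, Rinv_0_lt_compat]; lra)
      (fun n => dpow_bound z R0 rho K n (proj1 HR) ltac:(unfold R0; lra) HK)).
    (* Dropping the vanishing term [n = 0] of the derivative series aligns its index with the
       recursion. *)
    apply has_sum_succ in S3.
    assert (S1 := lin_has_sum d beta rho M W (fun n => Cpow z n) 1 k d ltac:(lra) Hb HB HW
      ltac:(lra) (fun n => Cpow_bound z rho n ltac:(lra))).
    assert (S4 := has_sum_rhs d g k (fun n => Cpow z n) (fun n => bil_sum d W n k) (fun n =>
      W n k d)
      (bil d X X k) (X k d) c Hc (fun m _ => HBil m)
      (has_sum_ext _ _ _ (fun n => Cmult_comm _ _) S1)).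
    symmetry; apply (has_sum_unique _ _ _ S4).
    replace (dser W z k c) with (Cminus (lin W (fun n =>
      Cmult (RtoC (INR n)) (Cpow z (pred n))) k c)
      (Cmult (W O k c) (Cmult (RtoC (INR 0)) (Cpow z (pred 0))))) by (unfold dser; simpl; ring).
    eapply has_sum_ext; [|exact S3].
    intros n; cbv beta; simpl pred; unfold W at 1; rewrite taylor_S; fold W; unfold step.
    apply validb_spec in Hk; rewrite Hk; destruct (Nat.leb_spec c d); [|lia]; simpl andb; cbv iota.
    assert (Hn : RtoC (INR (S n)) <> RtoC 0).
    { intros E; apply RtoC_inj in E; apply (not_0_INR (S n)); [lia|auto]. }
    rewrite RtoC_inv by (apply not_0_INR; lia); field; auto.
Qed.

Lemma ser_zero W k c : ser W (RtoC 0) k c = W O k c.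
Proof.
  unfold ser, lin; apply tsum_eq.
  replace (W O k c) with (sumC (O :: nil) (fun n => Cmult (W n k c) (Cpow (RtoC 0) n))).
  - apply has_sum_finite; [constructor; [easy|constructor]|].
    intros n Hn; destruct n as [|n]; [exfalso; apply Hn; now left|simpl; ring].
  - unfold sumC; simpl; ring.
Qed.

Lemma ser_is_state d beta rho M W z : 0 < rho -> 0 <= beta -> coef_bound d beta rho M W ->
  (forall n, is_state d (W n)) -> Cmod z <= rho -> is_state d (ser W z).
Proof.
  intros Hr Hb HB HW Hz.
  assert (HS : forall k c, has_sum (fun n => Cmult (W n k c) (Cpow z n)) (ser W z k c)).
  { intros k c; apply (lin_has_sum d beta rho M W _ 1); auto; try lra; intros;
    now apply Cpow_bound. }
  split; [|split].
  - intros k c H; apply tsum_eq, has_sum_zero; intros n; rewrite (proj1 (HW n) k c H); ring.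
  - intros c; apply tsum_eq, has_sum_zero; intros n; rewrite (proj1 (proj2 (HW n)) c); ring.
  - intros k; unfold sumC_lt.
    apply (has_sum_unique (fun n => sumC (seq 0 d) (fun i => Cmult (RtoC (IZR (k i)))
      (Cmult (W n k i) (Cpow z n))))).
    + apply (has_sum_sumC (seq 0 d) (fun i n => Cmult (RtoC (IZR (k i)))
        (Cmult (W n k i) (Cpow z n)))); intros i _; apply has_sum_scal, HS.
    + apply has_sum_zero; intros n.
      assert (E := proj2 (proj2 (HW n)) k); unfold sumC_lt in E.
      rewrite (sumC_ext _ _ (fun i => Cmult (Cpow z n) (Cmult (RtoC (IZR (k i))) (W n k i))))
        by (intros; ring).
      rewrite sumC_scal, E; ring.
Qed.

(** * From Wiener bounds on the series to the stated notion of solution *)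

Lemma wpartial_vsq_l1 d w u B N : (forall k, 0 <= w k) -> 0 <= B ->
  (forall c, (c < d)%nat -> sumR (box d N) (fun k => sqrt (w k) * Cmod (u k c)) <= B) ->
  wpartial d w (vsq d u) N <= (2 * PI) ^ d * (INR d * B ^ 2).
Proof.
  intros Hw HB H; unfold wpartial; apply Rmult_le_compat_l.
  { assert (A := two_pi_pow_ge_1 d); lra. }
  rewrite (sumR_ext _ _ (fun k => sumR (seq 0 d) (fun c => (sqrt (w k) * Cmod (u k c)) ^ 2))).
  - rewrite sumR_exchange; replace (INR d) with (INR (length (seq 0 d))) by now rewrite length_seq.
    rewrite <- sumR_const; apply sumR_le; intros c Hc; apply in_seq in Hc.
    eapply Rle_trans; [apply sumR_sq_le|apply pow_incr; split].
    + intros k; apply Rmult_le_pos; [apply sqrt_pos|apply Cmod_ge_0].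
    + apply sumR_nonneg; intros; apply Rmult_le_pos; [apply sqrt_pos|apply Cmod_ge_0].
    + apply H; lia.
  - intros k _; unfold vsq, sum_lt; rewrite <- sumR_scal; apply sumR_ext; intros c _.
    rewrite Rpow_mult_distr, pow2_sqrt; auto.
Qed.

Lemma wpartial_ssq_l1 d w e B N : (forall k, 0 <= w k) -> 0 <= B ->
  sumR (box d N) (fun k => sqrt (w k) * Cmod (e k)) <= B ->
  wpartial d w (ssq e) N <= (2 * PI) ^ d * B ^ 2.
Proof.
  intros Hw HB H; unfold wpartial; apply Rmult_le_compat_l.
  { assert (A := two_pi_pow_ge_1 d); lra. }
  rewrite (sumR_ext _ _ (fun k => (sqrt (w k) * Cmod (e k)) ^ 2)).
  - eapply Rle_trans; [apply sumR_sq_le|apply pow_incr; split; auto].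
    + intros k; apply Rmult_le_pos; [apply sqrt_pos|apply Cmod_ge_0].
    + apply sumR_nonneg; intros; apply Rmult_le_pos; [apply sqrt_pos|apply Cmod_ge_0].
  - intros k _; unfold ssq; rewrite Rpow_mult_distr, pow2_sqrt; auto.
Qed.

Lemma gweight_nonneg d r beta k : 0 <= gweight d r beta k.
Proof.
  unfold gweight; destruct (Rle_dec (knorm d k) 0); [lra|].
  apply Rmult_le_pos; apply Rlt_le; apply exp_pos.
Qed.

(** Half of the radius pays for the power [|k|^r], by [ln y <= y - 1] at [y = |k| / q]; the value
    [q = 2 * r / beta] makes [2 * r * |k| / q] equal to [beta * |k|]. *)
Lemma gweight_exp_bound d r beta : 0 < r -> 0 < beta -> exists K, 0 <= K /\
  forall k, sqrt (gweight d r (beta / 2) k) <= K * exp (beta * knorm d k).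
Proof.
  intros Hr Hb; set (q := 2 * r / beta).
  assert (Hq : 0 < q) by (apply Rdiv_lt_0_compat; lra).
  exists (sqrt (exp (2 * r * ln q))); split; [apply sqrt_pos|]; intros k.
  assert (E : exp (beta * knorm d k) = sqrt (exp (2 * beta * knorm d k))).
  { replace (2 * beta * knorm d k) with (beta * knorm d k + beta * knorm d k) by ring.
    rewrite exp_plus, sqrt_square; auto; apply Rlt_le, exp_pos. }
  rewrite E, <- sqrt_mult by (apply Rlt_le, exp_pos).
  apply sqrt_le_1_alt; rewrite <- exp_plus; unfold gweight.
  destruct (Rle_dec (knorm d k) 0) as [H|H]; [apply Rlt_le, exp_pos|].
  unfold Rpower; rewrite <- exp_plus; apply exp_mono.
  set (x := knorm d k) in *.
  assert (L : ln (x / q) <= x / q - 1).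
  { assert (T := exp_ineq1_le (ln (x / q))); rewrite exp_ln in T by (apply Rdiv_lt_0_compat; lra);
    lra. }
  unfold Rdiv in L; rewrite ln_mult, ln_Rinv in L by (auto using Rinv_0_lt_compat; lra).
  assert (L2 : 2 * r * ln x <= 2 * r * (ln q + x * / q)) by (apply Rmult_le_compat_l; lra).
  assert (E3 : 2 * r * (x * / q) = beta * x) by (unfold q; field; lra).
  lra.
Qed.

Lemma ser_bouss_sol d r g beta rho M u0 eta0 : 0 < r -> 0 < rho -> 0 < beta ->
  inH d u0 -> inS d eta0 -> coef_bound d beta rho M (taylor d g (st d u0 eta0)) ->
  bouss_sol d r g rho u0 eta0
    (fun z k i => if Nat.ltb i d then ser (taylor d g (st d u0 eta0)) z k i else RtoC 0)
    (fun z k => ser (taylor d g (st d u0 eta0)) z k d).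
Proof.
  intros Hr Hrho Hb Hu He HB; set (X0 := st d u0 eta0) in *; set (W := taylor d g X0) in *.
  assert (HX0 : is_state d X0) by now apply st_is_state.
  assert (HW : forall n, is_state d (W n)) by (intros; now apply taylor_is_state).
  assert (HM : 0 <= M) by (apply (HB nil nil); constructor).
  assert (Hb' := Rlt_le _ _ Hb).
  split; [|split].
  - intros k i; destruct (Nat.ltb_spec i d) as [Hi|Hi].
    + rewrite ser_zero; change (W O k i) with (X0 k i); unfold X0; now rewrite inH_vel.
    + symmetry; apply Hu; lia.
  - intros k; rewrite ser_zero; change (W O k d) with (X0 k d); unfold X0; now rewrite inS_scal.
  - intros z Hz; set (X := ser W z).
    assert (HX : is_state d X) by (apply (ser_is_state d beta rho M); auto; lra).
    assert (L1 : forall c l, NoDup l ->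
       sumR l (fun k => Cmod (X k c) * exp (beta * knorm d k)) <= 1 * M).
    { intros c l Hl; apply (lin_l1 d beta rho M W _ 1); auto; try lra; intros.
      apply Cpow_bound; lra. }
    assert (L0 : forall c N, sumR (box d N) (fun k => sqrt 1 * Cmod (X k c)) <= M).
    { intros c N; assert (A := lin_l1_0 d beta rho M W (fun n => Cpow z n) 1 c ltac:(lra) Hb' HB HW
        ltac:(lra) (fun n => Cpow_bound z rho n ltac:(lra)) (box d N) (NoDup_box d N)).
      rewrite sqrt_1, Rmult_1_l in *; eapply Rle_trans; [|exact A].
      apply sumR_le; intros; rewrite Rmult_1_l; apply Rle_refl. }
    destruct HX as (HX1 & HX2 & HX3).
    assert (Hvel : forall N w B, (forall k, 0 <= w k) -> 0 <= B ->
      (forall c, sumR (box d N) (fun k => sqrt (w k) * Cmod (X k c)) <= B) ->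
      wpartial d w (vsq d (fun k i => if Nat.ltb i d then X k i else RtoC 0)) N <=
      (2 * PI) ^ d * (INR d * B ^ 2)).
    { intros N w B Hw HB0 H; apply wpartial_vsq_l1; auto; intros c Hc.
      destruct (Nat.ltb_spec c d); [apply H|lia]. }
    assert (HU : inH d (fun k i => if Nat.ltb i d then X k i else RtoC 0)).
    { split; [|split; [|split]].
      - intros k i H; destruct (Nat.ltb_spec i d); auto; apply HX1; intros [H1 H2]; tauto.
      - intros i; destruct (Nat.ltb i d); auto.
      - intros k; rewrite <- (HX3 k); apply sumC_lt_ext; intros i Hi.
        destruct (Nat.ltb_spec i d); [easy|lia].
      - exists ((2 * PI) ^ d * (INR d * M ^ 2)); intros N; apply Hvel; auto; intros; lra. }
    assert (HE : inS d (fun k => X k d)).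
    { split; [|split].
      - intros k H; apply HX1; tauto.
      - apply HX2.
      - exists ((2 * PI) ^ d * M ^ 2); intros N; apply wpartial_ssq_l1; auto; intros; lra. }
    split; [exact HU|split; [exact HE|split]].
    + exists (beta / 2); split; [lra|].
      destruct (gweight_exp_bound d r beta Hr Hb) as (K & HK & HKk).
      assert (G : forall c N, sumR (box d N) (fun k =>
        sqrt (gweight d r (beta / 2) k) * Cmod (X k c)) <= K * M).
      { intros c N; apply Rle_trans with (K * sumR (box d N) (fun k =>
        Cmod (X k c) * exp (beta * knorm d k))).
        - rewrite <- sumR_scal; apply sumR_le; intros k _.
          rewrite (Rmult_comm (Cmod _)), <- Rmult_assoc; apply Rmult_le_compat_r;
            [apply Cmod_ge_0|auto].
        - apply Rmult_le_compat_l; auto; rewrite <- (Rmult_1_l M); apply L1, NoDup_box. }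
      assert (0 <= K * M) by now apply Rmult_le_pos.
      split.
      * exists ((2 * PI) ^ d * (INR d * (K * M) ^ 2)); intros N; apply Hvel;
        auto using gweight_nonneg.
      * exists ((2 * PI) ^ d * (K * M) ^ 2); intros N; apply wpartial_ssq_l1;
        auto using gweight_nonneg.
    + exists (dser W z), (fun k => dser W z k d); split.
      * intros eps Heps.
        destruct (ser_difference_quotient d beta rho M W z Hrho Hb' HB HW Hz) as
          (L & delta & HL & Hd & HQ).
        (* [S d] in place of [d] lets one constant serve velocity and scalar; the minimum with 1 in
           [d1] gives [|h|^2 <= |h|]. *)
        set (Cd := (2 * PI) ^ d * (INR (S d) * L ^ 2)).
        assert (HCd : 0 <= Cd).
        { apply Rmult_le_pos; [assert (A := two_pi_pow_ge_1 d); lra|].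
          apply Rmult_le_pos; [apply pos_INR|apply pow2_ge_0]. }
        set (d1 := Rmin 1 (eps / (Cd + 1))).
        assert (Hd1 : 0 < d1) by (apply Rmin_glb_lt; [lra|apply Rdiv_lt_0_compat; lra]).
        exists (Rmin delta d1); split; [now apply Rmin_glb_lt|].
        intros h Hh Hzh N.
        assert (Hh1 : 0 < Cmod h < delta) by (assert (A := Rmin_l delta d1); lra).
        assert (Hh2 : Cmod h <= d1) by (assert (A := Rmin_r delta d1); lra).
        assert (Hh3 : Cmod h ^ 2 * Cd <= eps).
        { assert (A1 := Rmin_l 1 (eps / (Cd + 1))); assert (A2 := Rmin_r 1 (eps / (Cd + 1))).
          fold d1 in A1, A2.
          apply Rle_trans with (eps / (Cd + 1) * (Cd + 1)); [|apply Req_le; field; lra].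
          apply Rmult_le_compat; [apply pow2_ge_0|auto| |lra].
          simpl; nra. }
        assert (HhL : 0 <= Cmod h * L) by (apply Rmult_le_pos; lra).
        assert (P1 := two_pi_pow_ge_1 d).
        assert (Hsq : 0 <= (Cmod h * L) ^ 2) by apply pow2_ge_0.
        assert (Hdn := pos_INR d).
        assert (Etot : (2 * PI) ^ d * (INR (S d) * (Cmod h * L) ^ 2) = Cmod h ^ 2 * Cd)
          by (unfold Cd; ring).
        rewrite S_INR in Etot.
        split.
        -- apply Rle_trans with ((2 * PI) ^ d * (INR d * (Cmod h * L) ^ 2)).
           ++ apply wpartial_vsq_l1; auto; [intros; lra|]; intros c Hc.
              eapply Rle_trans; [|apply (HQ h Hh1 c (box d N) (NoDup_box d N))].
              apply sumR_le; intros k _; rewrite sqrt_1, Rmult_1_l; unfold dq_v.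
              destruct (Nat.ltb_spec c d); [apply Rle_refl|lia].
           ++ eapply Rle_trans; [|exact Hh3]; rewrite <- Etot.
              apply Rmult_le_compat_l; [lra|]; apply Rmult_le_compat_r; lra.
        -- apply Rle_trans with ((2 * PI) ^ d * (Cmod h * L) ^ 2).
           ++ apply wpartial_ssq_l1; auto; [intros; lra|].
              eapply Rle_trans; [|apply (HQ h Hh1 d (box d N) (NoDup_box d N))].
              apply sumR_le; intros k _; rewrite sqrt_1, Rmult_1_l; apply Rle_refl.
           ++ eapply Rle_trans; [|exact Hh3]; rewrite <- Etot.
              apply Rmult_le_compat_l; [lra|]; nra.
      * intros k Hk.
        destruct (ser_equation d g beta rho M X0 z k Hrho Hb' HB HX0 Hz Hk) as [Q1 Q2].
        fold W X in Q1, Q2.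
        assert (HXs : is_state d X) by (split; auto).
        assert (Est : st d (fun k i => if Nat.ltb i d then X k i else RtoC 0) (fun k => X k d) = X).
        { apply functional_extensionality; intros k'; apply functional_extensionality; intros c.
          unfold st; destruct (validb d k') eqn:Ev.
          - destruct (Nat.ltb_spec c d); auto; destruct (Nat.eqb_spec c d) as [->|]; auto.
            symmetry; apply HX1; lia.
          - symmetry; apply HX1; rewrite <- validb_spec, Ev; intros [? _]; easy. }
        assert (Hconv : forall c, conv_to d (advt d X X k c) (bil d X X k c)).
        { intros c; apply conv_to_has_sum; auto; intros j Hj; apply advt_invalid; auto; tauto. }
        exists (bil d X X k), (bil d X X k d); split; [|split; [|split]].
        -- intros i Hi.
           replace (adv_term_v d _ _ k i) with (advt d X X k i); auto.
           apply functional_extensionality; intros j.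
           rewrite (adv_term_v_st d _ (fun k => X k d)); auto; now rewrite Est.
        -- replace (adv_term_s d _ _ k) with (advt d X X k d); auto.
           apply functional_extensionality; intros j.
           rewrite adv_term_s_st; auto; now rewrite Est.
        -- intros i Hi; rewrite Q2 by lia; unfold rhs.
           destruct (Nat.ltb_spec i d); [easy|lia].
        -- rewrite Q2 by lia; unfold rhs; destruct (Nat.ltb_spec d d); [lia|easy].
Qed.

(** * From the Gevrey norm to the Wiener norm *)

(** Finiteness excludes the supremum [+oo], which [real] would send to 0. *)
Lemma wpartial_le_wnorm2 d w a N : wfinite d w a -> wpartial d w a N <= wnorm2 d w a.
Proof.
  intros [M HM]; unfold wnorm2.
  assert (H := Sup_seq_correct (fun N => Finite (wpartial d w a N))).
  destruct (Sup_seq _) as [l| |]; simpl in H |- *.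
  - apply le_epsilon; intros eps He; destruct (H (mkposreal eps He)) as [H1 _].
    apply Rlt_le, (H1 N).
  - destruct (H M) as [n Hn]; specialize (HM n); lra.
  - specialize (H (wpartial d w a N) N); lra.
Qed.

Lemma gev_pair_norm_bound d r beta u eta N :
  gev_fin_v d r beta u -> gev_fin_s d r beta eta ->
  sumR (box d N) (fun k => gweight d r beta k * (vsq d u k + ssq eta k)) <=
  gev_pair_norm d r beta u eta ^ 2.
Proof.
  intros Hu He; unfold gev_pair_norm.
  assert (A := wpartial_le_wnorm2 d _ _ N Hu); assert (B := wpartial_le_wnorm2 d _ _ N He).
  assert (P := two_pi_pow_ge_1 d).
  assert (HA : 0 <= sumR (box d N) (fun k => gweight d r beta k * vsq d u k)).
  { apply sumR_nonneg; intros; apply Rmult_le_pos; [apply gweight_nonneg|apply vsq_nonneg]. }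
  assert (HB : 0 <= sumR (box d N) (fun k => gweight d r beta k * ssq eta k)).
  { apply sumR_nonneg; intros; apply Rmult_le_pos; [apply gweight_nonneg|apply ssq_nonneg]. }
  unfold wpartial in A, B.
  rewrite (sumR_ext _ _ (fun k => gweight d r beta k * vsq d u k + gweight d r beta k * ssq eta k))
    by (intros; ring).
  rewrite sumR_plus, pow2_sqrt; nra.
Qed.

(** Cauchy--Schwarz against [|k|^(-r)]; as [2 * r > d + 1] the lattice sum is bounded uniformly
    in [r]. *)
Lemma wiener_of_gevrey d r beta f n N : (INR d + 1) / 2 < r -> 0 <= n ->
  (forall k, 0 <= f k) -> f zerok = 0 ->
  sumR (box d N) (fun k => gweight d r beta k * f k ^ 2) <= n ^ 2 ->
  sumR (box d N) (fun k => f k * exp (beta * knorm d k)) <= sqrt (lattice_const d) * n.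
Proof.
  intros Hr Hn Hf H0 HG.
  set (F := fun k => if Rle_dec (knorm d k) 0 then 0 else Rpower (knorm d k) (- r)).
  set (G := fun k => if Rle_dec (knorm d k) 0 then 0 else
     Rpower (knorm d k) r * exp (beta * knorm d k) * f k).
  rewrite (sumR_ext _ _ (fun k => F k * G k)).
  - apply cauchy_schwarz_sqrt; auto; [apply sqrt_pos| |].
    + rewrite pow2_sqrt.
      2:{ unfold lattice_const; apply Rmult_le_pos; apply pow_le; [apply pos_INR|lra]. }
      eapply Rle_trans; [|apply (lattice_sum d N)].
      apply sumR_le; intros k Hk; apply in_box in Hk as [_ Hk]; unfold F.
      destruct (Rle_dec (knorm d k) 0) as [Hx|Hx]; [lra|].
      (* Nonzero wavevectors have [|k| >= 1], so a larger exponent only lowers [|k|^(-2r)] below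
         [|k|^(-(d+1))]. *)
      assert (Hx1 : 1 <= knorm d k).
      { apply knorm_ge_1; auto; intros ->; apply Hx; rewrite knorm_zero; lra. }
      rewrite <- (Rpower_pow (S d) (knorm d k)), <- Rpower_Ropp by lra.
      simpl pow; rewrite Rmult_1_r, <- Rpower_plus.
      apply Rle_Rpower; auto; rewrite S_INR; lra.
    + eapply Rle_trans; [|exact HG]; apply Req_le, sumR_ext; intros k _; unfold G, gweight.
      destruct (Rle_dec (knorm d k) 0) as [Hx|Hx]; [ring|].
      rewrite !Rpow_mult_distr.
      replace (2 * r) with (r + r) by ring; rewrite Rpower_plus.
      replace (2 * beta * knorm d k) with (beta * knorm d k + beta * knorm d k) by ring.
      rewrite exp_plus; ring.
  - intros k Hk; apply in_box in Hk as [_ Hk]; unfold F, G.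
    destruct (Rle_dec (knorm d k) 0) as [Hx|Hx].
    + rewrite (knorm_le_0 d k Hk Hx), H0; ring.
    + rewrite <- !Rmult_assoc, <- Rpower_plus, Rplus_opp_l, Rpower_O by lra; ring.
Qed.

(** Each component is at most the whole pair in the Gevrey norm, and the weights add up to
    [d + 64]. *)
Lemma initial_wiener_bound d r beta u eta : (INR d + 1) / 2 < r ->
  inH d u -> inS d eta -> gev_fin_v d r beta u -> gev_fin_s d r beta eta ->
  nb d beta (sz d (st d u eta))
    ((INR d + 64) * (sqrt (lattice_const d) * gev_pair_norm d r beta u eta)).
Proof.
  intros Hr Hu He Gu Ge; set (n := gev_pair_norm d r beta u eta).
  assert (Hn : 0 <= n) by apply sqrt_pos.
  set (X := st d u eta); destruct (st_is_state d u eta Hu He) as (HX1 & HX2 & _); fold X in HX1,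
    HX2.
  apply bsum_box with (d := d).
  - intros k; apply Rmult_le_pos; [apply sz_nonneg|apply Rlt_le, exp_pos].
  - intros k Hk; unfold sz; rewrite sumR_zero; [ring|]; intros c _.
    rewrite HX1, Cmod_0 by tauto; ring.
  - intros N.
    apply Rle_trans with (sumR (seq 0 (S d)) (fun c => wt d c * (sqrt (lattice_const d) * n))).
    + rewrite (sumR_ext (box d N) _ (fun k => sumR (seq 0 (S d)) (fun c =>
        wt d c * (Cmod (X k c) * exp (beta * knorm d k))))).
      2:{ intros k _; unfold sz; rewrite Rmult_comm, <- sumR_scal; apply sumR_ext; intros; ring. }
      rewrite sumR_exchange; apply sumR_le; intros c Hc; apply in_seq in Hc; rewrite sumR_scal.
      apply Rmult_le_compat_l; [assert (A := wt_ge_1 d c); lra|].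
      apply (wiener_of_gevrey d r beta (fun k => Cmod (X k c))); auto using Cmod_ge_0.
      * now rewrite HX2, Cmod_0.
      * eapply Rle_trans; [|apply (gev_pair_norm_bound d r beta u eta N Gu Ge)].
        apply sumR_le; intros k Hk; apply in_box in Hk as [_ Hk].
        apply Rmult_le_compat_l; [apply gweight_nonneg|].
        assert (A := vsq_nonneg d u k); assert (B := ssq_nonneg eta k).
        destruct (Nat.eq_dec c d) as [->|Hcd].
        -- unfold X; rewrite st_scal by auto; unfold ssq in *; lra.
        -- unfold X; rewrite st_vel by (auto; lia).
           assert (Cmod (u k c) ^ 2 <= vsq d u k); [|lra].
           apply (sumR_in_le (seq 0 d) (fun i => Cmod (u k i) ^ 2)).
           ++ intros; apply pow2_ge_0.
           ++ apply in_seq; lia.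
    + rewrite sumR_seq_split.
      rewrite (sumR_ext (seq 0 d) _ (fun _ => sqrt (lattice_const d) * n)).
      * rewrite sumR_const, length_seq; unfold wt; destruct (Nat.ltb_spec d d); [lia|].
        apply Req_le; ring.
      * intros c Hc; apply in_seq in Hc; unfold wt; destruct (Nat.ltb_spec c d); [ring|lia].
Qed.

(** At [beta = beta0 / 2] the bound on the [n]-th coefficient carries [(2 / beta0)^n], hence the
    argument [2 * rho / beta0] of the majorant series. *)
Lemma taylor_coef_bound d g X0 beta0 A0 rho : (d <= 3)%nat -> 0 <= g -> 0 < beta0 -> 0 <= A0 ->
  0 <= rho -> g * rho <= 2 -> rho * A0 <= beta0 / 128 -> nb d beta0 (sz d X0) A0 ->
  coef_bound d (beta0 / 2) rho (2 * A0) (taylor d g X0).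
Proof.
  intros Hd Hg Hb HA Hr Hgr HrA H0 ln lk Hln Hlk.
  set (B := fun n => ck_majorant g beta0 A0 n * (2 * rho / beta0) ^ n).
  assert (HB : forall n, 0 <= B n).
  { intros n; apply Rmult_le_pos; [apply ck_majorant_nonneg; lra|]; apply pow_le.
    apply Rmult_le_pos; [lra|apply Rlt_le, Rinv_0_lt_compat; lra]. }
  apply Rle_trans with (sumR ln B).
  - apply sumR_le; intros n _.
    rewrite (sumR_ext lk _ (fun k =>
      rho ^ n * (sz d (taylor d g X0 n) k * exp (beta0 / 2 * knorm d k))))
      by (intros; ring).
    rewrite sumR_scal.
    assert (A := taylor_bound d g X0 beta0 A0 Hd Hg Hb HA H0 n (beta0 / 2) ltac:(lra) lk Hlk).
    apply Rle_trans with (rho ^ n * (ck_majorant g beta0 A0 n / (beta0 - beta0 / 2) ^ n)).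
    + apply Rmult_le_compat_l; auto; now apply pow_le.
    + apply Req_le; unfold B; replace (beta0 - beta0 / 2) with (beta0 / 2) by field.
      unfold Rdiv; rewrite !Rpow_mult_distr, !pow_inv; field; split; apply pow_nonzero; lra.
  - destruct (incl_seq ln) as [N HN].
    eapply Rle_trans; [apply (sumR_incl_le ln (seq 0 N)); auto|].
    now apply ck_majorant_sum.
Qed.

(** The quotient in [CW] exceeds 1, its denominator being positive and smaller by 1 than its
    numerator. *)
Lemma CW_lower d r : (INR d + 1) / 2 < r -> / (PI * 2 ^ (d - 1)) <= CW d r.
Proof.
  intros Hr; unfold CW; assert (HPI := PI_RGT_0).
  assert (P : 0 < / (PI * 2 ^ (d - 1))).
  { apply Rinv_0_lt_compat, Rmult_lt_0_compat; [lra|apply pow_lt; lra]. }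
  rewrite <- (Rmult_1_r (/ (PI * 2 ^ (d - 1)))) at 1; apply Rmult_le_compat_l; [lra|].
  apply Rmult_le_reg_r with (2 * r - 1 - INR d); [lra|].
  unfold Rdiv; rewrite Rmult_assoc, Rinv_l; lra.
Qed.

Lemma ln_2_lt_1 : ln 2 < 1.
Proof.
  rewrite <- (ln_exp 1); apply ln_increasing; [lra|].
  assert (H := exp_ineq1 1); lra.
Qed.

(** Product of the losses: 128 from the majorant series, [(d + 64) * sqrt (lattice_const d)] from
    the initial data, and [PI * 2 ^ (d - 1)] from the lower bound on [CW]. The [+ 1] makes
    positivity immediate. *)
Definition radius_const (d : nat) : R :=
  / (128 * ((INR d + 64) * (sqrt (lattice_const d) + 1)) * (PI * 2 ^ (d - 1))).

Lemma radius_const_pos d : 0 < radius_const d.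
Proof.
  apply Rinv_0_lt_compat; assert (H := sqrt_pos (lattice_const d)); assert (H1 := pos_INR d).
  assert (HPI := PI_RGT_0).
  apply Rmult_lt_0_compat.
  - apply Rmult_lt_0_compat; [lra|apply Rmult_lt_0_compat; lra].
  - apply Rmult_lt_0_compat; [lra|apply pow_lt; lra].
Qed.

Lemma region_radius_spec d r beta0 g u eta : (INR d + 1) / 2 < r -> 0 < beta0 -> 0 < g ->
  let rho := region_radius d (radius_const d) r beta0 g u eta in
  0 < rho /\ g * rho <= 2 /\
  rho * ((INR d + 64) * (sqrt (lattice_const d) * gev_pair_norm d r beta0 u eta)) <= beta0 / 128.
Proof.
  intros Hr Hb Hg rho.
  set (n := gev_pair_norm d r beta0 u eta); assert (Hn : 0 <= n) by apply sqrt_pos.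
  assert (Hl2 : 0 < ln 2) by (rewrite <- ln_1; apply ln_increasing; lra).
  assert (Hl2' := ln_2_lt_1).
  assert (Hlg : 0 < 2 * ln 2 / g) by (apply Rdiv_lt_0_compat; lra).
  assert (Hgl : g * (2 * ln 2 / g) <= 2).
  { replace (g * (2 * ln 2 / g)) with (2 * ln 2) by (field; lra); lra. }
  assert (E : rho = if Rle_dec n 0 then 2 * ln 2 / g
    else Rmin (radius_const d * beta0 / (Rpower 2 r * CW d r * n)) (2 * ln 2 / g)) by reflexivity.
  clearbody rho; destruct (Rle_dec n 0) as [Hn0|Hn0]; subst rho.
  - split; [exact Hlg|split; [exact Hgl|]].
    replace n with 0 by lra; rewrite !Rmult_0_r; lra.
  - assert (HPI := PI_RGT_0); assert (HC := CW_lower d r Hr).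
    set (p := PI * 2 ^ (d - 1)) in *.
    assert (Hp : 0 < p) by (apply Rmult_lt_0_compat; [lra|apply pow_lt; lra]).
    assert (Hip : 0 < / p) by now apply Rinv_0_lt_compat.
    assert (Hd0 := pos_INR d).
    assert (H2r : 1 <= Rpower 2 r).
    { rewrite <- (Rpower_O 2) by lra; apply Rle_Rpower; lra. }
    assert (Hs := sqrt_pos (lattice_const d)).
    assert (Hrc := radius_const_pos d).
    set (D := Rpower 2 r * CW d r * n) in *.
    assert (HD : / p * n <= D).
    { unfold D; apply Rmult_le_compat_r; auto.
      rewrite <- (Rmult_1_l (/ p)); apply Rmult_le_compat; lra. }
    assert (HD0 : 0 < D).
    { eapply Rlt_le_trans; [|exact HD]; apply Rmult_lt_0_compat; lra. }
    set (q := radius_const d * beta0 / D) in *; set (rho := Rmin q (2 * ln 2 / g)).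
    assert (Hq : 0 < q) by (apply Rdiv_lt_0_compat; auto; now apply Rmult_lt_0_compat).
    assert (R1 : rho <= q) by apply Rmin_l.
    assert (R2 : rho <= 2 * ln 2 / g) by apply Rmin_r.
    assert (R0 : 0 < rho) by now apply Rmin_glb_lt.
    split; [exact R0|split].
    + eapply Rle_trans; [|exact Hgl]; apply Rmult_le_compat_l; lra.
    + set (s := sqrt (lattice_const d)) in *.
      apply Rle_trans with (q * ((INR d + 64) * ((s + 1) * n))).
      * apply Rmult_le_compat; try lra.
        -- repeat apply Rmult_le_pos; lra.
        -- apply Rmult_le_compat_l; [lra|]; apply Rmult_le_compat_r; lra.
      * apply Rmult_le_reg_r with D; auto.
        (* The constant is made so that the left side is exactly [beta0 / 128] times the lower bound
           [/ p * n] for [D]. *)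
        replace (q * ((INR d + 64) * ((s + 1) * n)) * D) with (beta0 / 128 * (/ p * n)).
        -- apply Rmult_le_compat_l; lra.
        -- unfold q, radius_const; fold s p; field; repeat split; lra.
Qed.

Theorem theorem5p1 :
  forall d : nat, (d = 2%nat \/ d = 3%nat) ->
  exists Cst : R, 0 < Cst /\
  forall (r beta0 g : R) (u0 : VField) (eta0 : SField),
    (INR d + 1) / 2 < r -> 0 < beta0 -> 0 < g ->
    inH d u0 -> real_v u0 -> inS d eta0 -> real_s eta0 ->
    gev_fin_v d r beta0 u0 -> gev_fin_s d r beta0 eta0 ->
    exists (U : C -> VField) (E : C -> SField),
      bouss_sol d r g (region_radius d Cst r beta0 g u0 eta0) u0 eta0 U E /\
      (forall (U' : C -> VField) (E' : C -> SField),
         bouss_sol d r g (region_radius d Cst r beta0 g u0 eta0) u0 eta0 U' E' ->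
         forall z, Cmod z < region_radius d Cst r beta0 g u0 eta0 ->
           (forall k i, U' z k i = U z k i) /\ (forall k, E' z k = E z k)).
Proof.
  intros d Hd; exists (radius_const d); split; [apply radius_const_pos|].
  intros r beta0 g u0 eta0 Hr Hb Hg Hu _ He _ Gu Ge.
  (* Gives [d + 1 <= 4], the numerical factor built into the recursion of [ck_majorant]. *)
  assert (Hd3 : (d <= 3)%nat) by lia.
  assert (Hd0 := pos_INR d).
  destruct (region_radius_spec d r beta0 g u0 eta0 Hr Hb Hg) as (R0 & R1 & R2).
  set (rho := region_radius d (radius_const d) r beta0 g u0 eta0) in *.
  assert (HA := initial_wiener_bound d r beta0 u0 eta0 Hr Hu He Gu Ge).
  assert (HA0 := bsum_pos _ _ HA).
  assert (HB := taylor_coef_bound d g _ beta0 _ rho Hd3 (Rlt_le _ _ Hg) Hb HA0 (Rlt_le _ _ R0) R1 R2 HA).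
  assert (HS := ser_bouss_sol d r g (beta0 / 2) rho _ u0 eta0 ltac:(lra) R0 ltac:(lra) Hu He HB).
  do 2 eexists; split; [exact HS|].
  intros U' E' HS'; exact (bouss_sol_unique d r g rho u0 eta0 _ _ _ _ (Rlt_le _ _ Hg) HS HS').
Qed.
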